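(* Let $\Bbbk$ be an algebraically closed field with $\operatorname{char}(\Bbbk)\neq2$, let $i\in\Bbbk$ be a primitive fourth root of unity, and let $H$ be the $\Bbbk$-algebra on (degree-one) generators $x,y,z$ with defining relations $$y^2=x^2,\qquad zy=-i\,yz,\qquad yx-xy=i\,z^2.$$ Then $H$ is a regular graded skew Clifford algebra and a twist of a graded Clifford algebra by an automorphism.
   Context: Regular algebras. A graded $\Bbbk$-algebra $A=\bigoplus_{n\ge 0}A_n$ with $A_0=\Bbbk$, generated by the finite-dimensional space $A_1$, is regular (in the sense of Artin–Schelter) of global dimension $d$ if it has finite global dimension $d$, has polynomial growth, and is Gorenstein, i.e. $\operatorname{Ext}^i_A(\Bbbk,A)=0$ for $i\ne d$ and $\operatorname{Ext}^d_A(\Bbbk,A)\cong\Bbbk$ up to a degree shift. It is quadratic if its defining relations are spanned by a subspace of $A_1\otimes_\Bbbk A_1$. Twists. If $D$ is a graded algebra and $\phi$ is a graded degree-zero automorphism of $D$, the twist $D^\phi$ of $D$ by $\phi$ has the same underlying graded vector space and multiplication determined by $a*b=a\,\phi(b)$ for $a,b\in D_1$ (in general $a*b=a\,\phi^m(b)$ for $a\in D_m$). Graded skew Clifford algebras ($\operatorname{char}(\Bbbk)\ne2$). Let $\mu=(\mu_{ij})\in M(n,\Bbbk)$ with $\mu_{ij}\in\Bbbk^\times$, $\mu_{ij}\mu_{ji}=1$ for $i\neq j$, $\mu_{ii}=1$. A matrix $M$ is $\mu$-symmetric if $M_{ij}=\mu_{ij}M_{ji}$ for all $i,j$. Given $\mu$-symmetric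 matrices $M_1,\dots,M_n$, an associated graded skew Clifford algebra is a graded $\Bbbk$-algebra on degree-one generators $x_1,\dots,x_n$ and degree-two generators $y_1,\dots,y_n$ with defining relations given by: (a) $x_ix_j+\mu_{ij}x_jx_i=\sum_{k=1}^n (M_k)_{ij}y_k$ for all $i,j$; and (b) the existence of a normalizing sequence $\{r_1,\dots,r_n\}$ of homogeneous degree-two elements spanning $\Bbbk y_1+\cdots+\Bbbk y_n$ (normalizing: the image of $r_{k+1}$ is a normal element in the quotient by $\langle r_1,\dots,r_k\rangle$ for each $k\geq 0$). If $\mu_{ij}=1$ for all $i,j$ and all the $y_k$ are central, the algebra is called a graded Clifford algebra. A regular graded skew Clifford algebra is a graded skew Clifford algebra that is quadratic and regular. *)

(* Defs.v *)
From HB Require Import structures.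
From mathcomp Require Import all_boot all_order all_algebra.
From mathcomp Require Import finmap.
From mathcomp.multinomials Require Import monalg.

Set Implicit Arguments.
Unset Strict Implicit.
Unset Printing Implicit Defensive.

Import GRing.Theory.
Local Open Scope ring_scope.

Notation free_alg K I := {malg K[{fmonom I}]}.

Definition fgen (K : fieldType) (I : choiceType) (i : I) : free_alg K I :=
  << fmu i >>.

Definition feval (K : fieldType) (I : choiceType) (A : algType K) (g : I -> A)
    (p : free_alg K I) : A :=
  mmap (in_alg A) (fun w : {fmonom I} => \prod_(i <- (w : seq I)) g i) p.

Definition homogeneous (K : fieldType) (I : choiceType) (wt : I -> nat)
    (n : nat) (p : free_alg K I) : Prop :=
  forall w : {fmonom I}, w \in msupp p -> (\sum_(i <- (w : seq I)) wt i)%N = n.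

Inductive ideal_gen (R : nzRingType) (X : R -> Prop) : R -> Prop :=
| IdealZero : ideal_gen X 0
| IdealGen a x b : X x -> ideal_gen X (a * x * b)
| IdealAdd p q : ideal_gen X p -> ideal_gen X q -> ideal_gen X (p + q).

Definition presents (K : fieldType) (I : choiceType) (A : algType K)
    (g : I -> A) (R : free_alg K I -> Prop) : Prop :=
  (forall a : A, exists p, feval g p = a) /\
  (forall p, feval g p = 0 <-> ideal_gen R p).

Definition is_grading (J : eqType) (V : zmodType) (gr : J -> V -> Prop) : Prop :=
  [/\ forall j, gr j 0,
      forall j u v, gr j u -> gr j v -> gr j (u - v),
      forall v, exists (s : seq J) (f : J -> V),
        (forall j, gr j (f j)) /\ v = \sum_(j <- s) f j
    & forall (s : seq J) (f : J -> V), (forall j, gr j (f j)) -> uniq s ->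
        \sum_(j <- s) f j = 0 -> forall j, j \in s -> f j = 0].

Record graded_alg (K : fieldType) := GradedAlg {
  galg :> algType K;
  gr : nat -> galg -> Prop;
  gr_grading : is_grading gr;
  gr_scale : forall n (c : K) a, gr n a -> gr n (c *: a);
  gr_one : gr 0 1;
  gr_mul : forall m n a b, gr m a -> gr n b -> gr (m + n) (a * b)
}.
Arguments gr {K} A n a : rename.

Definition spans (K : fieldType) (V : lmodType K) (m : nat) (v : 'I_m -> V)
    (S : V -> Prop) : Prop :=
  forall a, S a -> exists c : 'I_m -> K, a = \sum_(j < m) c j *: v j.

Definition connected (K : fieldType) (A : graded_alg K) : Prop :=
  forall a : A, gr A 0 a <-> exists c : K, a = c%:A.

Definition generated_in_degree_one (K : fieldType) (A : graded_alg K) : Prop :=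
  exists (m : nat) (g : 'I_m -> A),
    [/\ forall j, gr A 1 (g j), spans g (gr A 1)
      & forall a : A, exists p, feval g p = a].

Definition polynomial_growth (K : fieldType) (A : graded_alg K) : Prop :=
  exists c e : nat, forall n,
    exists v : 'I_(c * n.+1 ^ e) -> A, spans v (gr A n).

Definition quadratic (K : fieldType) (A : graded_alg K) : Prop :=
  exists (m : nat) (g : 'I_m -> A) (R : free_alg K 'I_m -> Prop),
    [/\ forall j, gr A 1 (g j),
        forall p, R p -> homogeneous (fun=> 1%N) 2 p
      & presents g R].

(* All modules are left modules. *)
Definition projective (R : nzRingType) (P : lmodType R) : Prop :=
  forall (M N : lmodType R) (g : {linear M -> N}) (f : {linear P -> N}),
    (forall v, exists u, g u = v) ->
    exists h : {linear P -> M}, forall u, g (h u) = f u.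

Record resolution (R : nzRingType) (M : lmodType R) := Resolution {
  res :> nat -> lmodType R;
  res_d : forall n, {linear res n.+1 -> res n};
  res_aug : {linear res 0 -> M};
  res_proj : forall n, projective (res n);
  res_aug_surj : forall v, exists u, res_aug u = v;
  res_exact0 : forall u, res_aug u = 0 <-> exists v, u = res_d 0 v;
  res_exact : forall n u, res_d n u = 0 <-> exists v, u = res_d n.+1 v
}.
Arguments res_d {R M} P n : rename.
Arguments res_aug {R M} P : rename.

Definition pd_le (R : nzRingType) (M : lmodType R) (n : nat) : Prop :=
  exists P : resolution M, forall m, (n < m)%N -> forall u : P m, u = 0.

Definition global_dimension (R : nzRingType) (d : nat) : Prop :=
  (forall M : lmodType R, pd_le M d) /\
  (forall e, (forall M : lmodType R, pd_le M e) -> (d <= e)%N).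

Definition grz (K : fieldType) (A : graded_alg K) (j : int) (a : A) : Prop :=
  if j is Posz n then gr A n a else a = 0.

Definition graded_module (K : fieldType) (A : graded_alg K) (M : lmodType A)
    (h : int -> M -> Prop) : Prop :=
  is_grading h /\
  (forall (n : nat) (j : int) (a : A) u, gr A n a -> h j u ->
     h (n%:Z + j) (a *: u)).

(* M is the one-dimensional module k = A / A_{>0}. *)
Definition residue_module (K : fieldType) (A : graded_alg K)
    (M : lmodType A) : Prop :=
  exists t : M,
    [/\ t <> 0, forall u, exists c : K, u = (c%:A : A) *: t
      & forall n a, (0 < n)%N -> gr A n a -> a *: t = 0].

(* A graded resolution of k, with k placed in degree 0. *)
Definition graded_resolution (K : fieldType) (A : graded_alg K)
    (M : lmodType A) (P : resolution M)
    (h : forall n, int -> P n -> Prop) : Prop :=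
  [/\ forall n, graded_module (h n),
      forall n j u, h n.+1 j u -> h n j (res_d P n u)
    & forall j u, j != 0 -> h 0%N j u -> res_aug P u = 0].

Section GradedExt.
Variables (K : fieldType) (A : graded_alg K) (M : lmodType A).
Variables (P : resolution M) (h : forall n, int -> P n -> Prop).

Definition cochain_of_degree (l : int) (i : nat)
    (f : {linear P i -> (A^o : lmodType A)}) : Prop :=
  forall j u, h j u -> grz (A := A) (j + l) (f u).

Definition cocycle (l : int) (i : nat)
    (f : {linear P i -> (A^o : lmodType A)}) : Prop :=
  cochain_of_degree l f /\ forall u, f (res_d P i u) = 0.

Definition coboundary (l : int) (i : nat) : (P i -> A) -> Prop :=
  if i is i'.+1 then fun f =>
    exists2 e : {linear P i' -> (A^o : lmodType A)},
      cochain_of_degree l e & forall u, f u = e (res_d P i' u)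
  else fun f => forall u, f u = 0.

(* Ext^i(k, A)_l = 0 *)
Definition Ext_zero (i : nat) (l : int) : Prop :=
  forall f : {linear P i -> (A^o : lmodType A)},
    cocycle l f -> coboundary l (f : P i -> A).

(* dim Ext^i(k, A)_l = 1 *)
Definition Ext_one_dim (i : nat) (l : int) : Prop :=
  exists f0 : {linear P i -> (A^o : lmodType A)},
    [/\ cocycle l f0, ~ coboundary l (f0 : P i -> A)
      & forall f : {linear P i -> (A^o : lmodType A)}, cocycle l f ->
          exists c : K, coboundary l (fun u => (f u : A) - c *: (f0 u : A))].
End GradedExt.

(* Ext^i(k, A)_l is the cohomology of the A-linear maps P_i -> A of degree l.
   Ext does not depend on the resolution, so one graded projective resolution
   is used to compute it. A graded right module whose underlying graded vector
   space is one-dimensional is automatically a shift of k. *)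
Definition gorenstein (K : fieldType) (A : graded_alg K) (d : nat) : Prop :=
  exists (M : lmodType A) (P : resolution M) (h : forall n, int -> P n -> Prop),
    [/\ residue_module M, graded_resolution h
      & exists2 l : int, Ext_one_dim h d l
          & forall i m, (i, m) != (d, l) -> Ext_zero h i m].

Definition regular (K : fieldType) (A : graded_alg K) (d : nat) : Prop :=
  [/\ connected A, generated_in_degree_one A, global_dimension A d,
      polynomial_growth A & gorenstein A d].

Definition central (R : nzRingType) (r : R) : Prop := forall a, r * a = a * r.

Definition normalizing_sequence (R : nzRingType) (n : nat)
    (r : 'I_n -> R) : Prop :=
  forall k : 'I_n,
    let J := ideal_gen (fun s => exists2 l : 'I_n, (l < k)%N & s = r l) in
    (forall a, exists b, J (r k * a - b * r k)) /\
    (forall a, exists b, J (a * r k - r k * b)).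

Section Clifford.
Variables (K : fieldType) (n : nat).

Definition skew_param (mu : 'M[K]_n) : Prop :=
  [/\ forall i j, mu i j != 0, forall i j, i != j -> mu i j * mu j i = 1
    & forall i, mu i i = 1].

Definition mu_symmetric (mu M : 'M[K]_n) : Prop :=
  forall i j, M i j = mu i j * M j i.

(* Generators: inl i stands for x_i and inr k for y_k. *)
Notation cgen := ('I_n + 'I_n)%type.
Notation X i := (fgen K (inl i : cgen)).
Notation Y k := (fgen K (inr k : cgen)).

Definition cweight (s : cgen) : nat := if s is inl _ then 1 else 2.

Definition clifford_rel (mu : 'M[K]_n) (M : 'I_n -> 'M[K]_n)
    (p : free_alg K cgen) : Prop :=
  exists i j, p = X i * X j + mu i j *: (X j * X i) - \sum_k M k i j *: Y k.

Definition ycomb (C : 'M[K]_n) (k : 'I_n) : free_alg K cgen :=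
  \sum_l C k l *: Y l.

(* A homogeneous relation which says that, for some k, the product of ycomb C k
   with some generator s, on one side, is a multiple of ycomb C k from the
   other side, modulo the ideal of the ycomb C l with l < k. Since s has degree
   1 or 2, such relations have degree 3 or 4. *)
Definition normality_rel (C : 'M[K]_n) (p : free_alg K cgen) : Prop :=
  exists (k : 'I_n) (s : cgen) (f w : free_alg K cgen),
    [/\ homogeneous cweight (cweight s) f,
        homogeneous cweight (2 + cweight s) w,
        ideal_gen (fun q => exists2 l : 'I_n, (l < k)%N & q = ycomb C l) w
      & p = ycomb C k * fgen K s - f * ycomb C k - w \/
        p = fgen K s * ycomb C k - ycomb C k * f - w].

(* The relations (b), collected in B, express that r_1, ..., r_n is a
   normalizing sequence, where r_k = \sum_l C k l *: y_l. *)
Definition gsca_on (mu : 'M[K]_n) (M : 'I_n -> 'M[K]_n) (A : graded_alg K)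
    (x y : 'I_n -> A) : Prop :=
  let g (s : cgen) := match s with inl i => x i | inr k => y k end in
  [/\ skew_param mu, forall k, mu_symmetric mu (M k),
      (forall i, gr A 1 (x i)) /\ (forall k, gr A 2 (y k))
    & exists (C : 'M[K]_n) (B : free_alg K cgen -> Prop),
        let r := fun k => \sum_l C k l *: y l in
        [/\ forall p, B p -> normality_rel C p,
            presents g (fun p => clifford_rel mu M p \/ B p),
            normalizing_sequence r
          & spans r (fun a => exists k, a = y k)]].
End Clifford.

Definition graded_skew_clifford (K : fieldType) (A : graded_alg K) : Prop :=
  exists (n : nat) (mu : 'M[K]_n) (M : 'I_n -> 'M[K]_n) (x y : 'I_n -> A),
    gsca_on mu M x y.

Definition graded_clifford (K : fieldType) (A : graded_alg K) : Prop :=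
  exists (n : nat) (M : 'I_n -> 'M[K]_n) (x y : 'I_n -> A),
    gsca_on (const_mx 1) M x y /\ forall k, central (y k).

Definition regular_gsca (K : fieldType) (A : graded_alg K) : Prop :=
  [/\ graded_skew_clifford A, quadratic A & exists d, regular A d].

Definition graded_automorphism (K : fieldType) (D : graded_alg K)
    (phi : {lrmorphism D -> D}) : Prop :=
  bijective phi /\ forall m a, gr D m a -> gr D m (phi a).

(* H is isomorphic, as a graded algebra, to the twist of D by phi: f is the
   isomorphism, read on the underlying graded vector space of D. *)
Definition is_twist (K : fieldType) (H D : graded_alg K)
    (phi : {lrmorphism D -> D}) : Prop :=
  exists f : {linear D -> H},
    [/\ bijective f, forall m a, gr D m a -> gr H m (f a)
      & forall m a b, gr D m a -> f (a * iter m phi b) = f a * f b].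

Definition H_rel (K : fieldType) (i : K) (p : free_alg K 'I_3) : Prop :=
  let x := fgen K (@inord 2 0) in
  let y := fgen K (@inord 2 1) in
  let z := fgen K (@inord 2 2) in
  [\/ p = y * y - x * x,
      p = z * y - (- i) *: (y * z)
    | p = y * x - x * y - i *: (z * z)].

(* Main.v *)
(** H is Koszul: the residue field has a resolution 0 -> H -> H^3 -> H^3 -> H.
    By Fox calculus in the free algebra, the presentation says that the linear
    syzygies of x, y, z are generated by the three relators; for these, common
    multiples of y and z and the regularity of y follow by a simultaneous
    induction on the degree, and give exactness in the remaining places. The
    opposite algebra satisfies the same relations with -i for i, so the dual
    complex is exact too, which is the Gorenstein property. For an arbitrary
    module M over H, with a basis over the base field, H (x) M is filtered by
    degree; the same complex, with differentials corrected by the action of the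
    generators on M, is exact because its leading terms are, so M has a
    resolution of length 3. No resolution of the residue field is shorter, since
    the last Koszul differential would split while its entries lie in the
    augmentation ideal.

    In H the elements x^2, z^2 and xz + i zx are normal, and adding them as
    generators turns the three relations into Clifford relations. Twisting H by
    the automorphism (x, y, z) |-> (x, -y, -i z) yields the algebra D with
    y^2 = - x^2, zy = - yz, yx + xy = - z^2, where x^2, z^2, xz + zx are central:
    D is a graded Clifford algebra, and H is its twist by the inverse
    automorphism. *)
Require Import Defs.
From HB Require Import structures.
From mathcomp Require Import all_boot all_order all_algebra.
From mathcomp Require Import finmap boolp classical_sets.
From mathcomp Require Import ring.
From mathcomp.multinomials Require Import monalg.
Set Implicit Arguments.
Unset Strict Implicit.
Unset Printing Implicit Defensive.
Import GRing.Theory.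
Local Open Scope ring_scope.

(** * Identities in noncommutative rings *)

(** No set of words is ever shown to be a basis of H. Exactness is drawn from the presentation
    itself: Fox derivatives turn membership in the relation ideal into syzygies over H, and for
    polynomial growth a spanning set of words is enough. The scalar i enters the computations as a
    central ring element [c] with c^2 = -1. Identities then have Gaussian integer coefficients on
    words and can be checked by computation; they carry over to the opposite algebra with [- c] for
    [c]. Global dimension quantifies over all modules, graded or not, so the complex must exist for
    every M. A basis of M over the field comes from Zorn's lemma, and only the leading terms of the
    differentials are homogeneous. For the twist D the difficulty is to show that its three
    relations suffice. The twisting automorphism is diagonal, so a word evaluated in D is a nonzero
    scalar times the same word evaluated in H; rescaling words carries one relation ideal to the
    other. A single parametrised family of relators gives the Clifford presentations of H and D
    together. *)

Inductive nc_term :=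
| NCvar of nat | NCroot | NC0 | NC1
| NCadd of nc_term & nc_term | NCopp of nc_term | NCmul of nc_term & nc_term.

Section NCNormal.
Variables (R : nzRingType) (c : R).
Hypothesis cC : forall a, c * a = a * c.
Hypothesis cc : c * c = -1.
Variable env : seq R.

Definition gauss := (int * int)%type.
Definition geval (u : gauss) : R := u.1%:~R + u.2%:~R * c.
Definition gadd (u v : gauss) : gauss := (u.1 + v.1, u.2 + v.2).
Definition gmul (u v : gauss) : gauss :=
  (u.1 * v.1 - u.2 * v.2, u.1 * v.2 + u.2 * v.1).

Lemma gevalD u v : geval (gadd u v) = geval u + geval v.
Proof. by rewrite /geval /= !rmorphD /= mulrDl addrACA. Qed.

Lemma gevalC u a : geval u * a = a * geval u.
Proof.
rewrite /geval mulrDl mulrDr -!mulrA cC; congr (_ + _).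
  exact: (esym (commr_int _ _)).
by rewrite mulrA -(commr_int a) mulrA.
Qed.

Lemma gevalM u v : geval (gmul u v) = geval u * geval v.
Proof.
rewrite /geval /= rmorphB rmorphD !rmorphM /= !mulrDl !mulrDr.
have E (a b : R) : a * c * (b * c) = - (a * b).
  by rewrite -mulrA (mulrA c) cC -!mulrA cc mulrN1 mulrN.
rewrite E -(mulrA _ c) cC (mulrA _ _ c) (mulrA u.1%:~R).
by rewrite -!addrA; congr (_ + _); rewrite addrC -!addrA.
Qed.

(** Words may be repeated and come in any order; [nc_coef] collects equal words only when the result
    is tested for zero, so no order on words is needed. *)
Definition nc_nf := seq (seq nat * gauss).
Definition nc_word (w : seq nat) : R := \prod_(k <- w) nth 0 env k.
Definition nf_eval (L : nc_nf) : R := \sum_(m <- L) geval m.2 * nc_word m.1.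

Fixpoint nc_eval (t : nc_term) : R :=
  match t with
  | NCvar k => nth 0 env k
  | NCroot => c
  | NC0 => 0
  | NC1 => 1
  | NCadd a b => nc_eval a + nc_eval b
  | NCopp a => - nc_eval a
  | NCmul a b => nc_eval a * nc_eval b
  end.

Fixpoint nc_norm (t : nc_term) : nc_nf :=
  match t with
  | NCvar k => [:: ([:: k], (1, 0))]
  | NCroot => [:: ([::], (0, 1))]
  | NC0 => [::]
  | NC1 => [:: ([::], (1, 0))]
  | NCadd a b => nc_norm a ++ nc_norm b
  | NCopp a => [seq (m.1, gmul (-1, 0) m.2) | m <- nc_norm a]
  | NCmul a b =>
    [seq (m.1 ++ n.1, gmul m.2 n.2) | m <- nc_norm a, n <- nc_norm b]
  end.

Lemma nc_normE t : nf_eval (nc_norm t) = nc_eval t.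
Proof.
have g1 : geval (1, 0) = 1 by rewrite /geval mul0r addr0.
rewrite /nf_eval; elim: t => /= [k||||a IHa b IHb|a IHa|a IHa b IHb].
- by rewrite big_seq1 /= g1 mul1r /nc_word big_seq1.
- by rewrite big_seq1 /= /geval mul1r add0r /nc_word big_nil mulr1.
- by rewrite big_nil.
- by rewrite big_seq1 /= g1 mul1r /nc_word big_nil.
- by rewrite big_cat /= IHa IHb.
- rewrite big_map /= -IHa -sumrN; apply: eq_bigr => m _.
  by rewrite gevalM {1}/geval mul0r addr0 mulN1r mulNr.
- rewrite big_allpairs_dep /= -IHa -IHb mulr_suml; apply: eq_bigr => m _.
  rewrite mulr_sumr; apply: eq_bigr => n _ /=.
  rewrite gevalM /nc_word big_cat /= -!mulrA; congr (_ * _).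
  by rewrite !mulrA gevalC.
Qed.

Definition nc_coef (w : seq nat) (L : nc_nf) : gauss :=
  foldr (fun m s => if m.1 == w then gadd m.2 s else s) (0, 0) L.

Lemma nc_zero (L : nc_nf) :
  all (fun w => nc_coef w L == (0, 0)) (undup (unzip1 L)) -> nf_eval L = 0.
Proof.
move=> /allP h.
have -> : nf_eval L =
    \sum_(w <- undup (unzip1 L)) geval (nc_coef w L) * nc_word w.
  have {h} : {subset unzip1 L <= undup (unzip1 L)}.
    by move=> w; rewrite mem_undup.
  move: (undup_uniq (unzip1 L)); move: (undup _) => s us.
  rewrite /nf_eval; elim: L => [_|m L IH hs].
    by rewrite big_nil big1 // => w _; rewrite /geval !mul0r addr0 mul0r.
  rewrite big_cons IH; last by move=> w hw; apply: hs; rewrite inE hw orbT.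
  have ms : m.1 \in s by apply: hs; rewrite inE eqxx.
  rewrite !(bigD1_seq m.1 ms us) /= eqxx gevalD addrA -mulrDl.
  by congr (_ + _); apply: eq_bigr => w hw; rewrite eq_sym (negPf hw).
by rewrite big_seq big1 // => w /h /eqP ->; rewrite /geval !mul0r addr0 mul0r.
Qed.

Lemma nc_correct t u :
  (let L := nc_norm (NCadd t (NCopp u)) in
   all (fun w => nc_coef w L == (0, 0)) (undup (unzip1 L))) ->
  nc_eval t = nc_eval u.
Proof. by move=> /nc_zero; rewrite nc_normE /= => /eqP; rewrite subr_eq0 => /eqP. Qed.
End NCNormal.

Ltac nc_index a l :=
  match l with
  | a :: _ => constr:(0%N)
  | _ :: ?t => let k := nc_index a t in constr:(k.+1)
  end.
Ltac nc_mem a l :=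
  match l with
  | a :: _ => constr:(true)
  | _ :: ?t => nc_mem a t
  | _ => constr:(false)
  end.
Ltac nc_atoms c t l :=
  match t with
  | c => l
  | GRing.add ?a ?b => let l := nc_atoms c a l in nc_atoms c b l
  | GRing.mul ?a ?b => let l := nc_atoms c a l in nc_atoms c b l
  | GRing.opp ?a => nc_atoms c a l
  | @GRing.zero _ => l
  | @GRing.one _ => l
  | ?a => match nc_mem a l with true => l | false => constr:(a :: l) end
  end.
Ltac nc_reify c t l :=
  match t with
  | c => constr:(NCroot)
  | GRing.add ?a ?b =>
    let p := nc_reify c a l in let q := nc_reify c b l in constr:(NCadd p q)
  | GRing.mul ?a ?b =>
    let p := nc_reify c a l in let q := nc_reify c b l in constr:(NCmul p q)
  | GRing.opp ?a => let p := nc_reify c a l in constr:(NCopp p)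
  | @GRing.zero _ => constr:(NC0)
  | @GRing.one _ => constr:(NC1)
  | ?a => let k := nc_index a l in constr:(NCvar k)
  end.
(* Decides identities of noncommutative rings with a central c, c ^ 2 = -1. *)
Ltac nc_ring cC cc :=
  match type of cc with @eq ?T (GRing.mul ?c ?c) _ =>
  match goal with |- ?t = ?u =>
    let l := nc_atoms c t (@nil T) in
    let l := nc_atoms c u l in
    let p := nc_reify c t l in
    let q := nc_reify c u l in
    let H := fresh "H" in
    have H := @nc_correct _ c cC cc l p q;
    cbv beta iota delta [nc_eval nth] in H;
    apply: H; vm_compute; reflexivity
  end end.

(** * Syzygies in an abstract filtered ring *)
Section KoszulRing.
Variables (R : nzRingType) (Fil : nat -> R -> Prop) (x y z c : R).
Hypothesis cC : forall a, c * a = a * c.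
Hypothesis cc : c * c = -1.
Hypothesis yy : y * y = x * x.
Hypothesis zy : z * y = - c * (y * z).
Hypothesis yx : y * x - x * y = c * (z * z).
Hypothesis Fil0 : forall a, Fil 0 a <-> a = 0.
Hypothesis FilB : forall n a b, Fil n a -> Fil n b -> Fil n (a - b).
Hypothesis FilZ : forall n a, Fil n a -> Fil n (c * a).
Hypothesis Filx : forall n a, Fil n a -> Fil n.+1 (a * x).
Hypothesis Filz : forall n a, Fil n a -> Fil n.+1 (a * z).
Hypothesis Fil_ex : forall a, exists n, Fil n a.
Hypothesis FilS : forall n a, Fil n a -> Fil n.+1 a.
Hypothesis E1 : forall n a b d, Fil n.+1 a -> Fil n.+1 b -> Fil n.+1 d ->
  a * x + b * y + d * z = 0 ->
  exists b1 b2 b3, [/\ Fil n b1, Fil n b2, Fil n b3 &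
  [/\ a = b3 * y - b1 * x, b = b1 * y + b2 * z - b3 * x & d = c * (b2 * y - b3 * z)]].

Lemma yz : y * z = c * (z * y).
Proof. by rewrite zy; nc_ring cC cc. Qed.

Lemma Fil_00 n : Fil n 0.
Proof. by elim: n => [|n IH]; [apply/Fil0 | apply: FilS]. Qed.

Lemma Fil_predx n a : Fil n.-1 a -> Fil n (a * x).
Proof.
by case: n => [/Fil0 ->|n]; [rewrite mul0r; apply/Fil0 | apply: Filx].
Qed.

Lemma Fil_predz n a : Fil n.-1 a -> Fil n (a * z).
Proof.
by case: n => [/Fil0 ->|n]; [rewrite mul0r; apply/Fil0 | apply: Filz].
Qed.

(** The two claims need each other. A syzygy (0, b, - d) yields by [E1] a common left multiple of x
    and y one degree lower, and a syzygy (a, - b, 0) yields one of y and z. *)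
Lemma common_left_multiples n :
  (forall b d, Fil n b -> Fil n d -> b * y = d * z ->
     exists a, [/\ Fil n.-1 a, b = c * (a * z) & d = a * y]) /\
  (forall a b, Fil n a -> Fil n b -> a * x = b * y ->
     exists d, [/\ Fil n.-1 d, a = d * x & b = d * y]).
Proof.
elim: n => [|n [IH1 IH2]].
  split=> a b /Fil0 -> /Fil0 -> _; exists 0; rewrite !mul0r ?mulr0.
    by split=> //; apply/Fil0.
  by split=> //; apply/Fil0.
split=> a b Fa Fb e.
- have [|b1 [b2 [b3 [F1 F2 F3 [e1 e2 e3]]]]] := E1 (Fil_00 _) Fa (FilB (Fil_00 _) Fb).
    by rewrite mul0r add0r e sub0r mulNr subrr.
  have [|d [Fd d1 d3]] := IH2 _ _ F1 F3.
    by apply/eqP; rewrite eq_sym -subr_eq0 -e1.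
  (* Substituting b1 = d x and b3 = d y gives b = (b2 - c d z) z, because y x - x y = c z^2; the
     factor - c is the inverse of c. *)
  exists (- c * (b2 - c * (d * z))); split=> /=.
  + rewrite mulNr -sub0r; apply: FilB (Fil_00 _) _; apply: FilZ.
    by apply: (FilB F2); apply: FilZ; apply: Fil_predz.
  + rewrite e2 d1 d3; transitivity (b2 * z - d * (y * x - x * y)).
      by nc_ring cC cc.
    by rewrite yx; nc_ring cC cc.
  + rewrite -[b]opprK -[- b]sub0r e3 d3.
    transitivity (- c * (b2 * y - d * (y * z))); first by nc_ring cC cc.
    by rewrite yz; nc_ring cC cc.
- have [|b1 [b2 [b3 [F1 F2 F3 [e1 e2 e3]]]]] := E1 Fa (FilB (Fil_00 _) Fb) (Fil_00 _).
    by rewrite mul0r addr0 e sub0r mulNr subrr.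
  have [|d [Fd d2 d3]] := IH1 _ _ F2 F3.
    apply/eqP; rewrite -subr_eq0; apply/eqP.
    by rewrite -[LHS]mul1r -[1]opprK -cc mulNr -mulrA -e3 mulr0 oppr0.
  exists (d * x - b1); split=> /=.
  + by apply: FilB => //; apply: Fil_predx.
  + rewrite e1 d3; transitivity (d * (y * y) - b1 * x); first by nc_ring cC cc.
    by rewrite yy; nc_ring cC cc.
  + rewrite -[b]opprK -[- b]sub0r e2 d2 d3.
    transitivity (d * (y * x - c * (z * z)) - b1 * y); first by nc_ring cC cc.
    by rewrite -yx; nc_ring cC cc.
Qed.

(** The syzygy (0, a, 0) gives a = a' z, where a' = b2 - c d z has lower degree and is again killed
    by y; induction on the degree gives a' = 0. *)
Lemma mulIy a : a * y = 0 -> a = 0.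
Proof.
have [n Fa] := Fil_ex a; elim: n a Fa => [|n IH] a Fa e; first exact/Fil0.
have [|b1 [b2 [b3 [F1 F2 F3 [e1 e2 e3]]]]] := E1 (Fil_00 _) Fa (Fil_00 _).
  by rewrite !mul0r e !addr0.
have [|d [Fd d1 d3]] := (common_left_multiples n).2 _ _ F1 F3.
  by apply/eqP; rewrite eq_sym -subr_eq0 -e1.
have ea : a = (b2 - c * (d * z)) * z.
  rewrite e2 d1 d3; transitivity (b2 * z - d * (y * x - x * y)).
    by nc_ring cC cc.
  by rewrite yx; nc_ring cC cc.
rewrite ea [X in X * z]IH ?mul0r //; first by apply: (FilB F2); apply: FilZ; apply: Fil_predz.
transitivity (- c * (c * (b2 * y - d * (y * z)))).
  by rewrite yz; nc_ring cC cc.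
by rewrite d3 -mulrA in e3; rewrite -e3 mulr0.
Qed.

(** A common left multiple of x and y produces a. Then y kills a2 - c (a z), so its right regularity
    determines a2. *)
Lemma syzygy_syzygies a1 a2 a3 :
    a1 * x = a3 * y -> a1 * y + a2 * z = a3 * x -> a2 * y = a3 * z ->
  exists a, [/\ a1 = a * x, a2 = c * (a * z) & a3 = a * y].
Proof.
move=> e1 _ e3; have [n [F1 F3]] : exists n, Fil n a1 /\ Fil n a3.
  have [n1 F1] := Fil_ex a1; have [n3 F3] := Fil_ex a3.
  have FD n k a : Fil n a -> Fil (k + n) a.
    by move=> F; elim: k => [//|k IH]; apply: FilS.
  by exists (n1 + n3)%N; split; [rewrite addnC|]; apply: FD.
have [a [_ d1 d3]] := (common_left_multiples n).2 _ _ F1 F3 e1.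
exists a; split=> //; apply/eqP; rewrite -subr_eq0; apply/eqP/mulIy.
transitivity (a2 * y - a * (y * z)); first by rewrite yz; nc_ring cC cc.
by rewrite e3 d3 mulrA subrr.
Qed.
End KoszulRing.

(** * From a grading to the degree filtration *)

Section GradedKoszulRing.
Variables (R : nzRingType) (pr : nat -> {additive R -> R}) (x y z c : R).
Hypothesis cC : forall a, c * a = a * c.
Hypothesis cc : c * c = -1.
Hypothesis yy : y * y = x * x.
Hypothesis zy : z * y = - c * (y * z).
Hypothesis yx : y * x - x * y = c * (z * z).
Hypothesis pr_pr : forall j k a, pr k (pr j a) = if k == j then pr j a else 0.
Hypothesis pr_sep : forall a, (forall k, pr k a = 0) -> a = 0.
Hypothesis pr_bound : forall a, exists n, forall k, (n <= k)%N -> pr k a = 0.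
Hypothesis prc : forall k a, pr k (c * a) = c * pr k a.
Hypothesis pr0M : forall a g, g \in [:: x; y; z] -> pr 0 (a * g) = 0.
Hypothesis prSM : forall k a g, g \in [:: x; y; z] ->
  pr k.+1 (a * g) = pr k a * g.
Hypothesis linear_syz : forall a b d, a * x + b * y + d * z = 0 ->
  exists b1 b2 b3, [/\ a = b3 * y - b1 * x, b = b1 * y + b2 * z - b3 * x
                     & d = c * (b2 * y - b3 * z)].

(** Degree strictly below n. With the strict bound [Fil 0] is the zero group, where the inductions
    start. *)
Let Fil n a := forall k, (n <= k)%N -> pr k a = 0.
Let trunc n a := \sum_(j < n) pr j a.

Lemma pr_trunc n a k : pr k (trunc n a) = if (k < n)%N then pr k a else 0.
Proof.
rewrite raddf_sum /=; case: ifP => [kn|nk]; last first.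
  by rewrite big1 // => j _; rewrite pr_pr; case: eqP nk => // ->; rewrite ltn_ord.
rewrite (bigD1 (Ordinal kn)) //= pr_pr eqxx big1 ?addr0 // => j.
by rewrite pr_pr -val_eqE /= eq_sym => /negPf ->.
Qed.

Let pr_inj a b : (forall k, pr k a = pr k b) -> a = b.
Proof.
by move=> e; apply/subr0_eq/pr_sep => k; rewrite raddfB /= e subrr.
Qed.

Let gx : x \in [:: x; y; z]. Proof. by rewrite inE eqxx. Qed.
Let gy : y \in [:: x; y; z]. Proof. by rewrite !inE eqxx orbT. Qed.
Let gz : z \in [:: x; y; z]. Proof. by rewrite !inE eqxx !orbT. Qed.

(** Linear syzygies can be compared degree by degree: as a, b, d have degree at most n, cutting off
    the components of b1, b2, b3 in degrees n and above leaves the equations true. *)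
Lemma linear_syz_bounded n a b d : Fil n.+1 a -> Fil n.+1 b -> Fil n.+1 d ->
  a * x + b * y + d * z = 0 ->
  exists b1 b2 b3, [/\ Fil n b1, Fil n b2, Fil n b3 &
  [/\ a = b3 * y - b1 * x, b = b1 * y + b2 * z - b3 * x
    & d = c * (b2 * y - b3 * z)]].
Proof.
move=> Fa Fb Fd /linear_syz [b1 [b2 [b3 [e1 e2 e3]]]].
have Ft e : Fil n (trunc n e) by move=> k nk; rewrite pr_trunc ltnNge nk.
exists (trunc n b1), (trunc n b2), (trunc n b3); split=> //.
by split; apply: pr_inj => -[|k];
  rewrite ?prc !raddfB /= ?raddfD /= ?pr0M ?prSM ?pr_trunc //;
  [rewrite e1|case: ifP => nk; [rewrite e1|rewrite Fa ?ltnS 1?leqNgt ?nk]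
  |rewrite e2|case: ifP => nk; [rewrite e2|rewrite Fb ?ltnS 1?leqNgt ?nk]
  |rewrite e3|case: ifP => nk; [rewrite e3|rewrite Fd ?ltnS 1?leqNgt ?nk]];
  rewrite ?prc ?raddfB /= ?raddfD /= ?pr0M ?prSM // !(mul0r, subr0, addr0, mulr0).
Qed.

Let Fil0 a : Fil 0 a <-> a = 0.
Proof.
split=> [F|-> k _]; last exact: raddf0.
by apply: pr_sep => k; apply: F.
Qed.
Let FilB n a b : Fil n a -> Fil n b -> Fil n (a - b).
Proof. by move=> Fa Fb k nk; rewrite raddfB /= Fa // Fb // subrr. Qed.
Let FilZ n a : Fil n a -> Fil n (c * a).
Proof. by move=> Fa k nk; rewrite prc Fa // mulr0. Qed.
Let FilM n a g : g \in [:: x; y; z] -> Fil n a -> Fil n.+1 (a * g).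
Proof. by move=> gg Fa [//|k] nk; rewrite prSM // Fa // mul0r. Qed.
Let FilS n a : Fil n a -> Fil n.+1 a.
Proof. by move=> Fa k /ltnW; apply: Fa. Qed.

Lemma right_regular_y a : a * y = 0 -> a = 0.
Proof.
exact: (mulIy cC cc yy zy yx Fil0 FilB FilZ (fun n a => @FilM n a x gx)
  (fun n a => @FilM n a z gz) pr_bound FilS linear_syz_bounded).
Qed.

Lemma quadratic_syzygies a1 a2 a3 :
    a1 * x = a3 * y -> a1 * y + a2 * z = a3 * x -> a2 * y = a3 * z ->
  exists a, [/\ a1 = a * x, a2 = c * (a * z) & a3 = a * y].
Proof.
exact: (syzygy_syzygies cC cc yy zy yx Fil0 FilB FilZ (fun n a => @FilM n a x gx)
  (fun n a => @FilM n a z gz) pr_bound FilS linear_syz_bounded).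
Qed.
End GradedKoszulRing.

(** * Free modules and free algebras *)
Lemma malg_ind (R : nzRingType) (J : choiceType) (P : {malg R[J]} -> Prop) :
  P 0 -> (forall u v, P u -> P v -> P (u + v)) ->
  (forall c k, P (c *: << k >>)) -> forall u, P u.
Proof.
move=> P0 PD PU u; rewrite (monalgE u).
elim/big_ind: _ => // k _.
rewrite [X in P X](_ : _ = u@_k *: << k >>); first exact: PU.
by apply/malgP=> l; rewrite mcoeffZ !mcoeffU mulr_natr.
Qed.

Section FreeModule.
Variables (R : nzRingType) (J : choiceType) (N : lmodType R) (phi : J -> N).

Definition malg_lift (u : {malg R[J]}) : N :=
  \sum_(k <- msupp u) u@_k *: phi k.

Lemma malg_liftEw (d : {fset J}) u : (msupp u `<=` d)%fset ->
  malg_lift u = \sum_(k <- d) u@_k *: phi k.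
Proof.
move=> le; rewrite /malg_lift (big_fset_incl _ le) //= => k _ /mcoeff_outdom ->.
by rewrite scale0r.
Qed.

Fact malg_lift_is_linear : linear malg_lift.
Proof.
move=> a u v; set d := (msupp u `|` msupp v)%fset.
rewrite (@malg_liftEw d (a *: u + v)); last first.
  by rewrite (fsubset_trans (msuppD_le _ _)) // fsetSU // msuppZ_le.
rewrite (@malg_liftEw d u) ?fsubsetUl // (@malg_liftEw d v) ?fsubsetUr //.
rewrite scaler_sumr -big_split; apply: eq_bigr => k _ /=.
by rewrite mcoeffD mcoeffZ scalerDl scalerA.
Qed.
HB.instance Definition _ :=
  GRing.isLinear.Build R {malg R[J]} N *:%R malg_lift malg_lift_is_linear.

Lemma malg_liftU k : malg_lift << k >> = phi k.
Proof.
by rewrite /malg_lift msuppU oner_eq0 big_seq_fset1 mcoeffUU scale1r.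
Qed.
End FreeModule.

Lemma malgUZ (R : nzRingType) (J : choiceType) (c : R) (k : J) :
  << c *g k >> = c *: << k >> :> {malg R[J]}.
Proof. by apply/malgP=> l; rewrite mcoeffZ !mcoeffU mulr_natr. Qed.

Lemma malgUM (R : nzRingType) (J : monomType) (k l : J) :
  << k >> * << l >> = << mmul k l >> :> {malg R[J]}.
Proof. by rewrite malgM_def fgmulUU mulr1. Qed.

Fact malg_scalerAr (R : comNzRingType) (J : monomType) (c : R)
  (u v : {malg R[J]}) : c *: (u * v) = u * (c *: v).
Proof.
elim/malg_ind: u => [|u1 u2 e1 e2|a k]; first by rewrite !mul0r scaler0.
  by rewrite !mulrDl scalerDr e1 e2.
elim/malg_ind: v => [|v1 v2 e1 e2|b l]; first by rewrite !(scaler0, mulr0).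
  by rewrite scalerDr !mulrDr scalerDr e1 e2.
rewrite scalerA -!malgUZ !malgM_def !fgmulUU.
by apply/malgP=> m; rewrite mcoeffZ !mcoeffU mulrnAr mulrCA.
Qed.

(* monalg makes [malg] an algebra for commutative monomials only. *)
Definition free_algebra (K : fieldType) (I : choiceType) : Type := free_alg K I.
HB.instance Definition _ (K : fieldType) (I : choiceType) := GRing.Lalgebra.on (free_algebra K I).
HB.instance Definition _ (K : fieldType) (I : choiceType) :=
  GRing.Lalgebra_isAlgebra.Build K (free_algebra K I)
    (@malg_scalerAr K {fmonom I}).

(* An interface for the free algebra: working with the structures of [malg]
   directly makes every failing unification explode. *)
Record free_model (K : fieldType) (I : choiceType) := FreeModel {
  free_sort :> algType K;
  word : seq I -> free_sort;
  word_nil : word [::] = 1;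
  word_cat : forall u v, word (u ++ v) = word u * word v;
  free_ind : forall P : free_sort -> Prop,
    P 0 -> (forall u v, P u -> P v -> P (u + v)) ->
    (forall c w, P (c *: word w)) -> forall u, P u;
  free_lift : forall (N : lmodType K) (phi : seq I -> N),
    {f : {linear free_sort -> N} | forall w, f (word w) = phi w}
}.
Arguments word {K I F} : rename.
Arguments word_nil {K I F} : rename.
Arguments word_cat {K I F} : rename.
Arguments free_lift {K I} F {N} : rename.

Section FreeAlgebra.
Variables (K : fieldType) (I : choiceType).
Notation wd w := (<< FMonom w >> : free_algebra K I).

Fact free_algebra_word_nil : wd [::] = 1.
Proof. by rewrite -fmoneE. Qed.

Fact free_algebra_word_cat u v : wd (u ++ v) = wd u * wd v.
Proof. by rewrite malgUM /mmul /= fmmulE. Qed.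

Fact free_algebra_ind (P : free_algebra K I -> Prop) :
  P 0 -> (forall u v, P u -> P v -> P (u + v)) ->
  (forall c w, P (c *: wd w)) -> forall u, P u.
Proof.
move=> P0 PD PU; elim/malg_ind=> // c k.
by rewrite -(fmK k); apply: PU.
Qed.

Definition free_algebra_lift (N : lmodType K) (phi : seq I -> N) :
  {f : {linear free_algebra K I -> N} | forall w, f (wd w) = phi w}.
Proof.
exists (malg_lift (fun k : {fmonom I} => phi k)) => w; exact: malg_liftU.
Defined.

Definition free_algebra_model := FreeModel free_algebra_word_nil
  free_algebra_word_cat free_algebra_ind free_algebra_lift.

Lemma fgenE s : fgen K s = word (F := free_algebra_model) [:: s].
Proof. by rewrite /fgen fmuE. Qed.
End FreeAlgebra.

Section FreeModelTheory.
Variables (K : fieldType) (I : choiceType) (F : free_model K I).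
Notation X s := (word (F := F) [:: s]).

Lemma word_cons s w : word (s :: w) = X s * word w.
Proof. by rewrite -word_cat. Qed.

Lemma scale_wordM a b u v :
  (a *: word (F := F) u) * (b *: word v) = (a * b) *: word (u ++ v).
Proof. by rewrite word_cat -scalerA -scalerAl -scalerAr. Qed.

Lemma free_ind_gen (P : F -> Prop) :
  (forall u v, P u -> P v -> P (u + v)) -> (forall c u, P u -> P (c *: u)) ->
  P 1 -> (forall s u, P u -> P (X s * u)) -> forall u, P u.
Proof.
move=> PD PZ P1 PM; elim/free_ind=> // [|c w].
  by rewrite -(scale0r 1); apply: PZ.
apply: PZ; elim: w => [|s w]; first by rewrite word_nil.
by rewrite word_cons; apply: PM.
Qed.

Lemma free_linear_ext (N : lmodType K) (f h : {linear F -> N}) :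
  (forall w, f (word w) = h (word w)) -> forall p, f p = h p.
Proof.
move=> e; elim/free_ind=> [|u v eu ev|c w]; first by rewrite !linear0.
  by rewrite !linearD /= eu ev.
by rewrite !linearZ /= e.
Qed.

Definition weval (A : nzRingType) (g : I -> A) (w : seq I) : A :=
  \prod_(s <- w) g s.

Lemma free_linear_morphism (A : algType K) (g : I -> A) (f : {linear F -> A}) :
  (forall w, f (word w) = weval g w) ->
  exists h : {lrmorphism F -> A}, f =1 h.
Proof.
move=> e; suff fM : GRing.monoid_morphism f.
  pose m := GRing.isMonoidMorphism.Build F A f fM.
  pose h : {lrmorphism F -> A} := HB.pack (f : F -> A) m f.
  by exists h.
split=> [|p q]; first by rewrite -word_nil e /weval big_nil.
elim/free_ind: p => [|u1 u2 e1 e2|a k].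
- by rewrite mul0r linear0 mul0r.
- by rewrite mulrDl !linearD /= mulrDl e1 e2.
elim/free_ind: q => [|u1 u2 e1 e2|b l].
- by rewrite mulr0 linear0 mulr0.
- by rewrite mulrDr !linearD /= mulrDr e1 e2.
rewrite scale_wordM !linearZ /= !e /weval big_cat /=.
by rewrite -scalerAr -scalerAl scalerA mulrC.
Qed.

Lemma free_eval (A : algType K) (g : I -> A) :
  exists h : {lrmorphism F -> A}, forall s, h (X s) = g s.
Proof.
have [f fE] := free_lift F (weval g).
have [h hE] := free_linear_morphism fE.
by exists h => s; rewrite -hE fE /weval big_seq1.
Qed.

End FreeModelTheory.

(** This bundles the bare function [feval] as an algebra morphism on the abstract free model, where
    kernels and Fox derivatives are studied. *)
Lemma feval_lrmorphism (K : fieldType) (I : choiceType) (A : algType K)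
    (g : I -> A) :
  exists h : {lrmorphism free_algebra_model K I -> A},
    (forall p, feval g p = h p) /\ forall s, h (word [:: s]) = g s.
Proof.
have [f fE] := free_lift (free_algebra_model K I) (weval g).
have [h hE] := free_linear_morphism fE.
pose L := malg_lift (fun k : {fmonom I} => weval g k).
exists h; split=> [p|s]; last by rewrite -hE fE /weval big_seq1.
have -> : feval g p = L p.
  by apply: eq_bigr => k _; rewrite /= mulr_algl.
rewrite -hE; apply: (@free_linear_ext _ _ _ _ (L : {linear free_algebra_model K I -> A})).
by move=> w; rewrite fE; apply: malg_liftU.
Qed.

Section Ideals.
Variables (R : nzRingType) (X : R -> Prop).

Lemma ideal_genM a p b : ideal_gen X p -> ideal_gen X (a * p * b).
Proof.
elim=> [|u f v Xf|u v _ IHu _ IHv]; first by rewrite mulr0 mul0r; constructor.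
  by rewrite -!mulrA !(mulrA _ f) !mulrA -mulrA; constructor.
by rewrite mulrDr mulrDl; constructor.
Qed.

Lemma ideal_genMl a p : ideal_gen X p -> ideal_gen X (a * p).
Proof. by move=> h; rewrite -[_ * p]mulr1; apply: ideal_genM. Qed.

Lemma ideal_genMr p b : ideal_gen X p -> ideal_gen X (p * b).
Proof. by move=> h; rewrite -[p]mul1r; apply: ideal_genM. Qed.

Lemma ideal_gen_rel p : X p -> ideal_gen X p.
Proof. by move=> h; rewrite -[p]mul1r -[_ * p]mulr1; constructor. Qed.

Lemma ideal_genN p : ideal_gen X p -> ideal_gen X (- p).
Proof. by move=> h; rewrite -mulN1r; apply: ideal_genMl. Qed.

Lemma ideal_genB p q : ideal_gen X p -> ideal_gen X q -> ideal_gen X (p - q).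
Proof. by move=> hp /ideal_genN; constructor. Qed.
End Ideals.

Lemma ideal_genZ (K : fieldType) (A : algType K) (X : A -> Prop) c p :
  ideal_gen X p -> ideal_gen X (c *: p).
Proof. by move=> h; rewrite -mulr_algl; apply: ideal_genMl. Qed.

Notation i0 := (@inord 2 0).
Notation i1 := (@inord 2 1).
Notation i2 := (@inord 2 2).

Lemma inord3_eq j k : (j < 3)%N -> (k < 3)%N ->
  (inord j == inord k :> 'I_3) = (j == k).
Proof. by move=> hj hk; rewrite -val_eqE /= !inordK. Qed.

Variant ord3_spec : 'I_3 -> Prop :=
| Ord3_0 : ord3_spec i0 | Ord3_1 : ord3_spec i1 | Ord3_2 : ord3_spec i2.

Lemma ord3P s : ord3_spec s.
Proof.
by rewrite -(inord_val s); case: s => [[|[|[|]]]] //= _; constructor.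
Qed.

(** * Fox derivatives *)
Section FoxDerivatives.
Variables (K : fieldType) (I : choiceType) (F : free_model K I) (A : algType K).
Variable ev : {lrmorphism F -> A}.
Notation X s := (word (F := F) [:: s]).

Definition eps_word (w : seq I) : K^o := (w == [::])%:R.
Definition eps : {linear F -> K^o} := sval (free_lift F eps_word).
Lemma epsE w : eps (word w) = (w == [::])%:R.
Proof. exact: (svalP (free_lift F eps_word)). Qed.

Lemma epsZ a p : eps (a *: p) = a * eps p.
Proof. exact: linearZ. Qed.

(* p = eps p + sum_s (right_fox s p) s, evaluated in A *)
Definition right_fox_word (s : I) (w : seq I) : A :=
  if w is t :: w' then if last t w' == s then ev (word (belast t w')) else 0 else 0.
Definition left_fox_word (s : I) (w : seq I) : A :=
  if w is t :: w' then if t == s then ev (word w') else 0 else 0.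
Definition right_fox s : {linear F -> A} := sval (free_lift F (right_fox_word s)).
Definition left_fox s : {linear F -> A} := sval (free_lift F (left_fox_word s)).
Lemma right_foxE s w : right_fox s (word w) = right_fox_word s w.
Proof. exact: (svalP (free_lift F (right_fox_word s))). Qed.
Lemma left_foxE s w : left_fox s (word w) = left_fox_word s w.
Proof. exact: (svalP (free_lift F (left_fox_word s))). Qed.

Lemma right_foxZ s a p : right_fox s (a *: p) = a *: right_fox s p.
Proof. exact: linearZ. Qed.
Lemma left_foxZ s a p : left_fox s (a *: p) = a *: left_fox s p.
Proof. exact: linearZ. Qed.

Lemma epsM p q : eps (p * q) = eps p * eps q :> K.
Proof.
elim/free_ind: p => [|u1 u2 e1 e2|a k].
- by rewrite mul0r linear0 mul0r.
- by rewrite mulrDl !linearD /= e1 e2 mulrDl.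
elim/free_ind: q => [|u1 u2 e1 e2|b l].
- by rewrite mulr0 linear0 mulr0.
- by rewrite mulrDr !linearD /= e1 e2 mulrDr.
rewrite scale_wordM !epsZ !epsE mulrACA.
by congr (_ * _); rewrite -natrM mulnb; case: k l => [|? ?] [|? ?].
Qed.

(** The derivative strips the last letter of a word. In a product that letter belongs to q, except
    for the constant term of q, which leaves the last letter of p. *)
Lemma right_foxM s p q :
  right_fox s (p * q) = ev p * right_fox s q + (eps q : K) *: right_fox s p.
Proof.
elim/free_ind: p => [|u1 u2 e1 e2|a k].
- by rewrite mul0r !linear0 mul0r add0r ?scaler0.
- by rewrite mulrDl !linearD /= e1 e2 mulrDl addrACA.
elim/free_ind: q => [|u1 u2 e1 e2|b l].
- by rewrite mulr0 !linear0 mulr0 ?scale0r addr0.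
- by rewrite mulrDr !linearD /= e1 e2 mulrDr scalerDl addrACA.
rewrite scale_wordM epsZ !linearZ /= !right_foxE epsE.
case/lastP: l => [|l t]; rewrite /= ?cats0 ?eqxx.
  by rewrite scaler0 mulr0 add0r mulr1 scalerA mulrC.
have -> : (rcons l t == [::]) = false by case: l.
have E w : right_fox_word s (rcons w t) = if t == s then ev (word w) else 0.
  by case: w => [|u w] //=; rewrite ?last_rcons ?belast_rcons.
rewrite -rcons_cat mulr0 scale0r scaler0 addr0 !E -scalerAr -scalerAl scalerA (mulrC b).
by case: ifP; rewrite ?mulr0 // word_cat rmorphM.
Qed.

Lemma left_foxM s p q :
  left_fox s (p * q) = left_fox s p * ev q + (eps p : K) *: left_fox s q.
Proof.
elim/free_ind: p => [|u1 u2 e1 e2|a k].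
- by rewrite mul0r !linear0 mul0r add0r ?scale0r.
- by rewrite mulrDl !linearD /= e1 e2 mulrDl scalerDl addrACA.
elim/free_ind: q => [|u1 u2 e1 e2|b l].
- by rewrite mulr0 !linear0 mulr0 ??scaler0 addr0.
- by rewrite mulrDr !linearD /= e1 e2 mulrDr ?scalerDr addrACA.
rewrite scale_wordM epsZ !linearZ /= !left_foxE epsE.
case: k => [|t k] /=.
  by rewrite scaler0 mul0r add0r mulr1 !scalerA mulrC.
rewrite mulr0 scale0r scaler0 addr0 -scalerAr -scalerAl !scalerA mulrC.
by case: ifP; rewrite ?mul0r // word_cat rmorphM.
Qed.

Lemma right_fox_gen s t : right_fox s (X t) = (t == s)%:R.
Proof.
by rewrite right_foxE /=; case: ifP => // _; rewrite word_nil rmorph1.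
Qed.
Lemma left_fox_gen s t : left_fox s (X t) = (t == s)%:R.
Proof.
by rewrite left_foxE /=; case: ifP => // _; rewrite word_nil rmorph1.
Qed.
Lemma eps_gen t : eps (X t) = 0.
Proof. by rewrite epsE. Qed.
End FoxDerivatives.

Definition H_relator (K : fieldType) (i : K) (F : free_model K 'I_3) (p : F) :=
  let x := word (F := F) [:: i0] in
  let y := word (F := F) [:: i1] in
  let z := word (F := F) [:: i2] in
  [\/ p = y * y - x * x, p = z * y - (- i) *: (y * z)
    | p = y * x - x * y - i *: (z * z)].

(** * Linear syzygies read off from the presentation *)

Section Syzygies.
Variables (K : fieldType) (i : K) (F : free_model K 'I_3) (A : algType K).
Variable ev : {lrmorphism F -> A}.
Hypothesis ev_surj : forall a, exists p, ev p = a.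
Hypothesis ev_ker : forall p, ev p = 0 <-> ideal_gen (H_relator i (F := F)) p.
Hypothesis ii : i * i = -1.
Notation X s := (word (F := F) [:: s]).
Notation x := (ev (X i0)).
Notation y := (ev (X i1)).
Notation z := (ev (X i2)).
Variable c : A.
Hypothesis cE : forall a : A, i *: a = c * a.

Definition right_syz (a b d : A) := exists b1 b2 b3,
  [/\ a = b3 * y - b1 * x, b = b1 * y + b2 * z - b3 * x
    & d = c * (b2 * y - b3 * z)].
Definition left_syz (a b d : A) := exists b1 b2 b3,
  [/\ a = y * b3 - x * b1, b = y * b1 + z * b2 - x * b3
    & d = - c * (y * b2 - z * b3)].

Let cC a : c * a = a * c.
Proof. by rewrite -cE -[c]mulr1 -cE -scalerAr mulr1. Qed.
Let cc : c * c = -1.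
Proof. by rewrite -cE -[c]mulr1 -cE scalerA ii scaleN1r. Qed.

Lemma right_syzD a b d a' b' d' : right_syz a b d -> right_syz a' b' d' ->
  right_syz (a + a') (b + b') (d + d').
Proof.
move=> [b1 [b2 [b3 [-> -> ->]]]] [d1 [d2 [d3 [-> -> ->]]]].
exists (b1 + d1), (b2 + d2), (b3 + d3).
by split; nc_ring cC cc.
Qed.

Lemma right_syzZ k u a b d : right_syz a b d ->
  right_syz (k *: (u * a)) (k *: (u * b)) (k *: (u * d)).
Proof.
move=> [b1 [b2 [b3 [-> -> ->]]]].
exists (k *: (u * b1)), (k *: (u * b2)), (k *: (u * b3)).
split; rewrite -!(scalerAl k) -?(scalerDr k) -(scalerBr k) -?(scalerAr k);
  by congr (_ *: _); nc_ring cC cc.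
Qed.

Lemma left_syzD a b d a' b' d' : left_syz a b d -> left_syz a' b' d' ->
  left_syz (a + a') (b + b') (d + d').
Proof.
move=> [b1 [b2 [b3 [-> -> ->]]]] [d1 [d2 [d3 [-> -> ->]]]].
exists (b1 + d1), (b2 + d2), (b3 + d3).
by split; nc_ring cC cc.
Qed.

Lemma left_syzZ k u a b d : left_syz a b d ->
  left_syz (k *: (a * u)) (k *: (b * u)) (k *: (d * u)).
Proof.
move=> [b1 [b2 [b3 [-> -> ->]]]].
exists (k *: (b1 * u)), (k *: (b2 * u)), (k *: (b3 * u)).
split; rewrite -!(scalerAr k) -?(scalerDr k) -(scalerBr k) -?(scalerAr k);
  by congr (_ *: _); nc_ring cC cc.
Qed.

Lemma relator_fox (f : F) : H_relator i f ->
  [/\ eps F f = 0, ev f = 0,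
      right_syz (right_fox ev i0 f) (right_fox ev i1 f) (right_fox ev i2 f)
    & left_syz (left_fox ev i0 f) (left_fox ev i1 f) (left_fox ev i2 f)].
Proof.
move=> rf; have f0 : ev f = 0 by apply/ev_ker; apply: ideal_gen_rel.
split=> //.
- by case: rf => ->; rewrite !linearB /= ?epsZ !epsM !eps_gen !mulr0 !subr0.
- case: rf => ->; [exists 1, 0, 0|exists 0, 1, 0|exists 0, 0, 1];
  rewrite !linearB /= ?right_foxZ !(right_foxM, right_fox_gen, eps_gen);
  rewrite !inord3_eq //=; split;
  rewrite ?mulr0n ?mulr1n ?scaleNr !scale0r ?cE; nc_ring cC cc.
(* [left_syz] is [right_syz] of the opposite algebra with [- c] for [c]. Reversed, the second and
   third relators agree with those normalised relators only up to the factors c and -1. *)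
- case: rf => ->; [exists 1, 0, 0|exists 0, c, 0|exists 0, 0, (-1)];
  rewrite !linearB /= ?left_foxZ !(left_foxM, left_fox_gen, eps_gen);
  rewrite !inord3_eq //=; split;
  rewrite ?mulr0n ?mulr1n ?scaleNr !scale0r ?cE; nc_ring cC cc.
Qed.

(** Lift a, b, d to the free algebra: the lifted sum lies in the relation ideal and its right Fox
    derivatives evaluate to a, b, d. For a generator u f w of the ideal the product rule leaves only
    u times the derivatives of f times the constant term of w, since f has value and constant term
    0. *)
Lemma linear_right_syzygy a b d : a * x + b * y + d * z = 0 -> right_syz a b d.
Proof.
move=> e; have [p pa] := ev_surj a; have [q qb] := ev_surj b.
have [r rd] := ev_surj d.
pose P := p * X i0 + q * X i1 + r * X i2.
have /ev_ker IP : ev P = 0 by rewrite !rmorphD !rmorphM /= pa qb rd.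
have: right_syz (right_fox ev i0 P) (right_fox ev i1 P) (right_fox ev i2 P).
  elim: IP => [|u f w rf|u v _ IHu _ IHv].
  - by rewrite !linear0; exists 0, 0, 0; rewrite !mul0r !(subr0, addr0, mulr0).
  - have [ef vf syz _] := relator_fox rf.
    rewrite -mulrA !(right_foxM _ _ u) !(right_foxM _ _ f) epsM ef vf.
    rewrite mul0r !mul0r !scale0r !addr0 !add0r -!scalerAr.
    exact: right_syzZ.
  - by rewrite !linearD; apply: right_syzD.
rewrite !linearD /= !right_foxM !right_fox_gen !eps_gen !inord3_eq //=.
by rewrite !scale0r !mulr0 !mulr1 !addr0 !add0r pa qb rd.
Qed.

Lemma linear_left_syzygy a b d : x * a + y * b + z * d = 0 -> left_syz a b d.
Proof.
move=> e; have [p pa] := ev_surj a; have [q qb] := ev_surj b.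
have [r rd] := ev_surj d.
pose P := X i0 * p + X i1 * q + X i2 * r.
have /ev_ker IP : ev P = 0 by rewrite !rmorphD !rmorphM /= pa qb rd.
have: left_syz (left_fox ev i0 P) (left_fox ev i1 P) (left_fox ev i2 P).
  elim: IP => [|u f w rf|u v _ IHu _ IHv].
  - by rewrite !linear0; exists 0, 0, 0; rewrite !mulr0 !(subr0, addr0, mulr0).
  - have [ef vf _ syz] := relator_fox rf.
    rewrite !(left_foxM _ _ _ w) !(left_foxM _ _ u) epsM ef vf.
    rewrite !mulr0 !scale0r !addr0 !add0r -!scalerAl.
    exact: left_syzZ.
  - by rewrite !linearD; apply: left_syzD.
rewrite !linearD /= !left_foxM !left_fox_gen !eps_gen !inord3_eq //=.
by rewrite !scale0r !mul0r !mul1r !addr0 !add0r pa qb rd.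
Qed.
End Syzygies.

(** * Graded algebras *)
Section Grading.
Variables (J : eqType) (V : zmodType) (h : J -> V -> Prop).
Hypothesis hG : is_grading h.

Lemma grading0 j : h j 0. Proof. by case: hG. Qed.
Lemma gradingB j u v : h j u -> h j v -> h j (u - v).
Proof. by case: hG => _ + _ _; apply. Qed.
Lemma gradingN j u : h j u -> h j (- u).
Proof. by move=> hu; rewrite -sub0r; apply: gradingB => //; apply: grading0. Qed.
Lemma gradingD j u v : h j u -> h j v -> h j (u + v).
Proof. by move=> hu hv; rewrite -[v]opprK; apply/gradingB/gradingN. Qed.

Definition components (v : V) (f : J -> V) := (forall j, h j (f j)) /\
  exists s, [/\ uniq s, forall j, j \notin s -> f j = 0 & v = \sum_(j <- s) f j].

Lemma sum_supset (f : J -> V) (s t : seq J) : uniq s -> uniq t ->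
  {subset s <= t} -> (forall j, j \notin s -> f j = 0) ->
  \sum_(j <- t) f j = \sum_(j <- s) f j.
Proof.
move=> us ut st f0; rewrite (bigID (mem s)) /= [X in _ + X]big1 ?addr0; last first.
  by move=> j /f0.
rewrite -big_filter; apply: perm_big; apply: uniq_perm => //.
  exact: filter_uniq.
by move=> j; rewrite mem_filter; case: (boolP (j \in s)) => //= /st ->.
Qed.

Lemma componentsB u v f g : components u f -> components v g ->
  components (u - v) (fun j => f j - g j).
Proof.
move=> [hf [s [us fs ->]]] [hg [t [ut gt ->]]].
split=> [j|]; first exact: gradingB.
exists (undup (s ++ t)); split; first exact: undup_uniq.
  by move=> j; rewrite mem_undup mem_cat negb_or => /andP [/fs -> /gt ->]; rewrite subrr.
rewrite sumrB; congr (_ - _); apply/esym/sum_supset => //; rewrite ?undup_uniq //;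
  by move=> j js; rewrite mem_undup mem_cat js ?orbT.
Qed.

Lemma components_hom j v : h j v -> components v (fun k => if k == j then v else 0).
Proof.
move=> hv; split=> [k|]; first by case: eqP => [->|_] //; apply: grading0.
exists [:: j]; split=> //; last by rewrite big_seq1 eqxx.
by move=> k; rewrite inE => /negPf ->.
Qed.

Lemma components_ex v : exists f, components v f.
Proof.
case: hG => _ _ /(_ v) [s [f [hf ->]]] _.
(* The list in [is_grading] may repeat indices, so the components are accumulated one summand at a
   time. *)
elim: s => [|j s [g gs]].
  exists (fun=> 0); split=> [j|]; first exact: grading0.
  by exists [::]; rewrite !big_nil.
rewrite big_cons -[X in _ + X]opprK -[- \sum_(_ <- _) _]sub0r.
have c0 : components 0 (fun=> 0).
  split=> [k|]; first exact: grading0.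
  by exists [::]; rewrite !big_nil.
by eexists; apply: componentsB (componentsB c0 gs); apply: components_hom (hf j).
Qed.

Lemma components0 f : components 0 f -> forall j, f j = 0.
Proof.
move=> [hf [s [us fs /esym e]]] j.
by case: hG => _ _ _ /(_ s f hf us e) f0; case: (boolP (j \in s)) => [/f0|/fs].
Qed.

Lemma components_uniq v f g : components v f -> components v g -> f =1 g.
Proof.
move=> cf cg j; apply: subr0_eq.
by move: (componentsB cf cg); rewrite subrr => /components0.
Qed.

Definition proj j v := sval (cid (components_ex v)) j.

Lemma projP v : components v (proj^~ v).
Proof. exact: (svalP (cid (components_ex v))). Qed.

Lemma proj_eq v f : components v f -> forall j, proj j v = f j.
Proof. by move=> cf j; apply: components_uniq (projP v) cf j. Qed.

Fact proj_is_zmod_morphism j : zmod_morphism (proj j).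
Proof.
by move=> u v; rewrite (proj_eq (componentsB (projP u) (projP v))).
Qed.
HB.instance Definition _ j :=
  GRing.isZmodMorphism.Build V V (proj j) (proj_is_zmod_morphism j).

Lemma proj_hom j k v : h j v -> proj k v = if k == j then v else 0.
Proof. by move=> /components_hom/proj_eq. Qed.

Lemma proj_in j v : h j (proj j v). Proof. exact: (projP v).1. Qed.

Lemma proj_proj j k v : proj k (proj j v) = if k == j then proj j v else 0.
Proof. exact/proj_hom/proj_in. Qed.

Lemma proj_sep v : (forall k, proj k v = 0) -> v = 0.
Proof. by move=> v0; have [_ [s [_ _ ->]]] := projP v; rewrite big1. Qed.

Lemma homP j v : h j v <-> forall k, k != j -> proj k v = 0.
Proof.
split=> [hv k /negPf kj|v0]; first by rewrite (proj_hom _ hv) kj.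
suff -> : v = proj j v by apply: proj_in.
apply/subr0_eq/proj_sep => k; rewrite raddfB /= proj_proj.
by case: eqP => [->|/eqP/v0 ->]; rewrite subrr.
Qed.

End Grading.

Section GradingFromProj.
Variables (J : eqType) (V : zmodType) (h : J -> V -> Prop) (p : J -> V -> V).
Hypothesis pB : forall j u v, p j (u - v) = p j u - p j v.
Hypothesis hp : forall j v, h j v <-> forall k, p k v = if k == j then v else 0.
Hypothesis pp : forall j v, h j (p j v).
Hypothesis pE : forall v, exists2 s, uniq s & v = \sum_(j <- s) p j v.

Lemma is_grading_proj : is_grading h.
Proof.
have p0 j : p j 0 = 0 by have := pB j 0 0; rewrite !subrr.
split.
- by move=> j; apply/hp => k; rewrite p0 if_same.
- move=> j u v /hp hu /hp hv; apply/hp => k; rewrite pB hu hv.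
  by case: eqP; rewrite ?subrr.
- by move=> v; have [s _ ->] := pE v; exists s, (p^~ v).
- move=> s f hf us e j js.
  have pD u v : p j (u + v) = p j u + p j v.
    by rewrite -[v in LHS]opprK pB -[- v]sub0r pB p0 sub0r opprK.
  have := congr1 (p j) e; rewrite p0 (big_morph (p j) pD (p0 j)).
  rewrite (bigD1_seq j) //= big1 ?addr0 => [|k kj]; last first.
    by have /hp -> := hf k; rewrite eq_sym (negPf kj).
  by have /hp -> := hf j; rewrite eqxx.
Qed.
End GradingFromProj.

Section GradedAlgebra.
Variables (K : fieldType) (A : graded_alg K).

Definition hcomp (n : nat) : {additive A -> A} := proj (@gr_grading K A) n.

Lemma comp_hom m n a : gr A m a -> hcomp n a = if n == m then a else 0.
Proof. exact: proj_hom. Qed.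
Lemma comp_in n a : gr A n (hcomp n a). Proof. exact: proj_in. Qed.
Lemma comp_comp j k a : hcomp k (hcomp j a) = if k == j then hcomp j a else 0.
Proof. exact: proj_proj. Qed.
Lemma comp_sep a : (forall k, hcomp k a = 0) -> a = 0.
Proof. exact: proj_sep. Qed.
Lemma comp_inj a b : (forall k, hcomp k a = hcomp k b) -> a = b.
Proof. by move=> e; apply/subr0_eq/comp_sep => k; rewrite raddfB /= e subrr. Qed.
Lemma comp_bound a : exists n, forall k, (n <= k)%N -> hcomp k a = 0.
Proof.
have [_ [s [us s0 _]]] := projP (@gr_grading K A) a.
exists (\max_(j <- s) j.+1)%N => k nk; apply: s0; apply: contraTN nk => ks.
by rewrite -ltnNge; apply: (@leq_bigmax_seq _ _ xpredT succn).
Qed.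
Lemma compE a n : (forall k, (n <= k)%N -> hcomp k a = 0) ->
  a = \sum_(j < n) hcomp j a.
Proof.
move=> a0; apply: comp_inj => k; rewrite raddf_sum /=.
case: (ltnP k n) => [kn|nk].
  rewrite (bigD1 (Ordinal kn)) //= comp_comp eqxx big1 ?addr0 // => j.
  by rewrite comp_comp -val_eqE /= eq_sym => /negPf ->.
rewrite a0 // big1 // => j _; rewrite comp_comp; case: eqP => // e.
by move: nk; rewrite e leqNgt ltn_ord.
Qed.

Lemma grD n a b : gr A n a -> gr A n b -> gr A n (a + b).
Proof. exact: (gradingD (@gr_grading K A)). Qed.
Lemma grB n a b : gr A n a -> gr A n b -> gr A n (a - b).
Proof. exact: (gradingB (@gr_grading K A)). Qed.
Lemma gr0 n : gr A n 0.
Proof. exact: (grading0 (@gr_grading K A)). Qed.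
Lemma gr_alg k : gr A 0 (k%:A).
Proof. by apply/gr_scale/gr_one. Qed.

Lemma compZ n k a : hcomp n (k *: a) = k *: hcomp n a.
Proof.
have [N aN] := comp_bound a; rewrite {1}(compE aN) scaler_sumr raddf_sum /=.
have E j : hcomp n (k *: hcomp j a) = if n == j then k *: hcomp j a else 0.
  by apply: comp_hom; apply: gr_scale; apply: comp_in.
under eq_bigr do rewrite E.
case: (ltnP n N) => [nN|Nn].
  rewrite (bigD1 (Ordinal nN)) //= eqxx big1 ?addr0 // => j.
  by rewrite -val_eqE /= eq_sym => /negPf ->.
rewrite aN // scaler0 big1 // => j _; case: eqP => // e.
by move: Nn; rewrite e leqNgt ltn_ord.
Qed.

Lemma compMr m n a b : gr A m b -> hcomp (n + m) (a * b) = hcomp n a * b.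
Proof.
move=> hb; have [N aN] := comp_bound a; rewrite {1}(compE aN) mulr_suml raddf_sum /=.
have E j : hcomp (n + m) (hcomp j a * b) = if n == j then hcomp j a * b else 0.
  by rewrite -(eqn_add2r m); apply: comp_hom; apply: gr_mul (comp_in _ _) hb.
under eq_bigr do rewrite E.
case: (ltnP n N) => [nN|Nn].
  rewrite (bigD1 (Ordinal nN)) //= eqxx big1 ?addr0 // => j.
  by rewrite -val_eqE /= eq_sym => /negPf ->.
rewrite aN // mul0r big1 // => j _; case: eqP => // e.
by move: Nn; rewrite e leqNgt ltn_ord.
Qed.

Lemma compMl m n a b : gr A m a -> hcomp (m + n) (a * b) = a * hcomp n b.
Proof.
move=> ha; have [N bN] := comp_bound b; rewrite {1}(compE bN) mulr_sumr raddf_sum /=.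
have E j : hcomp (m + n) (a * hcomp j b) = if n == j then a * hcomp j b else 0.
  by rewrite -(eqn_add2l m); apply: comp_hom; apply: gr_mul ha (comp_in _ _).
under eq_bigr do rewrite E.
case: (ltnP n N) => [nN|Nn].
  rewrite (bigD1 (Ordinal nN)) //= eqxx big1 ?addr0 // => j.
  by rewrite -val_eqE /= eq_sym => /negPf ->.
rewrite bN // mulr0 big1 // => j _; case: eqP => // e.
by move: Nn; rewrite e leqNgt ltn_ord.
Qed.

Lemma compMr_lt m n a b : gr A m b -> (n < m)%N -> hcomp n (a * b) = 0.
Proof.
move=> hb nm; have [N aN] := comp_bound a; rewrite (compE aN) mulr_suml raddf_sum /=.
rewrite big1 // => j _; rewrite (comp_hom _ (gr_mul (comp_in j a) hb)).
by case: eqP => // e; move: nm; rewrite e ltnNge leq_addl.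
Qed.

Lemma compMl_lt m n a b : gr A m a -> (n < m)%N -> hcomp n (a * b) = 0.
Proof.
move=> ha nm; have [N bN] := comp_bound b; rewrite (compE bN) mulr_sumr raddf_sum /=.
rewrite big1 // => j _; rewrite (comp_hom _ (gr_mul ha (comp_in j b))).
by case: eqP => // e; move: nm; rewrite e ltnNge leq_addr.
Qed.
End GradedAlgebra.
Arguments hcomp {K A} n.

Lemma H_rel_relator (K : fieldType) (i : K) p :
  H_rel i p <-> H_relator (F := free_algebra_model K 'I_3) i p.
Proof. by rewrite /H_rel !fgenE. Qed.

Lemma ideal_gen_eq (R : nzRingType) (X Y : R -> Prop) p :
  (forall q, X q -> ideal_gen Y q) -> ideal_gen X p -> ideal_gen Y p.
Proof.
move=> XY; elim=> [|a f b /XY h|u v _ hu _ hv]; first by constructor.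
  exact: ideal_genM.
by constructor.
Qed.

Lemma mul_opE (R : nzRingType) (a b : R^c) : a * b = (b : R) * (a : R).
Proof. by []. Qed.

(** * Relations, syzygies and decompositions in H and its opposite *)

Section HAlgebra.
Variables (K : fieldType) (i : K) (A : graded_alg K) (g : 'I_3 -> A).
Hypothesis ii : i * i = -1.
Hypothesis g1 : forall s, gr A 1 (g s).
Hypothesis presA : presents g (H_rel i).
Notation x := (g i0).
Notation y := (g i1).
Notation z := (g i2).
Variable c : A.
Hypothesis cE : forall a : A, i *: a = c * a.

Lemma c_central a : c * a = a * c.
Proof. by rewrite -cE -[c]mulr1 -cE -scalerAr mulr1. Qed.
Lemma c_square : c * c = -1.
Proof. by rewrite -cE -[c]mulr1 -cE scalerA ii scaleN1r. Qed.

Lemma presentation_eval :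
  exists (F : free_model K 'I_3) (ev : {lrmorphism F -> A}),
  [/\ forall s, ev (word [:: s]) = g s,
      forall a, exists p, ev p = a
    & forall p, ev p = 0 <-> ideal_gen (H_relator (F := F) i) p].
Proof.
pose F := free_algebra_model K 'I_3.
have [ev [evE evX]] := feval_lrmorphism g.
have [surj ker] := presA; exists F, ev; split; [exact: evX| |].
  by move=> a; have [p pa] := surj a; exists p; rewrite -pa evE.
move=> p; split=> [ep|h].
  have /ker : feval g p = 0 by rewrite evE.
  by apply: (@ideal_gen_eq F) => q /H_rel_relator; apply: (@ideal_gen_rel F).
rewrite -evE; apply/ker.
have : @ideal_gen F (fun q => H_rel i (q : free_alg K 'I_3)) p.
  move: h; apply: (@ideal_gen_eq F) => q hq; apply: (@ideal_gen_rel F).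
  by apply/H_rel_relator.
exact.
Qed.

Lemma H_yy : y * y = x * x.
Proof.
have [F [ev [evX _ ker]]] := presentation_eval.
have /ker := ideal_gen_rel (Or31 _ _ (erefl _) : H_relator i (F := F) _).
by rewrite rmorphB !rmorphM /= !evX => /subr0_eq.
Qed.

Lemma H_zy : z * y = - c * (y * z).
Proof.
have [F [ev [evX _ ker]]] := presentation_eval.
have /ker := ideal_gen_rel (Or32 _ _ (erefl _) : H_relator i (F := F) _).
by rewrite rmorphB /= linearZ /= !rmorphM /= !evX scaleNr cE mulNr => /subr0_eq.
Qed.

Lemma H_yx : y * x - x * y = c * (z * z).
Proof.
have [F [ev [evX _ ker]]] := presentation_eval.
have /ker := ideal_gen_rel (Or33 _ _ (erefl _) : H_relator i (F := F) _).
by rewrite !rmorphB /= linearZ /= !rmorphM /= !evX cE => /subr0_eq.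
Qed.

Lemma H_right_syzygy a b d : a * x + b * y + d * z = 0 ->
  exists b1 b2 b3, [/\ a = b3 * y - b1 * x, b = b1 * y + b2 * z - b3 * x
                     & d = c * (b2 * y - b3 * z)].
Proof.
have [F [ev [evX surj ker]]] := presentation_eval.
by rewrite -!evX; apply: (linear_right_syzygy surj ker).
Qed.

Lemma H_left_syzygy a b d : x * a + y * b + z * d = 0 ->
  exists b1 b2 b3, [/\ a = y * b3 - x * b1, b = y * b1 + z * b2 - x * b3
                     & d = - c * (y * b2 - z * b3)].
Proof.
have [F [ev [evX surj ker]]] := presentation_eval.
by rewrite -!evX; apply: (linear_left_syzygy surj ker).
Qed.

Lemma compc k a : hcomp k (c * a) = c * hcomp k a.
Proof. by rewrite -!cE compZ. Qed.

Lemma gen1 a : a \in [:: x; y; z] -> gr A 1 a.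
Proof. by rewrite !inE => /or3P [] /eqP ->. Qed.

Lemma comp0Mr a b : b \in [:: x; y; z] -> hcomp 0 (a * b) = 0.
Proof. by move=> /gen1 hb; apply: compMr_lt hb _. Qed.
Lemma compSMr k a b : b \in [:: x; y; z] -> hcomp k.+1 (a * b) = hcomp k a * b.
Proof. by move=> /gen1 hb; rewrite -addn1; apply: compMr. Qed.
Lemma comp0Ml a b : a \in [:: x; y; z] -> hcomp 0 (a * b) = 0.
Proof. by move=> /gen1 hb; apply: compMl_lt hb _. Qed.
Lemma compSMl k a b : a \in [:: x; y; z] -> hcomp k.+1 (a * b) = a * hcomp k b.
Proof. by move=> /gen1 hb; rewrite -add1n; apply: compMl. Qed.

Lemma H_right_regular a : a * y = 0 -> a = 0.
Proof.
exact: (right_regular_y c_central c_square H_yy H_zy H_yx (@comp_comp _ A)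
  (@comp_sep _ A) (@comp_bound _ A) compc comp0Mr compSMr H_right_syzygy).
Qed.

Lemma H_right_syzygy2 a1 a2 a3 :
    a1 * x = a3 * y -> a1 * y + a2 * z = a3 * x -> a2 * y = a3 * z ->
  exists a, [/\ a1 = a * x, a2 = c * (a * z) & a3 = a * y].
Proof.
exact: (quadratic_syzygies c_central c_square H_yy H_zy H_yx (@comp_comp _ A)
  (@comp_sep _ A) (@comp_bound _ A) compc comp0Mr compSMr H_right_syzygy).
Qed.

(* The opposite algebra satisfies the same relations with -i in place of i. *)
Let cC_op (a : A^c) : (- c : A^c) * a = a * (- c : A^c).
Proof. by rewrite !mul_opE mulrN mulNr c_central. Qed.
Let cc_op : (- c : A^c) * (- c : A^c) = -1.
Proof. by rewrite !mul_opE mulrNN c_square. Qed.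
Let zy_op : (z : A^c) * y = - (- c : A^c) * ((y : A^c) * z).
Proof.
rewrite !mul_opE opprK H_zy; nc_ring c_central c_square.
Qed.
Let yx_op : (y : A^c) * x - (x : A^c) * y = (- c : A^c) * ((z : A^c) * z).
Proof.
rewrite !mul_opE mulrN -c_central -H_yx opprB //.
Qed.
Let compc_op k (a : A^c) : hcomp k ((- c : A^c) * a) = (- c : A^c) * hcomp k a.
Proof. by rewrite !mul_opE !mulrN -!c_central raddfN /= compc. Qed.
Let comp0_op (a b : A^c) : b \in [:: x; y; z] -> hcomp 0 (a * b) = 0.
Proof. exact: comp0Ml. Qed.
Let compS_op k (a b : A^c) : b \in [:: x; y; z] ->
  hcomp k.+1 (a * b) = (hcomp k a : A^c) * b.
Proof. exact: compSMl. Qed.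
Let syz_op (a b d : A^c) : a * x + b * y + d * z = 0 ->
  exists b1 b2 b3 : A^c, [/\ a = b3 * y - b1 * x, b = b1 * y + b2 * z - b3 * x
                     & d = (- c : A^c) * (b2 * y - b3 * z)].
Proof.
move=> /H_left_syzygy [b1 [b2 [b3 [e1 e2 e3]]]]; exists b1, b2, b3; split=> //.
by rewrite e3 mul_opE mulrN mulNr c_central.
Qed.

Lemma H_left_regular a : y * a = 0 -> a = 0.
Proof.
exact: (@right_regular_y A^c (@hcomp K A) x y z (- c) cC_op cc_op H_yy zy_op yx_op
  (@comp_comp _ A) (@comp_sep _ A) (@comp_bound _ A) compc_op comp0_op compS_op syz_op a).
Qed.

Lemma H_left_syzygy2 a1 a2 a3 :
    x * a1 = y * a3 -> y * a1 + z * a2 = x * a3 -> y * a2 = z * a3 ->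
  exists a, [/\ a1 = x * a, a2 = - c * (z * a) & a3 = y * a].
Proof.
move=> e1 e2 e3.
have [|||a [d1 d2 d3]] :=
  @quadratic_syzygies A^c (@hcomp K A) x y z (- c) cC_op cc_op H_yy zy_op yx_op
  (@comp_comp _ A) (@comp_sep _ A) (@comp_bound _ A) compc_op comp0_op compS_op syz_op a1 a2 a3 => //.
by exists a; split=> //; rewrite d2 !mul_opE mulrN mulNr c_central.
Qed.

Lemma right_decomposition a : exists k a1 a2 a3,
  a = k%:A + a1 * x + a2 * y + a3 * z.
Proof.
have [F [ev [evX surj ker]]] := presentation_eval.
have [p <-] := surj a.
elim/free_ind_gen: p => [u v [k [a1 [a2 [a3 e1]]]] [l [b1 [b2 [b3 e2]]]]
  |e u [k [a1 [a2 [a3 e1]]]]||s u [k [a1 [a2 [a3 e1]]]]].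
- exists (k + l), (a1 + b1), (a2 + b2), (a3 + b3).
  by rewrite rmorphD /= e1 e2 scalerDl; nc_ring c_central c_square.
- exists (e * k), (e *: a1), (e *: a2), (e *: a3).
  by rewrite linearZ /= e1 !scalerDr scalerA !scalerAl.
- by exists 1, 0, 0, 0; rewrite rmorph1 !mul0r !addr0 scale1r.
- rewrite rmorphM /= evX e1; exists 0.
  have ks (b : A) : b * k%:A = k%:A * b by rewrite mulr_algl mulr_algr.
  case: (ord3P s); [exists (k%:A + x * a1), (x * a2), (x * a3)
   |exists (y * a1), (k%:A + y * a2), (y * a3)|exists (z * a1), (z * a2), (k%:A + z * a3)];
    by rewrite scale0r !mulrDr ks; nc_ring c_central c_square.
Qed.

Lemma left_decomposition a : exists k a1 a2 a3,
  a = k%:A + x * a1 + y * a2 + z * a3.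
Proof.
have [F [ev [evX surj ker]]] := presentation_eval.
have [p <-] := surj a.
elim/free_ind_gen: p => [u v [k [a1 [a2 [a3 e1]]]] [l [b1 [b2 [b3 e2]]]]
  |e u [k [a1 [a2 [a3 e1]]]]||s u _].
- exists (k + l), (a1 + b1), (a2 + b2), (a3 + b3).
  by rewrite rmorphD /= e1 e2 scalerDl; nc_ring c_central c_square.
- exists (e * k), (e *: a1), (e *: a2), (e *: a3).
  by rewrite linearZ /= e1 !scalerDr scalerA !scalerAr.
- by exists 1, 0, 0, 0; rewrite rmorph1 !mulr0 !addr0 scale1r.
- rewrite rmorphM /= evX; exists 0.
  by case: (ord3P s); [exists (ev u), 0, 0|exists 0, (ev u), 0|exists 0, 0, (ev u)];
    rewrite scale0r !mulr0 ?addr0 ?add0r.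
Qed.

Lemma H_connected : connected A.
Proof.
move=> a; split=> [ha|[k ->]]; last exact: gr_alg.
have [k [a1 [a2 [a3 e]]]] := right_decomposition a; exists k.
have := comp_hom 0 ha; rewrite eqxx => <-.
rewrite e !raddfD /= !comp0Mr ?inE ?eqxx ?orbT // !addr0.
by rewrite (comp_hom _ (gr_alg A k)).
Qed.
End HAlgebra.

(** * The Koszul complex of a module *)
Inductive zm_term :=
| ZMvar of nat | ZM0 | ZMadd of zm_term & zm_term | ZMopp of zm_term.

Section ZmodNormal.
Variables (V : zmodType) (env : seq V).

Fixpoint zm_eval (t : zm_term) : V :=
  match t with
  | ZMvar k => nth 0 env k
  | ZM0 => 0
  | ZMadd a b => zm_eval a + zm_eval b
  | ZMopp a => - zm_eval a
  end.

Fixpoint zm_coef (k : nat) (t : zm_term) : int :=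
  match t with
  | ZMvar l => if l == k then 1 else 0
  | ZM0 => 0
  | ZMadd a b => zm_coef k a + zm_coef k b
  | ZMopp a => - zm_coef k a
  end.

Lemma zm_evalE t : zm_eval t = \sum_(k < size env) env`_k *~ zm_coef k t.
Proof.
elim: t => /= [l||a IHa b IHb|a IHa].
- case: (ltnP l (size env)) => ls; last first.
    rewrite nth_default // big1 // => k _; case: eqP => // lk.
    by move: ls; rewrite lk leqNgt ltn_ord.
  rewrite (bigD1 (Ordinal ls)) //= eqxx big1 ?addr0 // => k.
  by rewrite -val_eqE /= eq_sym => /negPf ->.
- by rewrite big1.
- by rewrite IHa IHb -big_split; apply: eq_bigr => k _; rewrite /= mulrzDr.
- by rewrite IHa -sumrN; apply: eq_bigr => k _; rewrite /= mulrNz.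
Qed.

Lemma zm_correct t u :
  all (fun k => zm_coef k (ZMadd t (ZMopp u)) == 0) (iota 0 (size env)) ->
  zm_eval t = zm_eval u.
Proof.
move=> /allP h; apply/subr0_eq; rewrite -[LHS]/(zm_eval (ZMadd t (ZMopp u))) zm_evalE.
by rewrite big1 // => k _; rewrite (eqP (h k _)) ?mulr0z // mem_iota /=.
Qed.
End ZmodNormal.

Ltac zm_atoms t l :=
  match t with
  | GRing.add ?a ?b => let l := zm_atoms a l in zm_atoms b l
  | GRing.opp ?a => zm_atoms a l
  | @GRing.zero _ => l
  | ?a => match nc_mem a l with true => l | false => constr:(a :: l) end
  end.
Ltac zm_reify t l :=
  match t with
  | GRing.add ?a ?b =>
    let p := zm_reify a l in let q := zm_reify b l in constr:(ZMadd p q)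
  | GRing.opp ?a => let p := zm_reify a l in constr:(ZMopp p)
  | @GRing.zero _ => constr:(ZM0)
  | ?a => let k := nc_index a l in constr:(ZMvar k)
  end.
Ltac zm_size l :=
  match l with
  | _ :: ?t => let k := zm_size t in constr:(k.+1)
  | _ => constr:(0%N)
  end.
Ltac zmod_eq :=
  match goal with |- @eq ?T ?t ?u =>
    let l := zm_atoms t (@nil T) in
    let l := zm_atoms u l in
    let p := zm_reify t l in
    let q := zm_reify u l in
    let H := fresh "H" in
    have H := @zm_correct _ l p q;
    cbv beta iota delta [zm_eval nth] in H;
    apply: H; vm_compute; reflexivity
  end.

(** * Projectivity of free modules and of direct sums *)

Section ProjectiveModules.
Variable (R : nzRingType).

Lemma malg_lift_uniq (I : choiceType) (N : lmodType R)
    (f h : {linear {malg R[I]} -> N}) :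
  (forall k, f << k >> = h << k >>) -> f =1 h.
Proof.
move=> e; elim/malg_ind=> [|u v eu ev|c k]; first by rewrite !linear0.
  by rewrite !linearD /= eu ev.
by rewrite !linearZ /= e.
Qed.

Lemma malg_projective (I : choiceType) : projective {malg R[I]}.
Proof.
move=> M N g f g_surj.
have ex k : exists u, g u == f << k >>.
  by have [u <-] := g_surj (f << k >>); exists u.
exists (malg_lift (fun k => xchoose (ex k))).
apply: (@malg_lift_uniq _ _ (g \o malg_lift (fun k => xchoose (ex k))) f) => k /=.
by rewrite malg_liftU; apply/eqP/(xchooseP (ex k)).
Qed.

Lemma pair_projective (P Q : lmodType R) :
  projective P -> projective Q -> projective (P * Q)%type.
Proof.
move=> hP hQ M N g f g_surj.
pose f1u (u : P) : N := f (u, 0); pose f2u (u : Q) : N := f (0, u).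
have l1 : linear f1u.
  move=> a u v; rewrite /f1u -linearP; congr (f _).
  transitivity (a *: u + v, a *: (0 : Q) + 0); last by [].
  by rewrite scaler0 addr0.
have l2 : linear f2u.
  move=> a u v; rewrite /f2u -linearP; congr (f _).
  transitivity (a *: (0 : P) + 0, a *: u + v); last by [].
  by rewrite scaler0 addr0.
pose m1 := GRing.isLinear.Build R P N *:%R f1u l1.
pose m2 := GRing.isLinear.Build R Q N *:%R f2u l2.
pose f1 : {linear P -> N} := HB.pack f1u m1.
pose f2 : {linear Q -> N} := HB.pack f2u m2.
have [h1 h1E] := hP M N g f1 g_surj.
have [h2 h2E] := hQ M N g f2 g_surj.
pose hu (u : P * Q) : M := h1 u.1 + h2 u.2.
have lh : linear hu.
  by move=> a u v; rewrite /hu /= !linearP scalerDr addrACA.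
pose mh := GRing.isLinear.Build R (P * Q)%type M *:%R hu lh.
exists (HB.pack hu mh : {linear (P * Q)%type -> M}) => -[u v].
rewrite /= /hu linearD /= h1E h2E /= /f1u /f2u -linearD; congr (f _).
transitivity (u + 0, 0 + v); first by [].
by rewrite addr0 add0r.
Qed.
End ProjectiveModules.

(* The differential d = dL + dR of a graded complex, where dL raises the degree
   by one and dR preserves it, is exact as soon as leading terms of cycles are
   dL-boundaries: subtract boundaries until the degree is exhausted. *)
Section LeadingTerms.
Variables (X Y Z : zmodType).
Variables (prX : nat -> {additive X -> X}) (prY : nat -> {additive Y -> Y}).
Variables (dL dR : {additive X -> Y}) (e : {additive Y -> Z}).
Hypothesis dL0 : forall b, prY 0 (dL b) = 0.
Hypothesis dLS : forall k b, prY k.+1 (dL b) = dL (prX k b).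
Hypothesis dRE : forall k b, prY k (dR b) = dR (prX k b).
Hypothesis prXX : forall j k b, prX k (prX j b) = if k == j then prX j b else 0.
Hypothesis prY_sep : forall u, (forall k, prY k u = 0) -> u = 0.
Hypothesis prY_bound : forall u, exists n, forall k, (n <= k)%N -> prY k u = 0.
Hypothesis ed : forall b, e (dL b + dR b) = 0.
Hypothesis lead : forall n u, (forall k, (n < k)%N -> prY k u = 0) ->
  e u = 0 -> exists b, prY n u = dL b.
Hypothesis prYY : forall j k u, prY k (prY j u) = if k == j then prY j u else 0.

Lemma exact_of_leading_terms u : e u = 0 -> exists v, u = dL v + dR v.
Proof.
have [n un] := prY_bound u; elim: n u un => [|n IH] u un eu.
  exists 0; rewrite !raddf0 addr0; apply: prY_sep => k; exact: un.
have [b bE] := lead un eu.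
(* [dL] raises degrees by one, so only the part of b in degree n - 1 contributes; taking that part
   also keeps [dR b'] in degree below n. For n = 0 there is none. *)
pose b' := if n is k.+1 then prX k b else 0.
have b'E : dL b' = prY n u.
  have := congr1 (prY n) bE; rewrite prYY eqxx /b' => ->.
  by case: (n) => [|k]; rewrite ?dL0 ?dLS ?raddf0.
have bound k : (n <= k)%N -> prY k (u - (dL b' + dR b')) = 0.
  move=> nk; rewrite raddfB raddfD /= b'E prYY dRE.
  have -> : prX k b' = 0.
    rewrite /b'; case: (n) nk => [|m] mk; first exact: raddf0.
    by rewrite prXX; case: eqP mk => // ->; rewrite ltnn.
  rewrite raddf0 addr0; case: eqP => [->|/eqP kn]; first by rewrite subrr.
  by rewrite subr0; apply: un; rewrite ltn_neqAle eq_sym kn.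
have [|v vE] := IH _ bound; first by rewrite raddfB /= eu ed subrr.
exists (v + b'); rewrite !raddfD /= addrACA -vE; zmod_eq.
Qed.
End LeadingTerms.

Section PairArith.
Variables (R : nzRingType) (P Q : lmodType R).
Implicit Types u v : (P * Q)%type.
Lemma fstD u v : (u + v).1 = u.1 + v.1. Proof. by []. Qed.
Lemma sndD u v : (u + v).2 = u.2 + v.2. Proof. by []. Qed.
Lemma fstN u : (- u).1 = - u.1. Proof. by []. Qed.
Lemma sndN u : (- u).2 = - u.2. Proof. by []. Qed.
Lemma fstZ a u : (a *: u).1 = a *: u.1. Proof. by []. Qed.
Lemma sndZ a u : (a *: u).2 = a *: u.2. Proof. by []. Qed.
Lemma fst0 : (0 : P * Q).1 = 0. Proof. by []. Qed.
Lemma snd0 : (0 : P * Q).2 = 0. Proof. by []. Qed.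
Definition pairE := (fstD, sndD, fstN, sndN, fstZ, sndZ, fst0, snd0).
End PairArith.

Lemma triple_eq (T1 T2 T3 : Type) (u v : T1 * T2 * T3) :
  u.1.1 = v.1.1 -> u.1.2 = v.1.2 -> u.2 = v.2 -> u = v.
Proof. by case: u v => [[? ?] ?] [[? ?] ?] /= -> -> ->. Qed.

Section FreeModuleMaps.
Variables (K : fieldType) (A : graded_alg K) (B : choiceType).
Notation F := {malg A[B]}.

(** On A (x) M this is b (x) m |-> b a (x) m. Acting on the right of the first factor, it is linear
    for the left module structure. *)
Definition rmul (a : A) (u : F) : F := [malg k in msupp u => u@_k * a].
Lemma rmulE a u b : (rmul a u)@_b = u@_b * a.
Proof. by rewrite mcoeffE; case: msuppP => // _; rewrite mul0r. Qed.
Fact rmul_is_linear a : linear (rmul a).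
Proof.
move=> k u v; apply/malgP => b.
by rewrite rmulE !mcoeffD !mcoeffZ !rmulE mulrDl mulrA.
Qed.
HB.instance Definition _ a :=
  GRing.isLinear.Build A F F *:%R (rmul a) (rmul_is_linear a).

Definition fcomp (n : nat) (u : F) : F := [malg k in msupp u => hcomp n u@_k].
Lemma fcompE n u b : (fcomp n u)@_b = hcomp n u@_b.
Proof. by rewrite mcoeffE; case: msuppP => // _; rewrite raddf0. Qed.
Fact fcomp_is_zmod_morphism n : zmod_morphism (fcomp n).
Proof.
move=> u v; apply/malgP => b.
by rewrite fcompE !mcoeffB !fcompE raddfB.
Qed.
HB.instance Definition _ n :=
  GRing.isZmodMorphism.Build F F (fcomp n) (fcomp_is_zmod_morphism n).

Lemma fcomp_fcomp j k u : fcomp k (fcomp j u) = if k == j then fcomp j u else 0.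
Proof.
apply/malgP => b; rewrite !fcompE comp_comp.
by case: eqP => _; rewrite ?fcompE ?mcoeff0.
Qed.
Lemma fcomp_sep u : (forall k, fcomp k u = 0) -> u = 0.
Proof.
move=> u0; apply/malgP => b; rewrite mcoeff0; apply: comp_sep => k.
by rewrite -fcompE u0 mcoeff0.
Qed.
Lemma fcomp_bound u : exists n, forall k, (n <= k)%N -> fcomp k u = 0.
Proof.
pose f b := sval (cid (comp_bound u@_b)).
exists (\max_(b <- msupp u) f b)%N => k nk; apply/malgP => b.
rewrite fcompE mcoeff0; case: msuppP => [bu|_]; last exact: raddf0.
apply: (svalP (cid (comp_bound u@_b))); apply: leq_trans nk.
exact: (@leq_bigmax_seq _ _ xpredT f).
Qed.

(** Exactness is proved one basis element at a time. Choosing 0 outside a finite set keeps the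
    assembled witnesses finitely supported. *)
Lemma malg_choice3 (Q : B -> A -> A -> A -> Prop) (d : {fset B}) :
  (forall b, exists a1 a2 a3, Q b a1 a2 a3) ->
  (forall b, b \notin d -> Q b 0 0 0) ->
  exists u1 u2 u3 : F, forall b, Q b u1@_b u2@_b u3@_b.
Proof.
move=> ex d0.
have ex3 b : exists a : A * A * A, Q b a.1.1 a.1.2 a.2.
  by have [a1 [a2 [a3 h]]] := ex b; exists (a1, a2, a3).
pose f b := sval (cid (ex3 b)); pose fP b := svalP (cid (ex3 b)).
exists [malg b in d => (f b).1.1], [malg b in d => (f b).1.2], [malg b in d => (f b).2].
move=> b; rewrite !mcoeffE; case: ifP => [_|/negbT/d0 //]; exact: fP.
Qed.

Lemma rmul_rmul a b u : rmul a (rmul b u) = rmul (b * a) u.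
Proof. by apply/malgP => k; rewrite !rmulE mulrA. Qed.
Lemma rmulD a b u : rmul (a + b) u = rmul a u + rmul b u.
Proof. by apply/malgP => k; rewrite mcoeffD !rmulE mulrDr. Qed.
Lemma rmulN a u : rmul (- a) u = - rmul a u.
Proof. by apply/malgP => k; rewrite mcoeffN !rmulE mulrN. Qed.
Lemma rmulU a k : rmul a << k >> = a *: << k >>.
Proof.
apply/malgP => b; rewrite rmulE mcoeffZ !mcoeffU mulr_natr.
by case: eqP; rewrite ?mul1r ?mul0r.
Qed.
End FreeModuleMaps.

Section PairMap.
Variables (R : nzRingType) (U P Q : lmodType R).
Variables (f : {linear U -> P}) (h : {linear U -> Q}).
Definition pair_map (u : U) : (P * Q)%type := (f u, h u).
Fact pair_map_is_linear : linear pair_map.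
Proof. by move=> a u v; rewrite /pair_map !linearP. Qed.
HB.instance Definition _ :=
  GRing.isLinear.Build R U (P * Q)%type *:%R pair_map pair_map_is_linear.
End PairMap.

(** * The Koszul complex with coefficients in a module *)

Section KoszulComplex.
Variables (K : fieldType) (i : K) (A : graded_alg K) (g : 'I_3 -> A).
Hypothesis ii : i * i = -1.
Hypothesis g1 : forall s, gr A 1 (g s).
Hypothesis presA : presents g (H_rel i).
Notation x := (g i0).
Notation y := (g i1).
Notation z := (g i2).
Variable c : A.
Hypothesis cE : forall a : A, i *: a = c * a.

(* M is a module with K-basis e, and iota m is 1 (x) m in A (x)_K M. *)
Variables (M : lmodType A) (B : choiceType) (e : B -> M).
Notation F := {malg A[B]}.
Notation F3 := (F * F * F)%type.
Variable iota : {additive M -> F}.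
Hypothesis iotaZ : forall k m, iota ((k%:A : A) *: m) = (k%:A : A) *: iota m.
Hypothesis iota_e : forall b, iota (e b) = << b >>.
Hypothesis iotaK : forall m, malg_lift e (iota m) = m.
Hypothesis iota0 : forall m b, gr A 0 (iota m)@_b.

Definition aug (u : F) : M := malg_lift e u.
Fact aug_is_linear : linear aug. Proof. exact: linearP. Qed.
HB.instance Definition _ := GRing.isLinear.Build A F M *:%R aug aug_is_linear.

(** On A (x) M this is a (x) m |-> a (x) g_s m, so it commutes with every [rmul]. *)
Definition act (s : 'I_3) (u : F) : F := malg_lift (fun b => iota (g s *: e b)) u.
Fact act_is_linear s : linear (act s). Proof. exact: linearP. Qed.
HB.instance Definition _ s :=
  GRing.isLinear.Build A F F *:%R (act s) (act_is_linear s).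

Let cC a : c * a = a * c. Proof. exact: (c_central cE). Qed.
Let cc : c * c = -1. Proof. exact: (c_square ii cE). Qed.
Let conn := H_connected ii g1 presA cE.

Lemma iota_degree0 u : (forall b, gr A 0 u@_b) -> u = iota (aug u).
Proof.
move=> u0; rewrite /aug /= /malg_lift raddf_sum /= {1}(monalgE u).
apply: eq_bigr => b _; have /conn [k ->] := u0 b.
by rewrite iotaZ iota_e malgUZ.
Qed.

Lemma act_iota s m : act s (iota m) = iota (g s *: m).
Proof.
rewrite -{2}(iotaK m) /act /= /malg_lift scaler_sumr raddf_sum /=.
apply: eq_bigr => b _; have /conn [k ->] := iota0 m b.
by rewrite -iotaZ !scalerA mulr_algl mulr_algr.
Qed.

Lemma act_basis s b : act s << b >> = iota (g s *: e b).
Proof. exact: malg_liftU. Qed.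

Lemma rmul_iota a m : rmul a (iota m) = a *: iota m.
Proof.
apply/malgP => b; rewrite rmulE mcoeffZ; have /conn [k ->] := iota0 m b.
by rewrite mulr_algl mulr_algr.
Qed.

Lemma rmulc_iota m : rmul c (iota m) = iota (c *: m).
Proof. by rewrite rmul_iota; have -> : c = i%:A; rewrite ?iotaZ // cE mulr1. Qed.

Lemma rmul_act a s u : rmul a (act s u) = act s (rmul a u).
Proof.
apply: (@malg_lift_uniq _ _ _ (@rmul _ _ _ a \o act s) (act s \o @rmul _ _ _ a)) => b /=.
by rewrite rmulU linearZ /= act_basis rmul_iota.
Qed.

Lemma act_yy u : act i1 (act i1 u) = act i0 (act i0 u).
Proof.
apply: (@malg_lift_uniq _ _ _ (act i1 \o act i1) (act i0 \o act i0)) => b /=.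
by rewrite !act_basis !act_iota !scalerA (H_yy presA).
Qed.

Lemma act_zy u : act i2 (act i1 u) = - rmul c (act i1 (act i2 u)).
Proof.
apply: (@malg_lift_uniq _ _ _ (act i2 \o act i1)
  (\- (@rmul _ _ _ c \o act i1 \o act i2))) => b /=.
rewrite !act_basis !act_iota rmulc_iota -raddfN !scalerA (H_zy presA cE).
by rewrite -scaleNr !mulNr mulrA.
Qed.

Lemma act_yx u :
  act i1 (act i0 u) = act i0 (act i1 u) + rmul c (act i2 (act i2 u)).
Proof.
apply: (@malg_lift_uniq _ _ _ (act i1 \o act i0)
  ((act i0 \o act i1) \+ (@rmul _ _ _ c \o act i2 \o act i2))) => b /=.
rewrite !act_basis !act_iota !scalerA rmulc_iota -raddfD scalerA -scalerDl.
by congr (iota (_ *: _)); rewrite -(H_yx presA cE) addrC subrK.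
Qed.

Lemma rmul_yy (u : F) : rmul y (rmul y u) = rmul x (rmul x u).
Proof. by rewrite !rmul_rmul (H_yy presA). Qed.

Lemma rmul_yz (u : F) : rmul y (rmul z u) = - rmul c (rmul z (rmul y u)).
Proof. by rewrite !rmul_rmul (H_zy presA cE) mulNr rmulN cC mulrA. Qed.

Lemma rmul_xy (u : F) :
  rmul x (rmul y u) = rmul y (rmul x u) + rmul c (rmul z (rmul z u)).
Proof.
rewrite !rmul_rmul (mulrA z) -cC -(H_yx presA cE) rmulD rmulN.
by rewrite addrC subrK.
Qed.

Lemma rmulcc (u : F) : rmul c (rmul c u) = - u.
Proof. by apply/malgP => b; rewrite rmul_rmul rmulE mcoeffN cc mulrN1. Qed.
Lemma rmul_c a (u : F) : rmul a (rmul c u) = rmul c (rmul a u).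
Proof. by rewrite !rmul_rmul cC. Qed.

Lemma actD s u v : act s (u + v) = act s u + act s v.
Proof. exact: linearD. Qed.
Lemma actN s u : act s (- u) = - act s u.
Proof. exact: linearN. Qed.
Lemma rmulDr a (u v : F) : rmul a (u + v) = rmul a u + rmul a v.
Proof. exact: linearD. Qed.
Lemma rmulNr a (u : F) : rmul a (- u) = - rmul a u.
Proof. exact: linearN. Qed.
Definition koszulE := (actD, actN, rmulDr, rmulNr).

Notation p1 := (fst \o fst).
Notation p2 := (snd \o fst).
Notation p3 := snd.
Notation R := (@rmul K A B).

(** These are the differentials of the Koszul complex of bimodules, tensored with M. A generator v
    goes to v (x) 1 - 1 (x) v, and a relator with terms u v goes to the sum of u (x) v (x) 1 + 1 (x)
    u (x) v. The suffix [L] collects the terms that multiply in A, [R] those that act on M. In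
    degree two the coordinates stand for r1 = y^2 - x^2, r2 = zy + i yz and r3 = yx - xy - i z^2. *)
Definition d1L : {linear F3 -> F} := (R x \o p1) \+ (R y \o p2) \+ (R z \o p3).
Definition d1R : {linear F3 -> F} :=
  \- ((act i0 \o p1) \+ (act i1 \o p2) \+ (act i2 \o p3)).
Definition d2L : {linear F3 -> F3} := pair_map (pair_map
  ((R y \o p3) \- (R x \o p1)) ((R y \o p1) \+ (R z \o p2) \- (R x \o p3)))
  (R c \o ((R y \o p2) \- (R z \o p3))).
Definition d2R : {linear F3 -> F3} := pair_map (pair_map
  (\- ((act i0 \o p1) \+ (act i1 \o p3)))
  ((act i1 \o p1) \+ (R c \o act i2 \o p2) \+ (act i0 \o p3)))
  ((act i1 \o p2) \- (R c \o act i2 \o p3)).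
(** In the free algebra x r1 + i z r2 + y r3 = r1 x - r2 z - r3 y. The left side gives [d3L], and
    minus the right side gives [d3R]. *)
Definition d3L : {linear F -> F3} := pair_map (pair_map (R x) (R c \o R z)) (R y).
Definition d3R : {linear F -> F3} :=
  pair_map (pair_map (\- act i0) (act i2)) (act i1).
Definition d1 : {linear F3 -> F} := d1L \+ d1R.
Definition d2 : {linear F3 -> F3} := d2L \+ d2R.
Definition d3 : {linear F -> F3} := d3L \+ d3R.

Lemma d1E u : d1 u = d1L u + d1R u. Proof. by []. Qed.
Lemma d2E u : d2 u = d2L u + d2R u. Proof. by []. Qed.
Lemma d3E u : d3 u = d3L u + d3R u. Proof. by []. Qed.

Ltac koszul :=
  rewrite /d1 /d2 /d3 /d1L /d1R /d2L /d2R /d3L /d3R /pair_map /= ?pairE /=;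
  rewrite ?(koszulE, rmul_act, rmulcc, rmul_c, rmul_yy, rmul_yz, rmul_xy, act_yy, act_zy, act_yx);
  zmod_eq.

Lemma d1_d2 u : d1 (d2L u + d2R u) = 0.
Proof. by case: u => [[u1 u2] u3]; koszul. Qed.

Lemma d2_d3 u : d2 (d3L u + d3R u) = 0.
Proof. by apply: triple_eq; koszul. Qed.

Lemma aug_d1 u : aug (d1L u + d1R u) = 0.
Proof.
have E s v : aug (rmul (g s) v) = aug (act s v).
  apply: (@malg_lift_uniq _ _ _ (aug \o @rmul _ _ _ (g s)) (aug \o act s)) => b /=.
  by rewrite rmulU act_basis linearZ /= /aug /= iotaK malg_liftU.
rewrite linearD /= linearN /= !linearD /= !E; zmod_eq.
Qed.

Definition fcomp3 (n : nat) (u : F3) : F3 :=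
  (fcomp n u.1.1, fcomp n u.1.2, fcomp n u.2).
Fact fcomp3_is_zmod_morphism n : zmod_morphism (fcomp3 n).
Proof. by move=> u v; rewrite /fcomp3 !raddfB. Qed.
HB.instance Definition _ n :=
  GRing.isZmodMorphism.Build F3 F3 (fcomp3 n) (fcomp3_is_zmod_morphism n).

Lemma fcomp3_fcomp3 j k u :
  fcomp3 k (fcomp3 j u) = if k == j then fcomp3 j u else 0.
Proof. by rewrite /fcomp3 /= !fcomp_fcomp; case: eqP. Qed.
Lemma fcomp3_sep u : (forall k, fcomp3 k u = 0) -> u = 0.
Proof.
case: u => [[u1 u2] u3] h.
apply: triple_eq; apply: fcomp_sep => k.
- exact: (congr1 (fun v : F3 => v.1.1) (h k)).
- exact: (congr1 (fun v : F3 => v.1.2) (h k)).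
- exact: (congr1 (fun v : F3 => v.2) (h k)).
Qed.
Lemma fcomp3_bound u : exists n, forall k, (n <= k)%N -> fcomp3 k u = 0.
Proof.
case: u => [[u1 u2] u3].
have [n1 h1] := fcomp_bound u1; have [n2 h2] := fcomp_bound u2.
have [n3 h3] := fcomp_bound u3.
exists (maxn n1 (maxn n2 n3)) => k; rewrite !geq_max => /and3P [k1 k2 k3].
by apply: triple_eq; rewrite /= ?h1 ?h2 ?h3.
Qed.

Lemma fcomp_rmul0 s (u : F) : fcomp 0 (rmul (g s) u) = 0.
Proof.
apply/malgP => b; rewrite fcompE rmulE mcoeff0.
exact: compMr_lt (g1 s) _.
Qed.
Lemma fcomp_rmulS s k (u : F) : fcomp k.+1 (rmul (g s) u) = rmul (g s) (fcomp k u).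
Proof.
apply/malgP => b; rewrite !(fcompE, rmulE) -addn1.
exact: compMr (g1 s).
Qed.
Lemma fcomp_rmulc k (u : F) : fcomp k (rmul c u) = rmul c (fcomp k u).
Proof. by apply/malgP => b; rewrite !(fcompE, rmulE) -!cC -!cE compZ. Qed.
Lemma fcomp_act s k u : fcomp k (act s u) = act s (fcomp k u).
Proof.
elim/malg_ind: u => [|u v eu ev|a b]; first by rewrite !raddf0.
  by rewrite actD !raddfD /= eu ev.
have -> : fcomp k (a *: << b >>) = hcomp k a *: (<< b >> : F).
  apply/malgP => b'; rewrite fcompE !mcoeffZ mcoeffU !mulr_natr.
  by case: eqP; rewrite ?mulr1n ?mulr0n ?raddf0.
rewrite !linearZ /= act_basis; apply/malgP => b'.
rewrite fcompE !mcoeffZ -[in LHS](addn0 k).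
exact: compMr (iota0 _ _).
Qed.
Lemma fcompD n u v : fcomp n (u + v) = fcomp n u + fcomp n v :> F.
Proof. exact: raddfD. Qed.
Lemma fcomp3D n u v : fcomp3 n (u + v) = fcomp3 n u + fcomp3 n v.
Proof. exact: raddfD. Qed.
Definition fcomp_koszulE :=
  (fcomp_rmul0, fcomp_rmulS, fcomp_rmulc, fcomp_act).

Ltac components := rewrite /fcomp3 /pair_map /= ?(raddf0, raddfD, raddfN) /=
  ?fcomp_koszulE ?(mulr0, addr0, subr0, oppr0).

Lemma d1L_0 u : fcomp 0 (d1L u) = 0.
Proof. by rewrite /d1L /= !raddfD /= !fcomp_rmul0 !addr0. Qed.
Lemma d1L_S k u : fcomp k.+1 (d1L u) = d1L (fcomp3 k u).
Proof. by rewrite /d1L /= !raddfD /= !fcomp_rmulS. Qed.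
Lemma d1R_comp k u : fcomp k (d1R u) = d1R (fcomp3 k u).
Proof. by rewrite /d1R /= raddfN !raddfD /= !fcomp_act. Qed.
Lemma d2L_0 u : fcomp3 0 (d2L u) = 0.
Proof.
by apply: triple_eq; rewrite /= ?fcomp_rmulc raddfB ?raddfD /=
  !fcomp_rmul0 ?raddf0 ?subrr ?addr0 ?subrr ?raddf0.
Qed.
Lemma d2L_S k u : fcomp3 k.+1 (d2L u) = d2L (fcomp3 k u).
Proof.
by apply: triple_eq; rewrite /= ?fcomp_rmulc raddfB ?raddfD /= !fcomp_rmulS.
Qed.
Lemma d2R_comp k u : fcomp3 k (d2R u) = d2R (fcomp3 k u).
Proof.
by apply: triple_eq; rewrite /= ?raddfB ?raddfN ?raddfD /= ?fcomp_rmulc !fcomp_act.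
Qed.
Lemma d3L_0 u : fcomp3 0 (d3L u) = 0.
Proof.
by apply: triple_eq; rewrite /= ?fcomp_rmulc !fcomp_rmul0 ?raddf0.
Qed.
Lemma d3L_S k u : fcomp3 k.+1 (d3L u) = d3L (fcomp k u).
Proof. by apply: triple_eq; rewrite /= ?fcomp_rmulc !fcomp_rmulS. Qed.
Lemma d3R_comp k u : fcomp3 k (d3R u) = d3R (fcomp k u).
Proof. by apply: triple_eq; rewrite /= ?raddfN /= !fcomp_act. Qed.

(** In degree n + 1 the cycle condition involves only [d1L] of the top component, because [d1R]
    preserves degrees. That equation splits over the basis of M into linear syzygies in H. *)
Lemma lead1 n u : (forall k, (n < k)%N -> fcomp3 k u = 0) -> d1 u = 0 ->
  exists b, fcomp3 n u = d2L b.
Proof.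
move=> un e0; have := congr1 (fcomp n.+1) e0.
rewrite d1E fcompD d1L_S d1R_comp (un _ (ltnSn n)) linear0 addr0 raddf0.
case: (fcomp3 n u) => [[u1 u2] u3] {u un e0} e0.
pose Q b a1 a2 a3 := [/\ u1@_b = a3 * y - a1 * x,
  u2@_b = a1 * y + a2 * z - a3 * x & u3@_b = c * (a2 * y - a3 * z)].
have [b|b|v1 [v2 [v3 vE]]] := @malg_choice3 _ _ _ Q (msupp u1 `|` msupp u2 `|` msupp u3)%fset.
- have /malgP /(_ b) := e0; rewrite /d1L /= !mcoeffD !rmulE mcoeff0.
  by move=> /(H_right_syzygy ii presA cE).
- rewrite !inE !negb_or => /andP [/andP [b1 b2] b3].
  rewrite /Q !mcoeff_outdom //; split; nc_ring cC cc.
exists (v1, v2, v3); apply: triple_eq; apply/malgP => b; have [h1 h2 h3] := vE b.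
- by rewrite h1 /= mcoeffB !rmulE.
- by rewrite h2 /= mcoeffB mcoeffD !rmulE.
- by rewrite h3 /= rmulE mcoeffB !rmulE cC.
Qed.

Lemma lead2 n u : (forall k, (n < k)%N -> fcomp3 k u = 0) -> d2 u = 0 ->
  exists b, fcomp3 n u = d3L b.
Proof.
move=> un e0; have := congr1 (fcomp3 n.+1) e0.
rewrite d2E fcomp3D d2L_S d2R_comp (un _ (ltnSn n)) linear0 addr0 raddf0.
case: (fcomp3 n u) => [[u1 u2] u3] {u un e0} e0.
pose Q b (a a2 a3 : A) := [/\ u1@_b = a * x, u2@_b = c * (a * z) & u3@_b = a * y].
have [b|b|v [v2 [v3 vE]]] := @malg_choice3 _ _ _ Q (msupp u1 `|` msupp u2 `|` msupp u3)%fset.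
- have [|||a h] := H_right_syzygy2 ii g1 presA cE (a1 := u1@_b) (a2 := u2@_b) (a3 := u3@_b).
  + have /(congr1 (fun v : F3 => v.1.1@_b)) := e0.
    by rewrite /= mcoeffB !rmulE mcoeff0 => /subr0_eq.
  + have /(congr1 (fun v : F3 => v.1.2@_b)) := e0.
    by rewrite /= mcoeffB mcoeffD !rmulE mcoeff0 => /subr0_eq.
  + have /(congr1 (fun v : F3 => v.2@_b)) := e0.
    rewrite /= rmulE mcoeffB !rmulE mcoeff0 => /(congr1 (fun a => a * c)).
    by rewrite -mulrA cc mulrN1 mul0r => /eqP; rewrite oppr_eq0 subr_eq0 => /eqP.
  by exists a, 0, 0.
- rewrite !inE !negb_or => /andP [/andP [b1 b2] b3].
  by rewrite /Q !mcoeff_outdom // !mul0r mulr0.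
exists v; apply: triple_eq; apply/malgP => b; have [h1 h2 h3] := vE b.
- by rewrite h1 /= rmulE.
- by rewrite h2 /= !rmulE cC.
- by rewrite h3 /= rmulE.
Qed.

Lemma lead3 n u : (forall k, (n < k)%N -> fcomp k u = 0) -> d3 u = 0 ->
  fcomp n u = 0.
Proof.
move=> un e0; have := congr1 (fcomp3 n.+1) e0.
rewrite d3E fcomp3D d3L_S d3R_comp (un _ (ltnSn n)) linear0 addr0 raddf0.
move=> {}e0; apply/malgP => b; rewrite mcoeff0.
apply: (H_right_regular ii g1 presA cE).
by have /(congr1 (fun v : F3 => v.2@_b)) := e0; rewrite /= rmulE mcoeff0.
Qed.

Lemma lead0 n u : (forall k, (n < k)%N -> fcomp k u = 0) -> aug u = 0 ->
  exists b, fcomp n u = d1L b.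
Proof.
case: n => [|n] un e0.
  (* An element of degree 0 is some 1 (x) m, and [aug] recovers m; hence u = 0. In higher degrees
     every component is already a combination of x, y, z. *)
  exists 0; rewrite raddf0; suff -> : u = 0 by rewrite raddf0.
  rewrite (@iota_degree0 u) ?e0 ?raddf0 // => b; apply/(homP (@gr_grading K A)).
  move=> [//|k] _; have /malgP /(_ b) := un k.+1 isT.
  by rewrite fcompE mcoeff0.
pose Q b a1 a2 a3 := (fcomp n.+1 u)@_b = a1 * x + a2 * y + a3 * z.
have [b|b|v1 [v2 [v3 vE]]] := @malg_choice3 _ _ _ Q (msupp u).
- have [k [a1 [a2 [a3 e1]]]] := right_decomposition ii presA cE u@_b.
  exists (hcomp n a1), (hcomp n a2), (hcomp n a3).
  rewrite /Q fcompE e1 !raddfD /= (comp_hom _ (gr_alg A k)) add0r.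
  by rewrite -[n.+1]addn1 !(compMr _ _ (g1 _)).
- by move=> bu; rewrite /Q fcompE mcoeff_outdom // raddf0 !mul0r !addr0.
exists (v1, v2, v3); apply/malgP => b; rewrite (vE b) /=.
by rewrite !mcoeffD !rmulE.
Qed.

Notation Z := {malg A[void]}.
Lemma malg_void (u : Z) : u = 0. Proof. by apply/malgP => -[]. Qed.

Lemma exact0 u : aug u = 0 <-> exists v, u = d1 v.
Proof.
split=> [|[v ->]]; last exact: aug_d1.
apply: (exact_of_leading_terms (prX := fcomp3) (prY := @fcomp K A B) (dL := d1L) (dR := d1R)).
- exact: d1L_0.
- exact: d1L_S.
- exact: d1R_comp.
- exact: fcomp3_fcomp3.
- exact: fcomp_sep.
- exact: fcomp_bound.
- exact: aug_d1.
- exact: lead0.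
- exact: fcomp_fcomp.
Qed.

Lemma exact1 u : d1 u = 0 <-> exists v, u = d2 v.
Proof.
split=> [|[v ->]]; last exact: d1_d2.
apply: (exact_of_leading_terms (prX := fcomp3) (prY := fcomp3) (dL := d2L) (dR := d2R)).
- exact: d2L_0.
- exact: d2L_S.
- exact: d2R_comp.
- exact: fcomp3_fcomp3.
- exact: fcomp3_sep.
- exact: fcomp3_bound.
- exact: d1_d2.
- exact: lead1.
- exact: fcomp3_fcomp3.
Qed.

Lemma exact2 u : d2 u = 0 <-> exists v, u = d3 v.
Proof.
split=> [|[v ->]]; last exact: d2_d3.
apply: (exact_of_leading_terms (prX := @fcomp K A B) (prY := fcomp3) (dL := d3L) (dR := d3R)).
- exact: d3L_0.
- exact: d3L_S.
- exact: d3R_comp.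
- exact: fcomp_fcomp.
- exact: fcomp3_sep.
- exact: fcomp3_bound.
- exact: d2_d3.
- exact: lead2.
- exact: fcomp3_fcomp3.
Qed.

Lemma d3_inj u : d3 u = 0 -> u = 0.
Proof.
have [n un] := fcomp_bound u; elim: n un => [un _|n IH un e0].
  by apply: fcomp_sep => k; apply: un.
apply: IH => // k; rewrite leq_eqVlt => /predU1P [<-|/un //].
by apply: lead3 e0 => k'; apply: un.
Qed.

(** The zero module is encoded as the free module on [void], so projectivity past degree 3 is again
    that of free modules. *)
Definition koszul_module (n : nat) : lmodType A :=
  match n with 0 => F | 1 => F3 | 2 => F3 | 3 => F | _ => Z end.

Definition koszul_d (n : nat) : {linear koszul_module n.+1 -> koszul_module n} :=
  match n return {linear koszul_module n.+1 -> koszul_module n} with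
  | 0 => d1 | 1 => d2 | 2 => d3 | 3 => \0 : {linear Z -> F} | _ => \0 : {linear Z -> Z}
  end.

Lemma koszul_projective n : projective (koszul_module n).
Proof.
have F3P : projective (F3 : lmodType A).
  by do 2?apply: pair_projective; apply: malg_projective.
by case: n => [|[|[|[|n]]]] //=; apply: malg_projective.
Qed.

Lemma koszul_exact n u : koszul_d n u = 0 <-> exists v, u = koszul_d n.+1 v.
Proof.
case: n u => [|[|[|[|n]]]] u.
- exact: exact1.
- exact: exact2.
- split=> [/d3_inj ->|[v ->]]; last exact: (linear0 d3).
  by exists 0.
- by split=> _; [exists 0; exact: malg_void|].
- by split=> _; [exists 0; exact: malg_void|].
Qed.

Lemma aug_surj m : exists u, aug u = m.
Proof. by exists (iota m); apply: iotaK. Qed.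

Definition koszul_resolution : resolution M :=
  @Resolution A M koszul_module koszul_d aug koszul_projective aug_surj exact0
    koszul_exact.

Lemma koszul_pd : pd_le M 3.
Proof.
by exists koszul_resolution => -[|[|[|[|m]]]] // _ u; apply: malg_void.
Qed.
End KoszulComplex.

(** * Global dimension *)
Section VectorSpaceBasis.
Variables (K : fieldType) (A : graded_alg K) (conn : connected A).
Variable (M : lmodType A).
Local Open Scope classical_set_scope.
Notation lin := (@malg_lift A M M id).

(** M is a module over A, so linear algebra over the field is done inside free A-modules, with
    coefficients restricted to A_0 = K. *)
Let scalar_coefs (J : choiceType) (u : {malg A[J]}) := forall m, gr A 0 u@_m.

Definition lin_independent (S : set M) := forall u : {malg A[M]},
  scalar_coefs u -> (forall m, u@_m != 0 -> S m) -> lin u = 0 -> u = 0.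

(** Zorn's lemma applies because a relation has finite support, and a finite nonempty part of the
    union of a chain lies in one member; empty support means u = 0. *)
Lemma max_independent : exists S, lin_independent S /\
  forall T, S `<` T -> ~ lin_independent T.
Proof.
apply: Zorn_bigcup => Fam Find Ftot u u0 uS.
have [|u_nil|[X FX uX]] : (forall m, m \in msupp u -> (\bigcup_(X in Fam) X) m) ->
    u = 0 \/ exists2 X, Fam X & forall m, m \in msupp u -> X m.
- have {u0 uS} : forall s : seq M, (forall m, m \in s -> (\bigcup_(X in Fam) X) m) ->
      s = [::] \/ exists2 X, Fam X & forall m, m \in s -> X m.
    elim=> [_|m s IH h]; first by left.
    right; have [Y FY Ym] := h m (mem_head _ _).
    have [|s0|[X FX Xs]] := IH; first by move=> n ns; apply: h; rewrite inE ns orbT.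
      by exists Y => // n; rewrite s0 inE => /eqP ->.
    have [XY|YX] := Ftot X Y FX FY.
      by exists Y => // n; rewrite inE => /predU1P [->|/Xs /XY].
    by exists X => // n; rewrite inE => /predU1P [->|/Xs] //; apply: YX.
  move=> /(_ (msupp u)) h us; case: (h us) => [u_nil|]; [left|by right].
  apply/malgP => m; rewrite mcoeff0; apply: mcoeff_outdom.
  by rewrite -[m \in _]/(m \in (msupp u : seq M)) u_nil.
- by move=> m; rewrite -mcoeff_neq0 => /uS.
- by rewrite u_nil.
by move=> lu; apply: (Find X FX u) => // m; rewrite mcoeff_neq0 => /uX.
Qed.

Lemma independent_basis : exists (B : choiceType) (e : B -> M),
  (forall u : {malg A[B]}, scalar_coefs u -> malg_lift e u = 0 -> u = 0) /\
  (forall m, exists2 u : {malg A[B]}, scalar_coefs u & malg_lift e u = m).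
Proof.
have [S [Sind Smax]] := max_independent.
pose B : choiceType := {m : M | `[< S m >]}.
pose e (b : B) : M := val b.
pose j (u : {malg A[B]}) : {malg A[M]} := malg_lift (fun b : B => << e b >>) u.
have jE u b : (j u)@_(e b) = u@_b.
  rewrite /j; elim/malg_ind: u => [|u v eu ev|c k]; first by rewrite linear0 !mcoeff0.
    by rewrite linearD /= !mcoeffD eu ev.
  rewrite linearZ /= malg_liftU !mcoeffZ !mcoeffU.
  by rewrite (inj_eq val_inj).
have j0 u m : ~ S m -> (j u)@_m = 0.
  move=> Sm; rewrite /j; elim/malg_ind: u => [|u v eu ev|c k].
  - by rewrite linear0 mcoeff0.
  - by rewrite linearD /= mcoeffD eu ev addr0.
  rewrite linearZ /= malg_liftU mcoeffZ mcoeffU; case: eqP; rewrite ?mulr0 // => km.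
  by case: Sm; rewrite -km; apply/asboolP/(valP k).
have jlin u : malg_lift e u = lin (j u).
  apply: (malg_lift_uniq (f := malg_lift e) (h := lin \o malg_lift (fun b : B => << e b >>))) => b.
  by rewrite /= !malg_liftU.
exists B, e; split=> [u u0 eu|m].
  have ju0 : j u = 0.
    apply: Sind; [| |by rewrite -jlin].
      move=> m; have [Sm|Sm] := pselect (S m); last by rewrite j0 //; apply: gr0.
      by rewrite -[m]/(e (Sub m (asboolT Sm))) jE.
    move=> m; have [//|Sm] := pselect (S m); by rewrite j0 // eqxx.
  by apply/malgP => b; rewrite -jE ju0 !mcoeff0.
have [v [v0 vS vm]] : exists v : {malg A[M]},
    [/\ scalar_coefs v, forall n, v@_n != 0 -> S n & lin v = m].
  have [Sm|Sm] := pselect (S m).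
    exists << m >>; split; last exact: malg_liftU.
      by move=> n; rewrite mcoeffU; case: eqP => _; [apply: gr_one|apply: gr0].
    by move=> n; rewrite mcoeffU; case: (m =P n) => [<- //|_]; rewrite eqxx.
  (* If m is not a combination of elements of S, then S with m added is still independent: a
     relation with nonzero coefficient at m could be solved for m. *)
  apply: contrapT => no; apply: (Smax (S `|` [set m])).
    by split=> [n Sn|/(_ m)]; [left|move=> h; apply: Sm; apply: h; right].
  move=> u u0 uS lu; apply: Sind => //.
  move=> n un; have [//|nm] := uS n un; case: no.
  rewrite /= in nm; rewrite {n}nm in un.
  have [k uk] := (conn _).1 (u0 m).
  have k0 : k != 0 by apply: contraNneq un => k0; rewrite uk k0 scale0r.
  (* Subtracting u divided by its coefficient k at m removes m from the support, and the value is
     still m because u is a relation. *)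
  exists (<< m >> - (k^-1%:A : A) *: u); split.
  - move=> n; rewrite mcoeffB mcoeffZ mcoeffU; apply: grB.
      by case: eqP => _; [apply: gr_one|apply: gr0].
    by rewrite -[0%N]addn0; apply: gr_mul => //; apply: gr_alg.
  - move=> n; rewrite mcoeffB mcoeffZ mcoeffU; case: (m =P n) => [<-|/eqP mn].
      by rewrite uk mulr_algl scalerA mulVf // scale1r subrr eqxx.
    rewrite sub0r oppr_eq0 => un0; have /uS [//|/= nm] : u@_n != 0.
      by apply: contraNneq un0 => ->; rewrite mulr0.
    by rewrite nm eqxx in mn.
  - by rewrite linearB linearZ /= lu scaler0 subr0 malg_liftU.
pose w : {malg A[B]} := [malg b in [fset b in pmap insub (msupp v)]%fset => v@_(e b)].
have wE b : w@_b = v@_(e b).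
  rewrite mcoeffE; case: ifP => // /negbT; rewrite !inE mem_pmap_sub /= => bv.
  by rewrite mcoeff_outdom.
exists w; first by move=> b; rewrite wE.
rewrite jlin -vm; congr (malg_lift _ _); apply/malgP => n.
have [Sn|Sn] := pselect (S n).
  by rewrite -[n]/(e (Sub n (asboolT Sn))) jE wE.
rewrite j0 //; apply/esym/eqP; apply: contrapT => /negP /vS; exact: Sn.
Qed.

Lemma coordinates : exists (B : choiceType) (e : B -> M)
    (iota : {additive M -> {malg A[B]}}),
  [/\ forall k m, iota ((k%:A : A) *: m) = (k%:A : A) *: iota m,
      forall b, iota (e b) = << b >>, forall m, malg_lift e (iota m) = m
    & forall m b, gr A 0 (iota m)@_b].
Proof.
have [B [e [inj surj]]] := independent_basis.
have ex m : exists u : {malg A[B]}, scalar_coefs u /\ malg_lift e u = m.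
  by have [u] := surj m; exists u.
pose f m := sval (cid (ex m)).
have f0 m : scalar_coefs (f m) := (svalP (cid (ex m))).1.
have fK m : malg_lift e (f m) = m := (svalP (cid (ex m))).2.
have f_uniq u m : scalar_coefs u -> malg_lift e u = m -> f m = u.
  move=> u0 um; apply: subr0_eq; apply: inj.
    by move=> b; rewrite mcoeffB; apply: grB; [apply: f0|apply: u0].
  by rewrite linearB /= fK um subrr.
have fB : zmod_morphism f.
  move=> u v; apply: f_uniq; last by rewrite linearB /= !fK.
  by move=> b; rewrite mcoeffB; apply: grB; apply: f0.
pose mf := GRing.isZmodMorphism.Build M {malg A[B]} f fB.
pose F : {additive M -> {malg A[B]}} := HB.pack f mf.
exists B, e, F; split=> //= [k m|b].
  apply: f_uniq; last by rewrite linearZ /= fK.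
  move=> b; rewrite mcoeffZ -[0%N]addn0; apply: gr_mul (f0 m b).
  exact: gr_alg.
apply: f_uniq; last exact: malg_liftU.
by move=> b'; rewrite mcoeffU; case: eqP => _; [apply: gr_one|apply: gr0].
Qed.
End VectorSpaceBasis.

(** * Lifting along exact sequences and comparison of resolutions *)

Section Kernel.
Variables (R : nzRingType) (U V : lmodType R) (f : {linear U -> V}).
Definition kernel_pred : {pred U} := [pred u | f u == 0].
Fact kernel_submod_closed : submod_closed kernel_pred.
Proof.
split=> [|a u v]; rewrite !inE /=; first by rewrite linear0.
by move=> /eqP u0 /eqP v0; rewrite linearP u0 v0 scaler0 addr0.
Qed.
HB.instance Definition _ :=
  GRing.isSubmodClosed.Build R U kernel_pred kernel_submod_closed.
Record kernel := Kernel { kernel_val : U; _ : kernel_val \in kernel_pred }.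
HB.instance Definition _ := [isSub for kernel_val].
HB.instance Definition _ := [Choice of kernel by <:].
HB.instance Definition _ := [SubChoice_isSubLmodule of kernel by <:].
End Kernel.

(** [projective] lifts only through surjections. Exactness makes d surjective onto the kernel of d',
    which is therefore built as a module in its own right. *)
Lemma projective_lifting (R : nzRingType) (X N1 N2 N3 : lmodType R)
    (f : {linear X -> N2}) (d : {linear N1 -> N2}) (d' : {linear N2 -> N3}) :
  projective X -> (forall u, d' u = 0 <-> exists v, u = d v) ->
  (forall u, d' (f u) = 0) -> exists h : {linear X -> N1}, forall u, d (h u) = f u.
Proof.
move=> projX ex df.
have kd v : d v \in kernel_pred d' by rewrite inE; apply/eqP/ex; exists v.
have kf u : f u \in kernel_pred d' by rewrite inE df.
pose dk v : kernel d' := Sub (d v) (kd v).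
pose fk u : kernel d' := Sub (f u) (kf u).
have dk_lin : linear dk by move=> a u v; apply: val_inj; rewrite /= linearP.
have fk_lin : linear fk by move=> a u v; apply: val_inj; rewrite /= linearP.
pose md := GRing.isLinear.Build R N1 (kernel d') *:%R dk dk_lin.
pose mf := GRing.isLinear.Build R X (kernel d') *:%R fk fk_lin.
have [|h hE] := projX _ _ (HB.pack dk md : {linear N1 -> kernel d'})
  (HB.pack fk mf : {linear X -> kernel d'}).
  move=> [u ku]; have /eqP/ex [v vE] : d' u == 0 by exact: ku.
  by exists v; apply: val_inj.
by exists h => u; have /(congr1 val) := hE u.
Qed.

(* Comparing P with a resolution Q of length two through chain maps both ways
   and a chain homotopy, the last differential of P splits. *)
Lemma short_resolution_split (R : nzRingType) (M : lmodType R) (P Q : resolution M) :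
  (forall m, (2 < m)%N -> forall u : Q m, u = 0) ->
  (forall u, res_d P 2 u = 0 -> u = 0) ->
  exists h : {linear P 2 -> P 3}, forall u, h (res_d P 2 u) = u.
Proof.
move=> Q0 Pinj.
pose pP := res_proj (r := P); pose pQ := res_proj (r := Q).
have augd (S : resolution M) u : res_aug S (res_d S 0 u) = 0.
  by apply/res_exact0; exists u.
have dd (S : resolution M) n u : res_d S n (res_d S n.+1 u) = 0.
  by apply/res_exact; exists u.
have [f0 f0E] := pP 0%N _ _ (res_aug Q) (res_aug P) (res_aug_surj Q).
have [g0 g0E] := pQ 0%N _ _ (res_aug P) (res_aug Q) (res_aug_surj P).
have [|f1 f1E] := projective_lifting (f := f0 \o res_d P 0) (pP 1%N) (@res_exact0 _ _ Q).
  by move=> u /=; rewrite f0E augd.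
have [|f2 f2E] := projective_lifting (f := f1 \o res_d P 1) (pP 2%N) (@res_exact _ _ Q 0).
  by move=> u /=; rewrite f1E /= dd linear0.
have [|g1 g1E] := projective_lifting (f := g0 \o res_d Q 0) (pQ 1%N) (@res_exact0 _ _ P).
  by move=> u /=; rewrite g0E augd.
have [|g2 g2E] := projective_lifting (f := g1 \o res_d Q 1) (pQ 2%N) (@res_exact _ _ P 0).
  by move=> u /=; rewrite g1E /= dd linear0.
have [|h0 h0E] := projective_lifting (f := idfun \- (g0 \o f0)) (pP 0%N) (@res_exact0 _ _ P).
  by move=> u /=; rewrite linearB /= g0E f0E subrr.
have [|h1 h1E] := projective_lifting (f := idfun \- (g1 \o f1) \- (h0 \o res_d P 0)) (pP 1%N)
    (@res_exact _ _ P 0).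
  by move=> u /=; rewrite !linearB /= h0E g1E /= f1E /= subrr.
have [|h2 h2E] := projective_lifting (f := idfun \- (g2 \o f2) \- (h1 \o res_d P 1)) (pP 2%N)
    (@res_exact _ _ P 1).
  move=> u /=; rewrite !linearB /= h1E /= g2E /= f2E /= dd linear0 subr0.
  by rewrite subrr.
exists h2 => u; apply/subr0_eq/Pinj; rewrite linearB /= h2E /= dd linear0 subr0.
have -> : f2 (res_d P 2 u) = 0.
  have /res_exact [v ->] : res_d Q 1 (f2 (res_d P 2 u)) = 0.
    by rewrite f2E /= dd linear0.
  by rewrite (Q0 3%N isT v) linear0.
by rewrite linear0 subr0 subrr.
Qed.

Lemma comp0M (K : fieldType) (A : graded_alg K) (a b : A) :
  hcomp 0 (a * b) = hcomp 0 a * hcomp 0 b.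
Proof.
have [n an] := comp_bound a; case: n an => [|n] an.
  by rewrite (compE an) big_ord0 mul0r raddf0 mul0r.
rewrite {1}(compE an) big_ord_recl mulrDl raddfD /= -[0%N in LHS]addn0.
rewrite (compMl _ _ (comp_in 0 a)) mulr_suml raddf_sum big1 ?addr0 // => j _.
exact: compMl_lt (comp_in _ a) _.
Qed.

(** * The residue field as a module *)

Section Residue.
Variables (K : fieldType) (A : graded_alg K) (conn : connected A).

Definition augmentation (a : A) : K :=
  sval (cid ((conn (hcomp 0 a)).1 (comp_in 0 a))).

Lemma augmentationE a : hcomp 0 a = (augmentation a)%:A.
Proof. exact: (svalP (cid ((conn (hcomp 0 a)).1 (comp_in 0 a)))). Qed.

Lemma in_alg_inj : injective (fun k : K => k%:A : A).
Proof. exact: (fmorph_inj (GRing.in_alg A)). Qed.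

Lemma augmentation_alg k : augmentation k%:A = k.
Proof. by apply: in_alg_inj; rewrite -augmentationE (comp_hom _ (gr_alg A k)). Qed.

Lemma augmentationD a b : augmentation (a + b) = augmentation a + augmentation b.
Proof.
by apply: in_alg_inj; rewrite -augmentationE raddfD /= !augmentationE -scalerDl.
Qed.

Lemma augmentationM a b : augmentation (a * b) = augmentation a * augmentation b.
Proof.
apply: in_alg_inj; rewrite -augmentationE comp0M !augmentationE.
by rewrite mulr_algl scalerA.
Qed.

Lemma augmentation_hom n a : gr A n a -> (0 < n)%N -> augmentation a = 0.
Proof.
move=> ha n0; apply: in_alg_inj; rewrite -augmentationE (comp_hom _ ha) scale0r.
by case: eqP n0 => // <-.
Qed.

(** The [let] makes the type depend on [conn], from which the augmentation and hence the module
    structure are defined. *)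
Definition residue : Type := let _ := conn in K.
HB.instance Definition _ := GRing.Zmodule.copy residue K.
Definition residue_scale (a : A) (u : residue) : residue := augmentation a * (u : K).
Fact residue_scaleA a b u :
  residue_scale a (residue_scale b u) = residue_scale (a * b) u.
Proof. by rewrite /residue_scale augmentationM mulrA. Qed.
Fact residue_scale1 : left_id 1 residue_scale.
Proof.
by move=> u; rewrite /residue_scale -[1]scale1r augmentation_alg mul1r.
Qed.
Fact residue_scaleDr : right_distributive residue_scale +%R.
Proof. by move=> a u v; rewrite /residue_scale mulrDr. Qed.
Fact residue_scaleDl u : {morph residue_scale^~ u : a b / a + b}.
Proof. by move=> a b; rewrite /residue_scale augmentationD mulrDl. Qed.
HB.instance Definition _ := GRing.Zmodule_isLmodule.Build A residue
  residue_scaleA residue_scale1 residue_scaleDr residue_scaleDl.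

Lemma residue_is_residue_module : residue_module (residue : lmodType A).
Proof.
exists (1 : K); split.
- by apply/eqP; apply: oner_neq0.
- move=> u; exists (u : K).
  by rewrite [RHS]/(residue_scale _ _) /residue_scale augmentation_alg mulr1.
- move=> n a n0 ha.
  by rewrite [LHS]/(residue_scale _ _) /residue_scale (augmentation_hom ha) ?mul0r.
Qed.

Definition residue_basis (_ : unit) : residue := (1 : K).
Definition residue_iota (m : residue) : {malg A[unit]} := ((m : K)%:A : A) *: << tt >>.
Fact residue_iota_is_zmod_morphism : zmod_morphism residue_iota.
Proof. by move=> u v; rewrite /residue_iota -scalerBl -scalerBl. Qed.
HB.instance Definition _ := GRing.isZmodMorphism.Build residue {malg A[unit]}
  residue_iota residue_iota_is_zmod_morphism.

Lemma residue_iotaZ k m :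
  residue_iota ((k%:A : A) *: m) = (k%:A : A) *: residue_iota m.
Proof.
rewrite /residue_iota scalerA mulr_algl scalerA.
by rewrite [X in ((X : K)%:A : A) *: _]/(residue_scale _ _) /residue_scale augmentation_alg.
Qed.
Lemma residue_iota_e b : residue_iota (residue_basis b) = << b >>.
Proof. by case: b; rewrite /residue_iota /residue_basis !scale1r. Qed.
Lemma residue_iotaK m : malg_lift residue_basis (residue_iota m) = m.
Proof.
rewrite /residue_iota linearZ /= malg_liftU.
by rewrite [LHS]/(residue_scale _ _) /residue_scale augmentation_alg mulr1.
Qed.
Lemma residue_iota0 m b : gr A 0 (residue_iota m)@_b.
Proof.
rewrite /residue_iota mcoeffZ mcoeffU mulr_natr; apply/conn.
by case: b; exists m.
Qed.
End Residue.

(** * The Gorenstein property *)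
Section GradedPieces.
Variables (V : zmodType) (pr : nat -> {additive V -> V}).
Hypothesis prVV : forall j k u, pr k (pr j u) = if k == j then pr j u else 0.
Hypothesis pr_sep : forall u, (forall k, pr k u = 0) -> u = 0.
Hypothesis pr_bound : forall u, exists n, forall k, (n <= k)%N -> pr k u = 0.

(* The grading of V placed in degrees s, s + 1, ... *)
Definition shifted_piece (s : int) (j : int) (u : V) : Prop :=
  if j - s is Posz n then pr n u = u else u = 0.

Let p (s j : int) (u : V) : V := if j - s is Posz n then pr n u else 0.

Lemma shifted_piece_grading s : is_grading (shifted_piece s).
Proof.
apply: (@is_grading_proj _ _ _ (p s)).
- by move=> j u v; rewrite /p; case: (j - s) => n; rewrite ?raddfB ?subrr.
- move=> j v; split=> [|h]; last first.
    have := h j; rewrite eqxx /p /shifted_piece; by case: (j - s) => // n /esym.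
  rewrite /shifted_piece; case E : (j - s) => [n|n] hv k; last first.
    by rewrite hv if_same /p; case: (k - s) => m; rewrite ?raddf0.
  rewrite -{1}hv /p; case E' : (k - s) => [m|m].
    rewrite prVV hv -[k](subrK s) -[j](subrK s) E E'.
    by rewrite (inj_eq (addIr s)).
  by case: eqP => // kj; move: E'; rewrite kj E.
- move=> j v; rewrite /shifted_piece /p; case: (j - s) => // n.
  by rewrite prVV eqxx.
- move=> v; have [n vn] := pr_bound v.
  exists [seq m%:Z + s | m <- iota 0 n].
    by rewrite map_inj_uniq ?iota_uniq // => a b /addIr [].
  rewrite big_map; apply/subr0_eq/pr_sep => k; rewrite raddfB raddf_sum /=.
  rewrite (eq_bigr (fun m => if k == m then pr m v else 0)); last first.
    by move=> m _; rewrite /p addrK prVV.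
  case: (ltnP k n) => kn.
    rewrite (bigD1_seq k) ?iota_uniq ?mem_iota //= eqxx big1 ?addr0 ?subrr //.
    by move=> m; rewrite eq_sym => /negPf ->.
  rewrite vn // big1_seq ?subrr // => m; rewrite mem_iota /= => mn.
  by case: eqP => // e; move: kn; rewrite e leqNgt mn.
Qed.

Lemma shifted_piece0 s j : shifted_piece s j 0.
Proof. by rewrite /shifted_piece; case: (j - s) => // n; apply: raddf0. Qed.
End GradedPieces.

Lemma shifted_piece_map (V W : zmodType) (pv : nat -> {additive V -> V})
    (pw : nat -> {additive W -> W}) (f : {additive V -> W}) s j u :
  (forall k u, pw k.+1 (f u) = f (pv k u)) ->
  shifted_piece pv (s + 1) j u -> shifted_piece pw s j (f u).
Proof.
move=> fS; rewrite /shifted_piece opprD addrA.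
case E : (j - s - 1) => [n|n]; last by move=> ->; rewrite raddf0; apply: shifted_piece0.
have -> : j - s = n.+1 by rewrite -[LHS](subrK 1) E -addn1.
by move=> e; rewrite fS e.
Qed.

Section HomogeneousInt.
Variables (K : fieldType) (A : graded_alg K).

Definition hz (j : int) (a : A) : A := if j is Posz n then hcomp n a else 0.
Lemma hz_id j a : grz (A := A) j a -> hz j a = a.
Proof. by case: j => [n|n] //= ha; rewrite (comp_hom _ ha) eqxx. Qed.
Lemma hz_in j a : grz (A := A) j (hz j a).
Proof. by case: j => [n|n] //=; apply: comp_in. Qed.
Lemma hzB j a b : hz j (a - b) = hz j a - hz j b.
Proof. by case: j => [n|n] /=; rewrite ?raddfB ?subrr. Qed.
Lemma hzD j a b : hz j (a + b) = hz j a + hz j b.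
Proof. by case: j => [n|n] /=; rewrite ?raddfD ?addr0. Qed.
Lemma grz0 j : grz (A := A) j 0.
Proof. by case: j => [n|n] //=; apply: gr0. Qed.
Lemma hzM j a b : gr A 1 a -> hz (j + 1) (a * b) = a * hz j b.
Proof.
move=> ha; case: j => [n|n].
  have -> : Posz n + 1 = Posz (1 + n) by rewrite addrC PoszD.
  exact: compMl.
(* [Negz 0] is degree -1. There j + 1 = 0, and a b has no part of degree 0 because a has degree
   1. *)
rewrite /= mulr0; case: n => [|n]; first exact: compMl_lt ha _.
have -> : Negz n.+1 + 1 = Negz n by rewrite !NegzE -addn1 PoszD opprD addrNK.
by [].
Qed.
Lemma grzM j l a b : grz (A := A) j a -> grz (A := A) l b -> grz (A := A) (j + l) (a * b).
Proof.
case: j => [n|n] /= ha; last by rewrite ha mul0r => _; apply: grz0.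
case: l => [m|m] /= hb; last by rewrite hb mulr0; apply: grz0.
exact: gr_mul.
Qed.
Lemma hz_neq0 j k : j != 0 -> hz j (k%:A) = 0.
Proof.
by case: j => [[|n]|n] //= _; rewrite (comp_hom _ (gr_alg A k)).
Qed.
End HomogeneousInt.

Lemma free3_linear_eq (R : nzRingType) (J : choiceType) (N : lmodType R)
    (f h : {linear ({malg R[J]} * {malg R[J]} * {malg R[J]})%type -> N}) :
  (forall b, f (<< b >>, 0, 0) = h (<< b >>, 0, 0)) ->
  (forall b, f (0, << b >>, 0) = h (0, << b >>, 0)) ->
  (forall b, f (0, 0, << b >>) = h (0, 0, << b >>)) -> f =1 h.
Proof.
move=> e1 e2 e3 [[u1 u2] u3].
have -> : (u1, u2, u3) = (u1, 0, 0) + (0, u2, 0) + (0, 0, u3)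
    :> ({malg R[J]} * {malg R[J]} * {malg R[J]})%type.
  by apply: triple_eq; rewrite ?pairE /= ?addr0 ?add0r.
have split3 (w : {malg R[J]} -> ({malg R[J]} * {malg R[J]} * {malg R[J]})%type) u :
    linear w -> (forall b, f (w << b >>) = h (w << b >>)) -> f (w u) = h (w u).
  move=> wl ew; pose mw := GRing.isLinear.Build R {malg R[J]}
    ({malg R[J]} * {malg R[J]} * {malg R[J]})%type *:%R w wl.
  pose W : {linear {malg R[J]} -> ({malg R[J]} * {malg R[J]} * {malg R[J]})%type} :=
    HB.pack w mw.
  exact: (malg_lift_uniq (f := f \o W) (h := h \o W)).
rewrite !linearD /=; congr (_ + _ + _).
- apply: (split3 (fun u => (u, 0, 0))) => // a u v.
  by apply: triple_eq; rewrite ?pairE /= ?scaler0 ?addr0.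
- apply: (split3 (fun u => (0, u, 0))) => // a u v.
  by apply: triple_eq; rewrite ?pairE /= ?scaler0 ?addr0.
- apply: (split3 (fun u => (0, 0, u))) => // a u v.
  by apply: triple_eq; rewrite ?pairE /= ?scaler0 ?addr0.
Qed.

(** * The graded resolution of the residue field and its dual *)

Section ResidueResolution.
Variables (K : fieldType) (i : K) (A : graded_alg K) (g : 'I_3 -> A).
Hypothesis ii : i * i = -1.
Hypothesis g1 : forall s, gr A 1 (g s).
Hypothesis presA : presents g (H_rel i).
Notation x := (g i0).
Notation y := (g i1).
Notation z := (g i2).
Variable c : A.
Hypothesis cE : forall a : A, i *: a = c * a.
Let cC a : c * a = a * c. Proof. exact: (c_central cE). Qed.
Let cc : c * c = -1. Proof. exact: (c_square ii cE). Qed.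

Let conn : connected A := H_connected ii g1 presA cE.
Notation M := (residue conn : lmodType A).
Notation F := {malg A[unit]}.
Notation F3 := (F * F * F)%type.
Notation b0 := (<< tt >> : F).

Definition residue_resolution : resolution M :=
  koszul_resolution ii g1 presA cE (@residue_iotaZ K A conn)
  (@residue_iota_e K A conn) (@residue_iotaK K A conn) (@residue_iota0 K A conn).

Notation P := residue_resolution.

(** Generators have positive degree and kill the residue field. The correction terms thus disappear,
    leaving the ordinary Koszul complex. *)
Lemma residue_act s u : act g (@residue_basis K A conn) (@residue_iota K A conn) s u = 0.
Proof.
have E a (m : M) : gr A 1 a -> a *: m = 0.
  move=> ha; rewrite [LHS]/(residue_scale _ _) /residue_scale.
  by rewrite (augmentation_hom conn ha) ?mul0r.
apply: (malg_lift_uniq (h := \0 : {linear F -> F})) => b /=.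
by rewrite /act malg_liftU E ?raddf0.
Qed.

Lemma residue_d1 (u : F3) : res_d P 0 u = rmul x u.1.1 + rmul y u.1.2 + rmul z u.2.
Proof.
rewrite [LHS]d1E /d1R /= !residue_act !addr0 oppr0 addr0 //.
Qed.
Lemma residue_d2 (u : F3) : res_d P 1 u =
  (rmul y u.2 - rmul x u.1.1, rmul y u.1.1 + rmul z u.1.2 - rmul x u.2,
   rmul c (rmul y u.1.2 - rmul z u.2)) :> F3.
Proof.
rewrite [LHS]d2E; apply: triple_eq; rewrite ?pairE /= !residue_act ?raddf0;
  by rewrite !(subr0, addr0, oppr0).
Qed.
Lemma residue_d3 (u : F) : res_d P 2 u = (rmul x u, rmul c (rmul z u), rmul y u) :> F3.
Proof.
by rewrite [LHS]d3E; apply: triple_eq; rewrite ?pairE /= !residue_act ?oppr0 !addr0.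
Qed.

Lemma H_global_dimension : global_dimension A 3.
Proof.
split=> [N|e le_e].
  have [B [f [iota [iotaZ iota_e iotaK iota0]]]] := coordinates conn N.
  exact: (koszul_pd ii g1 presA cE iotaZ iota_e iotaK iota0).
rewrite leqNgt; apply/negP => e3.
have [Q Q0] := le_e M.
have [||h hE] := @short_resolution_split A M P Q.
- by move=> m m2; apply: Q0; apply: leq_trans m2.
- move=> u; exact: (d3_inj ii g1 presA cE (@residue_iota0 K A conn)).
(* A splitting would write the basis vector as a combination with coefficients x, z c, y of elements
   of the free module. Its coordinate would then have no part of degree 0, but that coordinate is
   1. *)
have := hE b0.
have -> : res_d P 2 b0 = x *: ((b0, 0, 0) : F3) + (z * c) *: ((0, b0, 0) : F3)
     + y *: ((0, 0, b0) : F3).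
  rewrite residue_d3; apply: triple_eq;
    by rewrite ?pairE /= ?scaler0 ?addr0 ?add0r ?rmul_rmul !rmulU.
rewrite !linearD !linearZ /= => /(congr1 (fun u : F => hcomp 0 u@_tt)).
rewrite !mcoeffD !mcoeffZ mcoeffUU !raddfD /= -cC -mulrA.
rewrite (comp_hom _ (gr_one A)) eqxx (compc cE) !(compMl_lt _ (g1 _)) //.
by rewrite mulr0 !addr0 => /esym/eqP; rewrite oner_eq0.
Qed.

(** The n-th module is generated in degree n, which makes the differentials homogeneous of degree 0.
    Past 3 the module is zero, and [True] describes each of its pieces. *)
Definition residue_pieces (n : nat) : int -> P n -> Prop :=
  match n return int -> P n -> Prop with
  | 0 => shifted_piece (@fcomp K A unit) 0
  | 1 => shifted_piece (@fcomp3 K A unit) 1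
  | 2 => shifted_piece (@fcomp3 K A unit) 2
  | 3 => shifted_piece (@fcomp K A unit) 3
  | _ => fun _ _ => True
  end.

Lemma fcompZ m n (a : A) (u : F) : gr A n a ->
  fcomp (n + m) (a *: u) = a *: fcomp m u.
Proof.
move=> ha; apply/malgP => b; rewrite fcompE !mcoeffZ fcompE.
exact: compMl.
Qed.

Lemma shifted_piece_action (V : lmodType A) (pr : nat -> {additive V -> V})
    (s : int) : (forall m n (a : A) u, gr A n a -> pr (n + m)%N (a *: u) = a *: pr m u) ->
  forall n j (a : A) u, gr A n a -> shifted_piece pr s j u ->
    shifted_piece pr s (n%:Z + j) (a *: u).
Proof.
move=> prZ n j a u ha; rewrite {1}/shifted_piece; case E : (j - s) => [m|m].
  by move=> e; rewrite /shifted_piece -addrA E -PoszD prZ // e.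
by move=> ->; rewrite scaler0; apply: shifted_piece0.
Qed.

Lemma residue_graded_resolution : graded_resolution residue_pieces.
Proof.
have fcomp3Z m n (a : A) (u : F3) : gr A n a -> fcomp3 (n + m) (a *: u) = a *: fcomp3 m u.
  by move=> ha; apply: triple_eq; rewrite ?pairE /= fcompZ.
split.
- have gF s : graded_module (A := A) (shifted_piece (@fcomp K A unit) s).
    split; last exact/shifted_piece_action/fcompZ.
    exact: (shifted_piece_grading (@fcomp_fcomp K A unit) (@fcomp_sep K A unit) (@fcomp_bound K A unit)).
  have gF3 s : graded_module (A := A) (shifted_piece (@fcomp3 K A unit) s).
    split; last exact/shifted_piece_action/fcomp3Z.
    exact: (shifted_piece_grading (@fcomp3_fcomp3 K A unit) (@fcomp3_sep K A unit) (@fcomp3_bound K A unit)).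
  case=> [|[|[|[|n]]]]; [exact: gF|exact: gF3|exact: gF3|exact: gF|].
  split; last by [].
  split=> //.
    by move=> v; exists [::], (fun=> 0); split=> //; rewrite big_nil; apply: malg_void.
  by move=> s f _ _ _ j _; apply: malg_void.
- have d1S k u : fcomp k.+1 (res_d P 0 u) = res_d P 0 (fcomp3 k u).
    by rewrite !residue_d1 !fcompD !(fcomp_rmulS g1).
  have d2S k u : fcomp3 k.+1 (res_d P 1 u) = res_d P 1 (fcomp3 k u).
    rewrite !residue_d2; apply: triple_eq; rewrite /= ?(fcomp_rmulc cE) raddfB ?raddfD /=;
    by rewrite !(fcomp_rmulS g1).
  have d3S k u : fcomp3 k.+1 (res_d P 2 u) = res_d P 2 (fcomp k u).
    by rewrite !residue_d3; apply: triple_eq; rewrite /= ?(fcomp_rmulc cE) !(fcomp_rmulS g1).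
  move=> [|[|[|[|n]]]] j u //.
  + exact: (@shifted_piece_map _ _ _ _ (res_d P 0) 0 j u d1S).
  + exact: (@shifted_piece_map _ _ _ _ (res_d P 1) 1 j u d2S).
  + exact: (@shifted_piece_map _ _ _ _ (res_d P 2) 2 j u d3S).
  + by move=> _; rewrite [u]malg_void raddf0; apply: shifted_piece0.
- move=> j u j0; rewrite /= /shifted_piece subr0.
  case: j j0 => [n|n] n0; last by move=> ->; rewrite linear0.
  move=> un; rewrite -un [LHS](_ : _ = malg_lift (@residue_basis K A conn) (fcomp n u)) //.
  rewrite /malg_lift big1 // => b _; rewrite fcompE.
  rewrite [LHS]/(residue_scale _ _) /residue_scale (augmentation_hom conn (comp_in n _)) ?mul0r //.
  by case: n n0 {un}.
Qed.

Definition constant_map (a : A) (u : F) : (A^o : lmodType A) := malg_lift (N := A^o) (fun=> a) u.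
Fact constant_map_is_linear a : linear (constant_map a).
Proof. exact: linearP. Qed.
HB.instance Definition _ a := GRing.isLinear.Build A F A^o *:%R (constant_map a)
  (constant_map_is_linear a).
Lemma constant_mapU a : constant_map a b0 = a.
Proof. exact: malg_liftU. Qed.

Lemma constant_mapE a u : constant_map a u = u@_tt * a.
Proof.
rewrite /constant_map; elim/malg_ind: u => [|u v eu ev|k []].
- by rewrite linear0 mcoeff0 mul0r.
- by rewrite linearD /= eu ev mcoeffD mulrDl.
- by rewrite linearZ /= malg_liftU mcoeffZ mcoeffUU mulr1.
Qed.

Lemma piece_coef s j u : shifted_piece (@fcomp K A unit) s j u ->
  grz (A := A) (j - s) u@_tt.
Proof.
rewrite /shifted_piece; case: (j - s) => n /= e; last by rewrite e mcoeff0.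
by rewrite -e fcompE; apply: comp_in.
Qed.

Lemma piece_coef3 s j u : shifted_piece (@fcomp3 K A unit) s j u ->
  [/\ grz (A := A) (j - s) u.1.1@_tt, grz (A := A) (j - s) u.1.2@_tt
    & grz (A := A) (j - s) u.2@_tt].
Proof.
rewrite /shifted_piece; case: (j - s) => n /= e; last by rewrite e /= mcoeff0.
by rewrite -e /= !fcompE; split; apply: comp_in.
Qed.

Notation E1 := ((b0, 0, 0) : F3).
Notation E2 := ((0, b0, 0) : F3).
Notation E3 := ((0, 0, b0) : F3).

Lemma fcomp_b0 : fcomp 0 b0 = b0.
Proof.
apply/malgP => -[]; rewrite fcompE mcoeffUU.
by rewrite (comp_hom _ (gr_one A)).
Qed.

Lemma piece_b0 s : shifted_piece (@fcomp K A unit) s s b0.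
Proof. by rewrite /shifted_piece subrr; apply: fcomp_b0. Qed.

Lemma piece_E s : [/\ shifted_piece (@fcomp3 K A unit) s s E1,
  shifted_piece (@fcomp3 K A unit) s s E2 & shifted_piece (@fcomp3 K A unit) s s E3].
Proof.
by rewrite /shifted_piece subrr; split; apply: triple_eq; rewrite /= ?fcomp_b0 ?raddf0.
Qed.

Lemma residue_dE : [/\ res_d P 0 E1 = x *: b0, res_d P 0 E2 = y *: b0
                     & res_d P 0 E3 = z *: b0].
Proof. by rewrite !residue_d1 /= !raddf0 !rmulU !(addr0, add0r). Qed.

Lemma residue_d2E : [/\ res_d P 1 E1 = y *: E2 - x *: E1,
    res_d P 1 E2 = z *: E2 + (y * c) *: E3
  & res_d P 1 E3 = y *: E1 - x *: E2 - (z * c) *: E3].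
Proof.
by split; rewrite residue_d2; apply: triple_eq;
  rewrite ?pairE /= ?raddfB /= ?rmul_rmul ?raddf0 ?rmulU ?scaler0 ?(oppr0, addr0, add0r, subr0, sub0r).
Qed.

Lemma residue_d3E : res_d P 2 b0 = x *: E1 + (z * c) *: E2 + y *: E3.
Proof.
by rewrite residue_d3; apply: triple_eq;
  rewrite ?pairE /= ?scaler0 ?addr0 ?add0r ?rmul_rmul !rmulU.
Qed.

Lemma regular_linearZ (N : lmodType A) (f : {linear N -> (A^o : lmodType A)})
  (a : A) u : f (a *: u) = a * (f u : A).
Proof. exact: linearZ. Qed.

(* The cochain complex Hom(P, A) is the left-hand version of the complex P,
   hence exact by the syzygy lemmas for the opposite algebra. *)
Lemma Ext0 l : Ext_zero residue_pieces 0 l.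
Proof.
move=> f [_ f0] u; apply: (malg_lift_uniq (f := f) (h := \0)) => -[] /=.
apply: (H_left_regular ii g1 presA cE).
have := f0 E2; have [_ -> _] := residue_dE.
by rewrite (regular_linearZ f).
Qed.

Lemma Ext1 l : Ext_zero residue_pieces 1 l.
Proof.
move=> f [fl f0].
have [d2E1 d2E2 d2E3] := residue_d2E.
have [h1 h2 h3] := piece_E 1.
set a1 : A := f E1; set a2 : A := f E2; set a3 : A := f E3.
have e1 : x * a1 = y * a2.
  have := f0 E1; rewrite d2E1 linearB /= !(regular_linearZ f) => /eqP.
  by rewrite subr_eq0 => /eqP ->.
have e2 : z * a2 = - (y * c * a3).
  have := f0 E2; rewrite d2E2 linearD /= !(regular_linearZ f) => /eqP.
  by rewrite addr_eq0 => /eqP ->.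
have e3 : y * a1 - z * c * a3 = x * a2.
  have := f0 E3; rewrite d2E3 !linearB /= !(regular_linearZ f) => /eqP.
  by rewrite addrAC subr_eq0 => /eqP ->.
(* Swapping the values on [E2] and [E3], and multiplying the one on [E3] by - c, turns the cocycle
   equations into those of the left syzygies. *)
have [|||a [d1 d2 d3]] := H_left_syzygy2 ii g1 presA cE (a1 := a1) (a2 := - (c * a3)) (a3 := a2) => //.
- by rewrite -e3; nc_ring cC cc.
- by rewrite e2; nc_ring cC cc.
have {}d2 : a3 = z * a.
  rewrite -[a3]opprK -mulN1r -cc; transitivity (c * - (c * a3)); first by nc_ring cC cc.
  by rewrite d2; nc_ring cC cc.
(* The values of f on the generators have degree 1 + l, so a may be replaced by its component of
   degree l; the bounding map becomes homogeneous. *)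
have hl s b : grz (A := A) (1 + l) b -> b = g s * a -> b = g s * hz l a.
  by move=> hb e; rewrite -(hz_id hb) e addrC hzM.
exists (constant_map (hz l a)).
  move=> j u hu; rewrite /= constant_mapE; apply: grzM (hz_in _ _).
  by have := piece_coef hu; rewrite subr0.
apply: (free3_linear_eq (f := f) (h := constant_map (hz l a) \o res_d P 0)) => -[].
- by rewrite -[RHS]/(constant_map (hz l a) (res_d P 0 E1)) constant_mapE
    residue_d1 /= !mcoeffD !rmulE mcoeffUU !mcoeff0 !mul0r ?addr0 ?add0r mul1r; apply: hl d1; apply: fl h1.
- by rewrite -[RHS]/(constant_map (hz l a) (res_d P 0 E2)) constant_mapE
    residue_d1 /= !mcoeffD !rmulE mcoeffUU !mcoeff0 !mul0r ?addr0 ?add0r mul1r; apply: hl d3; apply: fl h2.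
- by rewrite -[RHS]/(constant_map (hz l a) (res_d P 0 E3)) constant_mapE
    residue_d1 /= !mcoeffD !rmulE mcoeffUU !mcoeff0 !mul0r ?addr0 ?add0r mul1r; apply: hl d2; apply: fl h3.
Qed.

Definition constant_map3 (a1 a2 a3 : A) : {linear F3 -> (A^o : lmodType A)} :=
  (constant_map a1 \o (fst \o fst)) \+ (constant_map a2 \o (snd \o fst))
  \+ (constant_map a3 \o snd).
Lemma constant_map3E a1 a2 a3 u :
  constant_map3 a1 a2 a3 u = u.1.1@_tt * a1 + u.1.2@_tt * a2 + u.2@_tt * a3.
Proof. by rewrite /constant_map3 /= !constant_mapE. Qed.

Lemma constant_map3_cochain s l a1 a2 a3 j u :
  grz (A := A) (s + l) a1 -> grz (A := A) (s + l) a2 -> grz (A := A) (s + l) a3 ->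
  shifted_piece (@fcomp3 K A unit) s j u ->
  grz (A := A) (j + l) (constant_map3 a1 a2 a3 u).
Proof.
move=> h1 h2 h3 /piece_coef3 [k1 k2 k3]; rewrite constant_map3E.
have -> : j + l = (j - s) + (s + l) by rewrite addrA subrK.
have D t a b : grz (A := A) t a -> grz (A := A) t b -> grz (A := A) t (a + b).
  case: t => [n|n] /=; first exact: grD.
  by move=> -> ->; rewrite addr0.
by apply: (D); [apply: (D)|]; apply: grzM.
Qed.

Lemma Ext2 l : Ext_zero residue_pieces 2 l.
Proof.
move=> f [fl f0].
have [h1 h2 h3] := piece_E 2.
set a1 : A := f E1; set a2 : A := f E2; set a3 : A := f E3.
have e1 : x * a1 + y * a3 + z * (c * a2) = 0.
  have := f0 b0; rewrite residue_d3E !linearD /= !(regular_linearZ f) => e.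
  by rewrite -[RHS]e addrAC mulrA.
have [b1 [b2 [b3 [d1 d3 d2]]]] := H_left_syzygy ii presA cE e1.
have {}d2 : a2 = z * b3 - y * b2.
  rewrite -[a2]opprK -mulN1r -cc; transitivity (- (c * (c * a2))); first by nc_ring cC cc.
  by rewrite d2; transitivity (- (c * c) * (z * b3 - y * b2)); rewrite ?cc; nc_ring cC cc.
have E : (1 + l) + 1 = 2 + l by rewrite addrAC.
have hb a : grz (A := A) (2 + l) a -> a = hz (1 + l + 1) a by rewrite E => /hz_id.
pose c1 := hz (1 + l) b1; pose c2 := hz (1 + l) b2; pose c3 := hz (1 + l) b3.
have hzc t b : hz t (c * b) = c * hz t b by case: t => n /=; rewrite ?mulr0 ?(compc cE).
(* The transposed differential matches the parametrisation of left syzygies after a swap of the last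
   two coordinates and a factor c. *)
exists (constant_map3 c1 c3 (c * c2)).
  move=> j u; apply: constant_map3_cochain; try exact: hz_in.
  by rewrite -hzc; apply: hz_in.
have [d2E1 d2E2 d2E3] := residue_d2E.
apply: (free3_linear_eq (f := f) (h := constant_map3 c1 c3 (c * c2) \o res_d P 1)) => -[].
- rewrite -[RHS]/(constant_map3 c1 c3 (c * c2) (res_d P 1 E1)).
  rewrite constant_map3E residue_d2 /= !(rmulE, mcoeffB, mcoeffD) ?mcoeffUU ?mcoeff0.
  rewrite (hb _ (fl _ _ h1)) -/a1 d1 hzB !hzM // -/c1 -/c3; nc_ring cC cc.
- rewrite -[RHS]/(constant_map3 c1 c3 (c * c2) (res_d P 1 E2)).
  rewrite constant_map3E residue_d2 /= !(rmulE, mcoeffB, mcoeffD) ?mcoeffUU ?mcoeff0.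
  rewrite (hb _ (fl _ _ h2)) -/a2 d2 hzB !hzM // -/c2 -/c3; nc_ring cC cc.
- rewrite -[RHS]/(constant_map3 c1 c3 (c * c2) (res_d P 1 E3)).
  rewrite constant_map3E residue_d2 /= !(rmulE, mcoeffB, mcoeffD) ?mcoeffUU ?mcoeff0.
  rewrite (hb _ (fl _ _ h3)) -/a3 d3 hzB hzD !hzM // -/c1 -/c2 -/c3; nc_ring cC cc.
Qed.

Lemma Ext_large n l : Ext_zero residue_pieces n.+4 l.
Proof.
move=> f _; exists (\0 : {linear P n.+3 -> A^o}).
  by move=> j u _ /=; apply: grz0.
by move=> u; rewrite [u]malg_void linear0.
Qed.

Lemma Ext3_coboundary l (f : {linear P 3 -> (A^o : lmodType A)}) :
  (exists a1 a2 a3, [/\ grz (A := A) (2 + l) a1, grz (A := A) (2 + l) a2,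
    grz (A := A) (2 + l) a3 & f b0 = x * a1 + y * a2 + z * a3 :> A]) ->
  coboundary residue_pieces l (i := 3) (f : P 3 -> A).
Proof.
move=> [a1 [a2 [a3 [h1 h2 h3 e]]]].
(* The generator of [P 3] maps to x E1 + z c E2 + y E3, so the value on [E2] must be - c a3 to
   produce z a3. *)
exists (constant_map3 a1 (- (c * a3)) a2).
  move=> j u; apply: constant_map3_cochain => //.
  have D t a : grz (A := A) t a -> grz (A := A) t (- (c * a)).
    case: t => n /=; last by move=> ->; rewrite mulr0 oppr0.
    by move=> ha; rewrite -cE -scaleNr; apply: gr_scale.
  exact: D.
apply: (malg_lift_uniq (f := f) (h := constant_map3 a1 (- (c * a3)) a2 \o res_d P 2)) => -[].
rewrite -[RHS]/(constant_map3 a1 (- (c * a3)) a2 (res_d P 2 b0)).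
rewrite constant_map3E residue_d3 /= !rmulE mcoeffUU e.
nc_ring cC cc.
Qed.

(** The value of f on the generator has degree 3 + l, which is nonzero; without a scalar part it
    lies in x A + y A + z A, and so f is a coboundary. *)
Lemma Ext3_zero l : l != -3 -> Ext_zero residue_pieces 3 l.
Proof.
move=> l3 f [fl _]; apply: Ext3_coboundary.
have [k [a1 [a2 [a3 e]]]] := left_decomposition ii presA cE (f b0 : A).
exists (hz (2 + l) a1), (hz (2 + l) a2), (hz (2 + l) a3).
split; try exact: hz_in.
have E : 3 + l = (2 + l) + 1 by rewrite [RHS]addrAC.
have := hz_id (fl _ _ (piece_b0 3)); rewrite {1}e !hzD hz_neq0; last first.
  by rewrite addrC addr_eq0.
by rewrite add0r E !hzM // => <-.
Qed.

(** As [P 3] is generated in degree 3, a map of degree -3 sends the generator to a scalar.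
    Coboundaries send it into x A + y A + z A, where the only scalar is 0. *)
Lemma Ext3_one_dim : Ext_one_dim residue_pieces 3 (-3).
Proof.
exists (constant_map 1); split.
- split; last by move=> u; rewrite [u]malg_void !linear0.
  move=> j u hu; rewrite /= constant_mapE mulr1; exact: piece_coef hu.
- move=> [f fl /(_ b0)]; rewrite [X in X = _](constant_mapU 1) residue_d3E !linearD /= !(regular_linearZ f).
  move=> /(congr1 (hcomp 0)); rewrite !raddfD /= (comp_hom _ (gr_one A)) eqxx.
  have r a b : gr A 1 a -> hcomp 0 (a * b) = 0 by move=> ha; apply: compMl_lt ha _.
  rewrite !r // ?addr0 => [|]; first by move/eqP; rewrite oner_eq0.
  by apply: (@gr_mul _ A 1 0) => //; rewrite -[c]mulr1 -cE; apply: gr_alg.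
- move=> f [fl _].
  have := fl _ _ (piece_b0 3); rewrite subrr => /conn [k fk].
  exists k; exists (\0 : {linear P 2 -> A^o}); first by move=> j u _ /=; apply: grz0.
  move=> u /=; rewrite constant_mapE mulr1.
  have -> : (f u : A) = u@_tt * k%:A.
    rewrite -constant_mapE.
    apply: (malg_lift_uniq (f := f) (h := constant_map (k%:A : A))) => -[].
    by rewrite /= constant_mapU.
  by rewrite mulr_algr subrr.
Qed.

Lemma H_gorenstein : gorenstein A 3.
Proof.
exists M, P, residue_pieces; split.
- exact: residue_is_residue_module.
- exact: residue_graded_resolution.
exists (-3); first exact: Ext3_one_dim.
move=> [|[|[|[|n]]]] m nm.
- exact: Ext0.
- exact: Ext1.
- exact: Ext2.
- by apply: Ext3_zero; apply: contraNneq nm => ->.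
- exact: Ext_large.
Qed.
End ResidueResolution.

(** * Polynomial growth *)
Lemma sum_ord3 (V : nmodType) (f : 'I_3 -> V) : \sum_s f s = f i0 + f i1 + f i2.
Proof.
rewrite !big_ord_recl big_ord0 addr0 addrA.
by congr (f _ + f _ + f _); apply: val_inj; rewrite /= inordK.
Qed.

Lemma homogeneous_relation (K : fieldType) (I : choiceType) (wt : I -> nat) n
    (p q : free_alg K I) k :
  homogeneous wt n p -> homogeneous wt n q -> homogeneous wt n (p - k *: q).
Proof.
move=> hp hq w /(fsubsetP (msuppB_le _ _)); rewrite inE => /orP [/hp //|].
by move=> /(fsubsetP (msuppZ_le _ _)) /hq.
Qed.

Lemma homogeneous_gen2 (K : fieldType) (I : choiceType) (wt : I -> nat) s t :
  homogeneous wt (wt s + wt t) (fgen K s * fgen K t).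
Proof.
move=> w; have -> : fgen K s * fgen K t = << mmul (fmu s) (fmu t) >> by apply: malgUM.
rewrite msuppU oner_eq0 inE => /eqP ->.
by rewrite fmM !fmU /= !big_cons big_nil addn0.
Qed.

Section Span.
Variables (K : fieldType) (V : lmodType K) (L : seq V).
Definition in_span (a : V) := exists c : nat -> K, a = \sum_(j < size L) c j *: L`_j.
Lemma in_span0 : in_span 0.
Proof. by exists (fun=> 0); rewrite big1 // => j _; rewrite scale0r. Qed.
Lemma in_spanD a b : in_span a -> in_span b -> in_span (a + b).
Proof.
move=> [c ->] [d ->]; exists (fun j => c j + d j).
by rewrite -big_split; apply: eq_bigr => j _ /=; rewrite scalerDl.
Qed.
Lemma in_spanZ k a : in_span a -> in_span (k *: a).
Proof.
move=> [c ->]; exists (fun j => k * c j).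
by rewrite scaler_sumr; apply: eq_bigr => j _; rewrite scalerA.
Qed.
Lemma in_span_mem a : a \in L -> in_span a.
Proof.
move=> aL; have ai : (index a L < size L)%N by rewrite index_mem.
exists (fun j => (j == index a L)%:R).
rewrite (bigD1 (Ordinal ai)) //= eqxx scale1r nth_index // big1 ?addr0 // => j.
by rewrite -val_eqE /= => /negPf ->; rewrite scale0r.
Qed.
End Span.

Section Growth.
Variables (K : fieldType) (i : K) (A : graded_alg K) (g : 'I_3 -> A).
Hypothesis ii : i * i = -1.
Hypothesis g1 : forall s, gr A 1 (g s).
Hypothesis presA : presents g (H_rel i).
Notation x := (g i0).
Notation y := (g i1).
Notation z := (g i2).
Variable c : A.
Hypothesis cE : forall a : A, i *: a = c * a.
Let cC a : c * a = a * c. Proof. exact: (c_central cE). Qed.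
Let cc : c * c = -1. Proof. exact: (c_square ii cE). Qed.
Let yy := H_yy presA.
Let zy := H_zy presA cE.
Let yx := H_yx presA cE.

Fixpoint alternating (p q : A) (n : nat) : A :=
  if n is m.+1 then p * alternating q p m else 1.

(** A power of x, then m letters of y x y x ..., then n letters of z x z x .... In a fixed degree
    there are quadratically many such words. *)
Definition normal_word (a m n : nat) : A :=
  x ^+ a * alternating y x m * alternating z x n.

Inductive normal_span (N : nat) : A -> Prop :=
| NSpan0 : normal_span N 0
| NSpanD u v : normal_span N u -> normal_span N v -> normal_span N (u + v)
| NSpanU k a m n : (a + m + n)%N = N -> normal_span N (k *: normal_word a m n).

Lemma NSpanZ N k u : normal_span N u -> normal_span N (k *: u).
Proof.
elim=> [|v w _ hv _ hw|l a m n e]; first by rewrite scaler0; constructor.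
  by rewrite scalerDr; constructor.
by rewrite scalerA; constructor.
Qed.
Lemma NSpanc N u : normal_span N u -> normal_span N (c * u).
Proof. by rewrite -cE; apply: NSpanZ. Qed.
Lemma NSpanN N u : normal_span N u -> normal_span N (- u).
Proof. by rewrite -scaleN1r; apply: NSpanZ. Qed.
Lemma NSpanB N u v : normal_span N u -> normal_span N v -> normal_span N (u - v).
Proof. by move=> hu /NSpanN; constructor. Qed.
Lemma NSpan_word N a m n : (a + m + n)%N = N -> normal_span N (normal_word a m n).
Proof. by move=> e; rewrite -[normal_word a m n]scale1r; constructor. Qed.

Lemma NSpanx N u : normal_span N u -> normal_span N.+1 (x * u).
Proof.
elim=> [|v w _ hv _ hw|l a m n e]; first by rewrite mulr0; constructor.
  by rewrite mulrDr; constructor.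
rewrite -scalerAr /normal_word !mulrA -exprS; apply: NSpanZ.
by apply: (@NSpan_word _ a.+1 m n); rewrite -e !addSn.
Qed.

Lemma y_xx : y * (x * x) = x * x * y.
Proof. by rewrite -yy mulrA. Qed.
Lemma z_xx : z * (x * x) = - (x * x * z).
Proof.
rewrite -yy mulrA zy -[_ * y]mulrA; transitivity (- c * (y * (z * y))).
  by nc_ring cC cc.
by rewrite zy; nc_ring cC cc.
Qed.
(** The element z commutes with z^2, hence with y x - x y. *)
Lemma z_xy : z * (x * y) = - (c * (y * (z * x))) - y * (x * z) + x * (y * z).
Proof.
have e : (y * x - x * y) * z = z * (y * x - x * y).
  by rewrite yx; nc_ring cC cc.
have -> : z * (x * y) = z * y * x - z * (y * x - x * y) by nc_ring cC cc.
by rewrite -e zy; nc_ring cC cc.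
Qed.

Lemma y_x2k k : y * x ^+ k.*2 = x ^+ k.*2 * y.
Proof.
elim: k => [|k IH]; first by rewrite mulr1 mul1r.
by rewrite doubleS !exprS !mulrA -(mulrA y) y_xx -!mulrA IH.
Qed.

Lemma z_x2k k : exists s : K, z * x ^+ k.*2 = s *: (x ^+ k.*2 * z).
Proof.
elim: k => [|k [s IH]]; first by exists 1; rewrite mulr1 mul1r scale1r.
exists (- s); rewrite doubleS !exprS !mulrA -(mulrA z) z_xx mulNr -(mulrA _ z) IH.
by rewrite -scalerAr scaleNr !mulrA.
Qed.

Lemma NSpan_xpow N k u : normal_span N u -> normal_span (k + N) (x ^+ k * u).
Proof.
move=> hu; elim: k => [|k IH]; first by rewrite mul1r.
by rewrite exprS -mulrA addSn; apply: NSpanx.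
Qed.

(** Since y commutes with x^2, only the parity of the exponent of x matters. An odd exponent
    lengthens the alternating word by y x; an even one puts y directly before that word, where y y
    becomes x^2 unless the word is empty. *)
Lemma NSpany N u : normal_span N u -> normal_span N.+1 (y * u).
Proof.
elim=> [|v w _ hv _ hw|l a m n e]; first by rewrite mulr0; constructor.
  by rewrite mulrDr; constructor.
rewrite -scalerAr; apply: NSpanZ; rewrite -{}e /normal_word.
rewrite -(odd_double_half a); set k := a./2.
have -> : y * (x ^+ (odd a + k.*2) * alternating y x m * alternating z x n) =
   x ^+ k.*2 * (y * (x ^+ odd a * alternating y x m * alternating z x n)).
  by rewrite addnC exprD !mulrA y_x2k.
have -> : (odd a + k.*2 + m + n).+1 = (k.*2 + (odd a + m + n).+1)%N.
  by rewrite addnS addnA [(k.*2 + _)%N]addnCA !addnA.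
apply: NSpan_xpow; case: (odd a); last first.
  rewrite mul1r add0n; case: m => [|[|m]].
  - rewrite /= mul1r; have -> : y * alternating z x n = normal_word 0 1 n.
      by rewrite /normal_word /= mul1r mulr1.
    exact: NSpan_word.
  - rewrite /= mulr1 mulrA yy; have -> : x * x * alternating z x n = normal_word 2 0 n.
      by rewrite /normal_word /= mulr1 expr2.
    exact: NSpan_word.
  - have -> : y * (alternating y x m.+2 * alternating z x n) = normal_word 3 m n.
      by rewrite /normal_word /= !mulrA yy exprS expr2 !mulrA.
    by apply: NSpan_word; rewrite !addSn.
have -> : y * (x ^+ true * alternating y x m * alternating z x n) = normal_word 0 m.+2 n.
  by rewrite /normal_word /= mul1r !mulrA.
by apply: NSpan_word; rewrite /= add0n add1n !addSn.
Qed.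

(** Moving z past y or past x y leaves z in front of a shorter word w or of x w, so both forms enter
    the induction, which removes a pair y x at a time. The even powers of x are dealt with
    separately by [z_x2k]. *)
Lemma NSpanz_word m n :
  normal_span (m + n).+1 (z * (alternating y x m * alternating z x n)) /\
  normal_span (m + n).+2 (z * (x * (alternating y x m * alternating z x n))).
Proof.
have nz k : alternating z x k = normal_word 0 0 k by rewrite /normal_word /= !mul1r.
have h0 k : normal_span k.+1 (z * alternating z x k) /\
    normal_span k.+2 (z * (x * alternating z x k)).
  split; last by rewrite -[z * _]/(alternating z x k.+2) nz; apply: NSpan_word.
  case: k => [|k]; first by rewrite -[z * _]/(alternating z x 1) nz; apply: NSpan_word.
  (* The leading z z is traded for - c (y x - x y), after which only multiplications by x and y
     remain. *)
  have -> : z * alternating z x k.+1 = - (c * (y * (x * alternating x z k)))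
      + c * (x * (y * alternating x z k)).
    transitivity (- (c * (c * (z * z))) * alternating x z k).
      by rewrite /=; nc_ring cC cc.
    by rewrite -yx; nc_ring cC cc.
  case: k => [|k].
    constructor; [apply/NSpanN|]; apply: NSpanc.
      apply: NSpany; rewrite mulr1.
      have -> : x = normal_word 1 0 0 by rewrite /normal_word /= !mulr1.
      exact: NSpan_word.
    apply: NSpanx; have -> : y * alternating x z 0 = normal_word 0 1 0.
      by rewrite /normal_word /= !mulr1 mul1r.
    exact: NSpan_word.
  have hz : normal_span k (alternating z x k) by rewrite nz; apply: NSpan_word.
  rewrite /=; constructor; [apply/NSpanN|]; apply: NSpanc.
    by do 3!(apply: NSpany || apply: NSpanx).
  by do 3!(apply: NSpany || apply: NSpanx).
elim/ltn_ind: m n => -[|[|m]] IH n.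
- by rewrite /= !mul1r; apply: h0.
- have [h1 h2] := h0 n; rewrite /= mulr1; split.
    have -> : z * (y * alternating z x n) = - (c * (y * (z * alternating z x n))).
      by rewrite !mulrA zy; nc_ring cC cc.
    by apply: NSpanN; apply: NSpanc; apply: NSpany.
  have -> : z * (x * (y * alternating z x n)) =
      - (c * (y * (z * (x * alternating z x n)))) - y * (x * (z * alternating z x n))
      + x * (y * (z * alternating z x n)).
    transitivity (z * (x * y) * alternating z x n); first by nc_ring cC cc.
    by rewrite z_xy; nc_ring cC cc.
  constructor; [apply: NSpanB|].
  - by apply: NSpanN; apply: NSpanc; apply: NSpany.
  - by apply: NSpany; apply: NSpanx.
  - by apply: NSpanx; apply: NSpany.
have [h1 h2] := IH m (ltnW (ltnSn _)) n.
set w := alternating y x m * alternating z x n in h1 h2.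
have -> : alternating y x m.+2 * alternating z x n = y * (x * w) by rewrite /= !mulrA.
split.
  have -> : z * (y * (x * w)) = - (c * (y * (z * (x * w)))).
    by rewrite !mulrA zy; nc_ring cC cc.
  by apply: NSpanN; apply: NSpanc; apply: NSpany.
have -> : z * (x * (y * (x * w))) =
    c * (y * (x * (x * (z * w)))) - y * (x * (z * (x * w))) + x * (y * (z * (x * w))).
  transitivity (z * (x * y) * (x * w)); first by nc_ring cC cc.
  rewrite z_xy; transitivity (- (c * (y * (z * (x * x) * w))) - y * (x * (z * (x * w))) + x * (y * (z * (x * w)))).
    by nc_ring cC cc.
  by rewrite z_xx; nc_ring cC cc.
constructor; [apply: NSpanB|].
- by apply: NSpanc; apply: NSpany; apply: NSpanx; apply: NSpanx.
- by apply: NSpany; apply: NSpanx.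
- by apply: NSpanx; apply: NSpany.
Qed.

Lemma NSpanz N u : normal_span N u -> normal_span N.+1 (z * u).
Proof.
elim=> [|v w _ hv _ hw|l a m n e]; first by rewrite mulr0; constructor.
  by rewrite mulrDr; constructor.
rewrite -scalerAr; apply: NSpanZ; rewrite -{}e /normal_word.
rewrite -(odd_double_half a); set k := a./2.
have [s sE] := z_x2k k.
have -> : z * (x ^+ (odd a + k.*2) * alternating y x m * alternating z x n) =
   s *: (x ^+ k.*2 * (z * (x ^+ odd a * (alternating y x m * alternating z x n)))).
  by rewrite addnC exprD !mulrA sE !scalerAl.
have -> : (odd a + k.*2 + m + n).+1 = (k.*2 + (odd a + m + n).+1)%N.
  by rewrite addnS addnA [(k.*2 + _)%N]addnCA !addnA.
apply: NSpanZ; apply: NSpan_xpow; have [h1 h2] := NSpanz_word m n.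
by case: (odd a); rewrite ?mul1r.
Qed.

Lemma gr_normal_span N u : gr A N u -> normal_span N u.
Proof.
elim: N u => [|N IH] u hu.
  have [k ->] := (H_connected ii g1 presA cE u).1 hu.
  have -> : 1 = normal_word 0 0 0 by rewrite /normal_word !mulr1.
  by constructor.
have [k [a1 [a2 [a3 e]]]] := left_decomposition ii presA cE u.
have -> : u = x * hcomp N a1 + y * hcomp N a2 + z * hcomp N a3.
  have := comp_hom N.+1 hu; rewrite eqxx => <-.
  rewrite e !raddfD /= (comp_hom _ (gr_alg A k)) add0r.
  by rewrite -[N.+1]add1n !(compMl _ _ (g1 _)).
constructor; [constructor|].
- by apply: NSpanx; apply: IH; apply: comp_in.
- by apply: NSpany; apply: IH; apply: comp_in.
- by apply: NSpanz; apply: IH; apply: comp_in.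
Qed.

Lemma H_polynomial_growth : polynomial_growth A.
Proof.
(* In degree N a normal word is determined by a and m, both at most N. This gives (N + 1)^2 entries,
   with 0 for pairs such that a + m exceeds N. *)
exists 1%N, 2%N => N.
pose L := [seq (if (a + m <= N)%N then normal_word a m (N - (a + m)) else 0)
  | a <- iota 0 N.+1, m <- iota 0 N.+1].
have sL : (1 * N.+1 ^ 2 = size L)%N by rewrite size_allpairs !size_iota mul1n mulnn.
rewrite sL; exists (fun j => L`_j) => u /gr_normal_span.
suff h : normal_span N u -> in_span L u.
  by move=> /h [d ->]; exists (fun j => d j).
elim=> [|v w _ hv _ hw|k a m n e]; first exact: in_span0.
  exact: in_spanD.
apply/in_spanZ/in_span_mem/allpairsP; exists (a, m); split.
- by rewrite mem_iota /= add0n ltnS -e -addnA leq_addr.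
- by rewrite mem_iota /= add0n ltnS -e addnAC leq_addl.
- by rewrite -e /= leq_addr addKn.
Qed.

Lemma H_generated : generated_in_degree_one A.
Proof.
exists 3%N, g; split=> //; last exact: presA.1.
move=> u hu; have [k [a1 [a2 [a3 e]]]] := right_decomposition ii presA cE u.
have conn := H_connected ii g1 presA cE.
have [k1 e1] := (conn _).1 (comp_in 0 a1).
have [k2 e2] := (conn _).1 (comp_in 0 a2).
have [k3 e3] := (conn _).1 (comp_in 0 a3).
exists (fun s => if s == i0 then k1 else if s == i1 then k2 else k3).
rewrite sum_ord3 eqxx !inord3_eq //=.
have := comp_hom 1 hu; rewrite eqxx => <-.
have E b s : hcomp 1 (b * g s) = hcomp 0 b * g s := compMr 0 b (g1 s).
rewrite {1}e !raddfD /= (comp_hom _ (gr_alg A k)) add0r.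
by rewrite [X in X + _ + _]E [X in _ + X + _]E [X in _ + X]E e1 e2 e3 !mulr_algl.
Qed.

Lemma H_regular : regular A 3.
Proof.
split; first exact: (H_connected ii g1 presA cE).
- exact: H_generated.
- exact: (H_global_dimension ii g1 presA cE).
- exact: H_polynomial_growth.
- exact: (H_gorenstein ii g1 presA cE).
Qed.

Lemma H_quadratic : quadratic A.
Proof.
exists 3%N, g, (H_rel i); split=> // p.
have h s t := @homogeneous_gen2 K 'I_3 (fun=> 1%N) s t.
case=> ->.
- by rewrite -[X in _ - X]scale1r; apply: homogeneous_relation; apply: h.
- by apply: homogeneous_relation; apply: h.
- apply: homogeneous_relation; last exact: h.
  by rewrite -[X in _ - X]scale1r; apply: homogeneous_relation; apply: h.
Qed.
End Growth.

(** * Clifford presentations *)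
Section Relators.
Variables (K : fieldType) (ep la de ka : K).
(** The parameters (ep, la, de, ka) are (1, -i, 1, i) for H and (-1, -1, -1, -1) for its twist D. *)
Definition relator (F : free_model K 'I_3) (p : F) :=
  let x := word (F := F) [:: i0] in
  let y := word (F := F) [:: i1] in
  let z := word (F := F) [:: i2] in
  [\/ p = y * y - ep *: (x * x), p = z * y - la *: (y * z)
    | p = y * x - de *: (x * y) - ka *: (z * z)].

Variable nu : K.
(** The entries for the pairs (x, y) and (y, z) are forced by the relators. The pair (x, z) has no
    relator, so nu is free there; it is chosen later to make xz + nu zx normal or central. *)
Definition cmu : 'M[K]_3 := \matrix_(a, b)
  if (a == i0) && (b == i1) then - de^-1 else
  if (a == i1) && (b == i0) then - de else
  if (a == i1) && (b == i2) then - la^-1 else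
  if (a == i2) && (b == i1) then - la else
  if (a == i0) && (b == i2) then nu else
  if (a == i2) && (b == i0) then nu^-1 else 1.

(** The new generators stand for x^2, z^2 and xz + nu zx. The entries 2 come from the diagonal
    relations, whose left side is twice a square. *)
Definition cM (k : 'I_3) : 'M[K]_3 := \matrix_(a, b)
  if k == i0 then
    if (a == i0) && (b == i0) then 2 else
    if (a == i1) && (b == i1) then 2 * ep else 0
  else if k == i1 then
    if (a == i2) && (b == i2) then 2 else
    if (a == i1) && (b == i0) then ka else
    if (a == i0) && (b == i1) then - de^-1 * ka else 0
  else
    if (a == i0) && (b == i2) then 1 else
    if (a == i2) && (b == i0) then nu^-1 else 0.

Hypothesis la0 : la != 0.
Hypothesis de0 : de != 0.
Hypothesis nu0 : nu != 0.
Hypothesis char2 : 2%:R != 0 :> K.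

Lemma cmu_skew_param : skew_param cmu.
Proof.
split=> [a b|a b|a].
- by case: (ord3P a); case: (ord3P b); rewrite mxE !inord3_eq //= ?oppr_eq0 ?invr_eq0 ?oner_neq0.
- by case: (ord3P a); case: (ord3P b); rewrite !mxE !inord3_eq //= ?mulrNN ?mulfV ?mulVf.
- by case: (ord3P a); rewrite mxE !inord3_eq.
Qed.

Lemma cM_symmetric k : mu_symmetric cmu (cM k).
Proof.
move=> a b; case: (ord3P k); case: (ord3P a); case: (ord3P b);
  rewrite !mxE !inord3_eq //= ?mulr0 ?mul1r ?mulfV ?mulVf ?mulr1 //.
by rewrite mulrA mulrNN mulfV ?mul1r.
Qed.

Section Tietze.
Variables (A : algType K) (F : free_model K 'I_3) (G : free_model K ('I_3 + 'I_3)%type).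
Variable ev : {lrmorphism F -> A}.
Hypothesis ev_ker : forall p, ev p = 0 <-> ideal_gen (relator (F := F)) p.
Notation X s := (word (F := G) [:: inl s]).
Notation Y s := (word (F := G) [:: inr s]).
Notation W s := (word (F := F) [:: s]).

Definition cliffrel (p : G) :=
  exists a b, p = X a * X b + cmu a b *: (X b * X a) - \sum_k cM k a b *: Y k.
Notation I := (ideal_gen cliffrel).

Definition yword (k : 'I_3) : F :=
  if k == i0 then W i0 * W i0 else if k == i1 then W i2 * W i2
  else W i0 * W i2 + nu *: (W i2 * W i0).

Lemma cliffrel_in a b : I (X a * X b + cmu a b *: (X b * X a) - \sum_k cM k a b *: Y k).
Proof. by apply: ideal_gen_rel; exists a, b. Qed.

Let double (V : lmodType K) (u v : V) : u + u - 2 *: v = 2 *: (u - v).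
Proof. by rewrite scalerBr (scaler_nat 2 u) mulr2n. Qed.
(** Here the characteristic enters: the diagonal Clifford relations determine the squares only up to
    a factor 2. *)
Let I2 (u : G) : I (2 *: u) -> I u.
Proof.
by move=> /(ideal_genZ 2^-1); rewrite scalerA mulVf // scale1r.
Qed.

Lemma cliff_relations :
  [/\ I (X i0 * X i0 - Y i0), I (X i1 * X i1 - ep *: Y i0), I (X i2 * X i2 - Y i1),
      I (X i2 * X i1 - la *: (X i1 * X i2))
    & I (X i1 * X i0 - de *: (X i0 * X i1) - ka *: Y i1) /\
      I (X i0 * X i2 + nu *: (X i2 * X i0) - Y i2)].
Proof.
have h a b := cliffrel_in a b.
split.
- have := h i0 i0; rewrite sum_ord3 !mxE !inord3_eq //= !scale0r !addr0 scale1r double.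
  exact: I2.
- have := h i1 i1; rewrite sum_ord3 !mxE !inord3_eq //= !scale0r !addr0 scale1r -scalerA double.
  exact: I2.
- have := h i2 i2; rewrite sum_ord3 !mxE !inord3_eq //= !scale0r add0r addr0 scale1r double.
  exact: I2.
- have := h i2 i1; rewrite sum_ord3 !mxE !inord3_eq //= !scale0r !addr0 subr0.
  by rewrite scaleNr.
split.
- have := h i1 i0; rewrite sum_ord3 !mxE !inord3_eq //= !scale0r add0r addr0.
  by rewrite scaleNr.
- by have := h i0 i2; rewrite sum_ord3 !mxE !inord3_eq //= !scale0r !add0r scale1r.
Qed.

(** A Tietze transformation: [si] replaces the new generators by quadrics and [io] includes the old
    ones. Every p is congruent to [io (si p)] modulo the Clifford relations, and [io] sends the
    relators into the ideal of these relations. *)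
Lemma tietze : exists ev' : {lrmorphism G -> A},
  [/\ forall s, ev' (X s) = ev (W s), forall k, ev' (Y k) = ev (yword k)
    & forall p, ev' p = 0 <-> I p].
Proof.
have [h1 h2 h3 h4 [h5 h6]] := cliff_relations.
pose fi (s : 'I_3) : G := X s.
have [io ioE] := free_eval F fi.
pose fs (s : 'I_3 + 'I_3) : F := match s with inl a => W a | inr k => yword k end.
have [si siE] := free_eval G fs.
pose fe (s : 'I_3 + 'I_3) : A := ev (fs s).
have [ev' evE] := free_eval G fe.
have ev'E p : ev' p = ev (si p).
  elim/free_ind_gen: p => [u v eu ev_|a u eu||s u eu].
  - by rewrite !rmorphD /= eu ev_.
  - by rewrite !linearZ /= eu.
  - by rewrite !rmorph1.
  - by rewrite !rmorphM /= eu evE siE.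
have IY k : I (Y k - io (yword k)).
  rewrite -opprB; apply: ideal_genN; rewrite /yword; case: (ord3P k);
    rewrite ?eqxx ?inord3_eq //=; first by rewrite rmorphM /= !ioE.
    by rewrite rmorphM /= !ioE.
  by rewrite rmorphD /= linearZ /= !rmorphM /= !ioE.
have Iio p : I (p - io (si p)).
  elim/free_ind_gen: p => [u v eu ev_|a u eu||s u eu].
  - by rewrite !rmorphD /= opprD addrACA; constructor.
  - by rewrite [si _]linearZ /= [io _]linearZ /= -scalerBr; apply: ideal_genZ.
  - by rewrite !rmorph1 subrr; constructor.
  - rewrite !rmorphM /= siE.
    have -> : word [:: s] * u - io (fs s) * io (si u) =
        word [:: s] * (u - io (si u)) + (word [:: s] - io (fs s)) * io (si u).
      by rewrite mulrBr mulrBl addrA subrK.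
    constructor; first exact: ideal_genMl.
    apply: ideal_genMr; case: s => [s|k] /=; last exact: IY.
    by rewrite ioE subrr; constructor.
have Irel p : ideal_gen (relator (F := F)) p -> I (io p).
  elim=> [|u f w rf|u v _ hu _ hv]; first by rewrite rmorph0; constructor.
    rewrite !rmorphM /=; apply: ideal_genM; case: rf => ->.
    - rewrite rmorphB /= linearZ !rmorphM /= !ioE.
      have -> : fi i1 * fi i1 - ep *: (fi i0 * fi i0) =
        (X i1 * X i1 - ep *: Y i0) - ep *: (X i0 * X i0 - Y i0).
        by rewrite scalerBr opprB addrA subrK.
      by apply: ideal_genB => //; apply: ideal_genZ.
    - by rewrite rmorphB /= linearZ !rmorphM /= !ioE.
    - rewrite !rmorphB /= ![io (_ *: _)]linearZ /= !rmorphM /= !ioE.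
      have -> : fi i1 * fi i0 - de *: (fi i0 * fi i1) - ka *: (fi i2 * fi i2) =
        (X i1 * X i0 - de *: (X i0 * X i1) - ka *: Y i1) - ka *: (X i2 * X i2 - Y i1).
        by rewrite scalerBr opprB addrA subrK.
      by apply: ideal_genB => //; apply: ideal_genZ.
  by rewrite rmorphD; constructor.
exists ev'; split=> [s|k|p]; [by rewrite evE|by rewrite evE|split].
- rewrite ev'E => /ev_ker/Irel h.
  by rewrite -(subrK (io (si p)) p); constructor.
have rel0 f : relator f -> ev f = 0 by move=> rf; apply/ev_ker/ideal_gen_rel.
have yyE : ev (W i1) * ev (W i1) = ep *: (ev (W i0) * ev (W i0)).
  have := rel0 _ (Or31 _ _ (erefl _)).
  by rewrite rmorphB /= linearZ !rmorphM /= => /subr0_eq.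
have zyE : ev (W i2) * ev (W i1) = la *: (ev (W i1) * ev (W i2)).
  have := rel0 _ (Or32 _ _ (erefl _)).
  by rewrite rmorphB /= linearZ !rmorphM /= => /subr0_eq.
have yxE : ev (W i1) * ev (W i0) - de *: (ev (W i0) * ev (W i1)) = ka *: (ev (W i2) * ev (W i2)).
  have := rel0 _ (Or33 _ _ (erefl _)).
  by rewrite !rmorphB /= ![ev (_ *: _)]linearZ /= !rmorphM /= => /subr0_eq.
elim=> [|u f w [a [b ->]]|u v _ hu _ hv]; first exact: rmorph0.
  rewrite !rmorphM /= [T in _ * T * _](_ : _ = 0) ?mulr0 ?mul0r //.
  rewrite sum_ord3 rmorphB !rmorphD /= ![ev' (_ *: _)]linearZ /= !rmorphM /= !evE /fe /fs /yword.
  rewrite eqxx !inord3_eq //= rmorphD /= [ev (_ *: _)]linearZ /= !rmorphM /=.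
  case: (ord3P a); case: (ord3P b); rewrite !mxE !inord3_eq //= ?scale0r ?addr0 ?add0r ?subr0 ?scale1r.
  - by rewrite double subrr scaler0.
  - rewrite -scalerA -yxE scalerBr scalerA mulNr mulVf // scaleN1r opprK.
    by rewrite [T in _ - T]addrC subrr.
  - by rewrite subrr.
  - by rewrite scaleNr yxE subrr.
  - by rewrite -scalerA -yyE double subrr scaler0.
  - by rewrite zyE scalerA mulNr mulVf // scaleN1r subrr.
  - by rewrite scalerDr scalerA mulVf // scale1r [T in _ - T]addrC subrr.
  - by rewrite scaleNr zyE subrr.
  - by rewrite double subrr scaler0.
by rewrite rmorphD /= hu hv addr0.
Qed.
End Tietze.

Definition quadrics (A : algType K) (g : 'I_3 -> A) (k : 'I_3) : A :=
  if k == i0 then g i0 * g i0 else if k == i1 then g i2 * g i2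
  else g i0 * g i2 + nu *: (g i2 * g i0).

Lemma clifford_rel_cliffrel :
  clifford_rel cmu cM = cliffrel (G := free_algebra_model K ('I_3 + 'I_3)%type).
Proof.
have e : @fgen K ('I_3 + 'I_3)%type =
    fun s => word (F := free_algebra_model K ('I_3 + 'I_3)%type) [:: s].
  by apply/funext => s; apply: fgenE.
by rewrite /clifford_rel e.
Qed.

(** The Clifford relations alone present A. Normality then holds as a property of A, so the set of
    extra relations is empty and the change of basis is the identity. *)
Lemma gsca_of_relators (A : graded_alg K) (F : free_model K 'I_3)
    (ev : {lrmorphism F -> A}) (x : 'I_3 -> A) (y : 'I_3 -> A) :
  (forall s, ev (word [:: s]) = x s) ->
  (forall s, gr A 1 (x s)) ->
  (forall a, exists p, ev p = a) ->
  (forall p, ev p = 0 <-> ideal_gen (relator (F := F)) p) ->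
  y =1 quadrics x ->
  (forall k a, (exists b, y k * a = b * y k) /\ (exists b, a * y k = y k * b)) ->
  gsca_on cmu cM x y.
Proof.
move=> evX x1 surj ker yE ynormal.
have x2 a b : gr A 2 (x a * x b) by apply: (@gr_mul _ A 1 1).
split; [exact: cmu_skew_param|exact: cM_symmetric| |].
  split=> // k; rewrite yE /quadrics; case: ifP => // _; case: ifP => // _.
  by apply: grD => //; apply: gr_scale.
exists 1%:M, (fun=> False); set r := fun k => _.
have rE k : r k = y k.
  rewrite /r (bigD1 k) //= mxE eqxx scale1r big1 ?addr0 // => l lk.
  by rewrite mxE eq_sym (negPf lk) scale0r.
split=> //.
- have [ev' [evx evy ker']] := tietze (free_algebra_model K ('I_3 + 'I_3)%type) ker.
  have [h [hE hX]] := feval_lrmorphism (fun s : 'I_3 + 'I_3 => match s with inl s => x s | inr k => y k end).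
  have hev p : h p = ev' p.
    elim/free_ind_gen: p => [u v eu ev_|a u eu||[s|k] u eu].
    - by rewrite !rmorphD /= eu ev_.
    - by rewrite !linearZ /= eu.
    - by rewrite !rmorph1.
    - by rewrite !rmorphM /= eu hX evx evX.
    - rewrite !rmorphM /= eu hX evy yE /yword /quadrics; congr (_ * _).
      by case: ifP => _; [|case: ifP => _]; rewrite ?rmorphD ?linearZ ?rmorphM /= ?linearZ /= ?rmorphM /= !evX.
  split=> [a|p].
    have [p0 <-] := surj a.
    suff [q qE] : exists q, h q = ev p0 by exists q; rewrite hE.
    elim/free_ind_gen: p0 => [u v [p pu] [q qv]|k u [p pu]||s u [p pu]].
    - by exists (p + q); rewrite !rmorphD /= pu qv.
    - by exists (k *: p); rewrite !linearZ /= pu.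
    - by exists 1; rewrite !rmorph1.
    - by exists (word [:: inl s] * p); rewrite !rmorphM /= pu hX evX.
  rewrite hE hev clifford_rel_cliffrel; split=> [/ker' ip|ip].
    have : @ideal_gen (free_algebra_model K ('I_3 + 'I_3)%type)
        (fun q => cliffrel q \/ False) p.
      by apply: ideal_gen_eq ip => q hq; apply: ideal_gen_rel; left.
    exact.
  apply/ker'; have : @ideal_gen (free_algebra_model K ('I_3 + 'I_3)%type)
      (fun q => cliffrel q \/ False) p by exact: ip.
  by apply: ideal_gen_eq => q [hq|//]; apply: ideal_gen_rel.
- move=> k J; split=> a; have [[b e1] [d e2]] := ynormal k a.
    by exists b; rewrite !rE e1 subrr; constructor.
  by exists d; rewrite !rE e2 subrr; constructor.
- move=> a [k ->]; exists (fun j => (j == k)%:R).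
  rewrite (bigD1 k) //= eqxx scale1r rE big1 ?addr0 // => j /negPf ->.
  by rewrite scale0r.
Qed.
End Relators.

Lemma skew_normal (K : fieldType) (A : algType K) (F : free_model K 'I_3)
    (ev : {lrmorphism F -> A}) (r : A) :
  (forall a, exists p, ev p = a) ->
  (forall s, exists2 k, k != 0 & r * ev (word [:: s]) = k *: (ev (word [:: s]) * r)) ->
  forall a, (exists b, r * a = b * r) /\ (exists b, a * r = r * b).
Proof.
move=> surj h a; have [p <-] := surj a.
elim/free_ind_gen: p => [u v [[b1 e1] [d1 f1]] [[b2 e2] [d2 f2]]
   |k u [[b e] [d f]]||s u [[b e] [d f]]].
- split; [exists (b1 + b2)|exists (d1 + d2)].
    by rewrite rmorphD /= mulrDr e1 e2 mulrDl.
  by rewrite rmorphD /= mulrDl f1 f2 mulrDr.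
- split; [exists (k *: b)|exists (k *: d)].
    by rewrite linearZ /= -scalerAr e -scalerAl.
  by rewrite linearZ /= -scalerAl f -scalerAr.
- by split; exists 1; rewrite rmorph1 mulr1 mul1r.
have [k k0 hk] := h s; rewrite rmorphM /=.
split; [exists (k *: (ev (word [:: s]) * b))|exists (k^-1 *: (ev (word [:: s]) * d))].
  by rewrite mulrA hk -!scalerAl -mulrA e mulrA.
by rewrite -mulrA f -scalerAr !mulrA hk -scalerAl scalerA mulVf // scale1r.
Qed.

(** * The algebra H as a graded skew Clifford algebra *)

Section HClifford.
Variables (K : fieldType) (i : K) (A : graded_alg K) (g : 'I_3 -> A).
Hypothesis char2 : 2%:R != 0 :> K.
Hypothesis ii : i * i = -1.
Hypothesis g1 : forall s, gr A 1 (g s).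
Hypothesis presA : presents g (H_rel i).
Notation x := (g i0).
Notation y := (g i1).
Notation z := (g i2).
Variable c : A.
Hypothesis cE : forall a : A, i *: a = c * a.
Let cC a : c * a = a * c. Proof. exact: (c_central cE). Qed.
Let cc : c * c = -1. Proof. exact: (c_square ii cE). Qed.
Let yy := H_yy presA.
Let zy := H_zy presA cE.
Let yx := H_yx presA cE.

Lemma i_neq0 : i != 0.
Proof.
apply/eqP => i00; move: ii; rewrite i00 mul0r => /eqP.
by rewrite eq_sym oppr_eq0 oner_eq0.
Qed.

Lemma zz_x : z * z * x = - (x * (z * z)).
Proof.
(* The element c z^2 = y x - x y anticommutes with x because y commutes with x^2; the invertible
   factor c is removed afterwards. *)
have e : c * (z * z * x) = c * (- (x * (z * z))).
  transitivity (c * (z * z) * x); first by nc_ring cC cc.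
  transitivity (- (x * (c * (z * z)))); last by nc_ring cC cc.
  rewrite -yx; transitivity (y * (x * x) - x * y * x); first by nc_ring cC cc.
  by rewrite (y_xx presA); nc_ring cC cc.
transitivity (- c * (c * (z * z * x))); first by nc_ring cC cc.
by rewrite e; nc_ring cC cc.
Qed.

Lemma zz_y : z * z * y = - (y * (z * z)).
Proof.
rewrite -mulrA zy; transitivity (- c * (z * y) * z); first by nc_ring cC cc.
by rewrite zy; nc_ring cC cc.
Qed.

Lemma H_quadrics_normal k a : (exists b, quadrics i g k * a = b * quadrics i g k) /\
  (exists b, a * quadrics i g k = quadrics i g k * b).
Proof.
have [F [ev [evX surj ker]]] := presentation_eval presA.
apply: (skew_normal surj) => s; rewrite evX /quadrics.
have i0 := i_neq0; have i0' : - i != 0 by rewrite oppr_eq0.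
have one0 : -1 != 0 :> K by rewrite oppr_eq0 oner_neq0.
have xz : x * z * x + c * (z * x) * x = - c * (x * (x * z + c * (z * x))).
  transitivity (x * z * x + c * (z * (x * x))); first by nc_ring cC cc.
  by rewrite (z_xx ii presA cE); nc_ring cC cc.
(* The scalars for passing x, y, z are (1, 1, -1) for x^2, (-1, -1, 1) for z^2 and (-i, -i, i) for
   xz + i zx. *)
case: (ord3P k); rewrite ?eqxx ?inord3_eq //=; case: (ord3P s).
- by exists 1; rewrite ?oner_neq0 // scale1r mulrA.
- by exists 1; rewrite ?oner_neq0 // scale1r (y_xx presA).
- by exists (-1) => //; rewrite (z_xx ii presA cE) scaleN1r opprK.
- by exists (-1) => //; rewrite scaleN1r zz_x.
- by exists (-1) => //; rewrite scaleN1r zz_y.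
- by exists 1; rewrite ?oner_neq0 // scale1r mulrA.
- exists (- i) => //; rewrite scaleNr !cE mulrDl xz; nc_ring cC cc.
- exists (- i) => //; rewrite scaleNr !cE.
  transitivity (x * (z * y) + c * (z * (x * y))); first by nc_ring cC cc.
  by rewrite zy (z_xy ii presA cE); nc_ring cC cc.
- exists i => //; rewrite !cE.
  transitivity (- (- (x * (z * z))) + c * z * x * z); first by nc_ring cC cc.
  by rewrite -zz_x; nc_ring cC cc.
Qed.

Lemma H_graded_skew_clifford : graded_skew_clifford A.
Proof.
have [F [ev [evX surj ker]]] := presentation_eval presA.
exists 3%N, (cmu (- i) 1 i), (cM 1 1 i i), g, (quadrics i g).
have i0' : - i != 0 by rewrite oppr_eq0 i_neq0.
apply: (gsca_of_relators i0' (oner_neq0 K) i_neq0 char2 evX) => //.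
- move=> p; split=> [/ker|h].
    apply: ideal_gen_eq => q [] ->; apply: ideal_gen_rel; rewrite /relator !scale1r.
    + by constructor 1.
    + by constructor 2.
    + by constructor 3.
  apply/ker; apply: ideal_gen_eq h => q; rewrite /relator !scale1r => -[] ->;
    apply: ideal_gen_rel; [constructor 1|constructor 2|constructor 3] => //.
- exact: H_quadrics_normal.
Qed.
End HClifford.

(** * Twists *)
Lemma hom_ind (K : fieldType) (A : graded_alg K) (P : A -> Prop) :
  (forall u v, P u -> P v -> P (u + v)) -> (forall m u, gr A m u -> P u) ->
  forall u, P u.
Proof.
move=> PD Ph u; have [n un] := comp_bound u; rewrite (compE un).
apply: big_ind => [|v w|j _]; first exact: (Ph 0%N _ (gr0 A 0)).
  exact: PD.
exact: Ph (comp_in j u).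
Qed.

Lemma iter_lrmorphism (K : fieldType) (A : algType K) (f : {lrmorphism A -> A}) m :
  exists h : {lrmorphism A -> A}, iter m f =1 h.
Proof.
elim: m => [|m [h hE]]; first by exists idfun.
by exists (f \o h) => a; rewrite /= hE.
Qed.

Section TwistedAlgebra.
Variables (K : fieldType) (A : graded_alg K) (psi : {lrmorphism A -> A}).
Hypothesis psi_gr : forall m a, gr A m a -> gr A m (psi a).

(** The [let] attaches the type to psi, so that a second multiplication can be put on the vector
    space of A. *)
Definition twist : Type := let _ := psi_gr in A.
HB.instance Definition _ := GRing.Lmodule.copy twist A.

(** The power of psi depends on the degree of the left factor, so a is split into components. The
    chosen bound only makes the sum finite; by [twist_mulE] any valid bound gives the same value. *)
Definition twist_mul (a b : A) : A :=
  \sum_(m < sval (cid (comp_bound a))) hcomp m a * iter m psi b.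

Lemma twist_mulE n a b : (forall k, (n <= k)%N -> hcomp k a = 0) ->
  twist_mul a b = \sum_(m < n) hcomp m a * iter m psi b.
Proof.
rewrite /twist_mul; set N := sval _; have aN := svalP (cid (comp_bound a)).
have W p q : (forall k, (p <= k)%N -> hcomp k a = 0) -> (p <= q)%N ->
    \sum_(m < p) hcomp m a * iter m psi b = \sum_(m < q) hcomp m a * iter m psi b.
  move=> ap pq; rewrite (big_ord_widen_cond _ xpredT (fun m => hcomp m a * iter m psi b) pq).
  rewrite [RHS](bigID (fun j : 'I_q => (j < p)%N)) /= [X in _ + X]big1 ?addr0 // => j.
  by rewrite -leqNgt => /ap ->; rewrite mul0r.
by move=> an; rewrite (W _ _ aN (leq_maxl N n)) (W _ _ an (leq_maxr N n)).
Qed.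

Lemma twist_mul_hom m a b : gr A m a -> twist_mul a b = a * iter m psi b.
Proof.
move=> ha; rewrite (@twist_mulE m.+1) => [|k mk]; last first.
  by rewrite (comp_hom _ ha); case: eqP mk => // ->; rewrite ltnn.
rewrite big_ord_recr /= (comp_hom _ ha) eqxx big1 ?add0r // => j _.
by rewrite (comp_hom _ ha); case: eqP => [e|]; rewrite ?mul0r //; move: (ltn_ord j); rewrite e ltnn.
Qed.

Lemma iter_psiD m a b : iter m psi (a + b) = iter m psi a + iter m psi b.
Proof. by have [h hE] := iter_lrmorphism psi m; rewrite !hE rmorphD. Qed.
Lemma iter_psiM m a b : iter m psi (a * b) = iter m psi a * iter m psi b.
Proof. by have [h hE] := iter_lrmorphism psi m; rewrite !hE rmorphM. Qed.
Lemma iter_psiZ m k a : iter m psi (k *: a) = k *: iter m psi a.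
Proof. by have [h hE] := iter_lrmorphism psi m; rewrite !hE linearZ. Qed.
Lemma iter_psi1 m : iter m psi 1 = 1.
Proof. by have [h hE] := iter_lrmorphism psi m; rewrite !hE rmorph1. Qed.
Lemma iter_psi_gr m n a : gr A n a -> gr A n (iter m psi a).
Proof. by move=> ha; elim: m => //= m IH; apply: psi_gr. Qed.

Lemma twist_mulDl : left_distributive twist_mul +%R.
Proof.
move=> a b d; have [n1 an] := comp_bound a; have [n2 bn] := comp_bound b.
have an' k : (maxn n1 n2 <= k)%N -> hcomp k a = 0 by rewrite geq_max => /andP [/an].
have bn' k : (maxn n1 n2 <= k)%N -> hcomp k b = 0 by rewrite geq_max => /andP [_ /bn].
rewrite (twist_mulE _ an') (twist_mulE _ bn') (@twist_mulE (maxn n1 n2)); last first.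
  by move=> k nk; rewrite raddfD /= an' // bn' // addr0.
by rewrite -big_split; apply: eq_bigr => j _; rewrite raddfD mulrDl.
Qed.

Lemma twist_mulDr : right_distributive twist_mul +%R.
Proof.
move=> a b d; rewrite /twist_mul -big_split; apply: eq_bigr => j _.
by rewrite iter_psiD mulrDr.
Qed.

Lemma twist_mulA : associative twist_mul.
Proof.
move=> a b d; elim/hom_ind: a => [u v eu ev|m a ha].
  by rewrite !twist_mulDl eu ev.
elim/hom_ind: b => [u v eu ev|n b hb].
  by rewrite !(twist_mulDl, twist_mulDr) eu ev.
rewrite (twist_mul_hom b ha) (twist_mul_hom d hb) (twist_mul_hom _ ha).
rewrite (twist_mul_hom _ (gr_mul ha (iter_psi_gr m hb))).
by rewrite iter_psiM -iterD mulrA.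
Qed.

Lemma twist_mul1 : left_id 1 twist_mul.
Proof. by move=> a; rewrite (twist_mul_hom _ (gr_one A)) mul1r. Qed.

Lemma twist_mulr1 : right_id 1 twist_mul.
Proof.
elim/hom_ind=> [u v eu ev|m a ha]; first by rewrite twist_mulDl eu ev.
by rewrite (twist_mul_hom _ ha) iter_psi1 mulr1.
Qed.

Lemma twist_mulZl k a b : k *: twist_mul a b = twist_mul (k *: a) b.
Proof.
elim/hom_ind: a => [u v eu ev|m a ha].
  by rewrite scalerDr !twist_mulDl scalerDr eu ev.
by rewrite (twist_mul_hom _ ha) (twist_mul_hom _ (gr_scale k ha)) scalerAl.
Qed.

Lemma twist_mulZr k a b : k *: twist_mul a b = twist_mul a (k *: b).
Proof.
rewrite /twist_mul scaler_sumr; apply: eq_bigr => j _.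
by rewrite iter_psiZ scalerAr.
Qed.

HB.instance Definition _ := GRing.Zmodule_isNzRing.Build twist
  twist_mulA twist_mul1 twist_mulr1 twist_mulDl twist_mulDr (oner_neq0 A).

Fact twist_scaleAl (k : K) (a b : twist) :
  k *: (a * b : twist) = (k *: a : twist) * b.
Proof. exact: twist_mulZl. Qed.
HB.instance Definition _ := GRing.Lmodule_isLalgebra.Build K twist twist_scaleAl.
Fact twist_scaleAr (k : K) (a b : twist) :
  k *: (a * b : twist) = a * (k *: b : twist).
Proof. exact: twist_mulZr. Qed.
HB.instance Definition _ := GRing.Lalgebra_isAlgebra.Build K twist twist_scaleAr.

Fact twist_gr_mul m n (a b : twist) : gr A m a -> gr A n b -> gr A (m + n) (a * b).
Proof.
move=> ha hb; change (gr A (m + n) (twist_mul a b)).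
by rewrite (twist_mul_hom _ ha); apply: gr_mul ha (iter_psi_gr m hb).
Qed.

Definition twist_graded : graded_alg K := @GradedAlg K twist
  (fun n (a : twist) => gr A n a) (@gr_grading K A) (@gr_scale K A) (@gr_one K A)
  twist_gr_mul.

Lemma twist_graded_untwist : exists t : {linear twist_graded -> A},
  [/\ bijective t, forall m a, gr twist_graded m a <-> gr A m (t a)
    & forall m a b, gr A m (t a) -> t (a * b) = t a * iter m psi (t b)].
Proof.
pose e : twist_graded -> A := id.
have e_lin : linear e by [].
pose m3 := GRing.isLinear.Build K twist_graded A *:%R e e_lin.
pose t : {linear twist_graded -> A} := HB.pack e m3.
exists t; split=> //; first by exists id.
by move=> m a b ha; apply: twist_mul_hom.
Qed.

Variable phi : {lrmorphism A -> A}.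
Hypothesis phi_gr : forall m a, gr A m a -> gr A m (phi a).
Hypothesis psiK : cancel psi phi.
Hypothesis phiK : cancel phi psi.

(** Being inverse to psi, phi commutes with its powers and so respects the twisted product. Twisting
    again by phi cancels these powers, and the identity of the common vector space is the
    isomorphism. *)
Lemma twist_automorphism : exists h : {lrmorphism twist_graded -> twist_graded},
  graded_automorphism h /\ is_twist A h.
Proof.
pose f : twist_graded -> twist_graded := phi.
have f_lin : linear f by move=> k u v; apply: (linearP phi).
have f_mul : GRing.monoid_morphism f.
  split; first exact: (rmorph1 phi).
  move=> a b; change (phi (twist_mul a b) = twist_mul (phi a) (phi b)).
  elim/hom_ind: a => [u v eu ev|m a ha].
    by rewrite !twist_mulDl !rmorphD /= !twist_mulDl eu ev.
  rewrite (twist_mul_hom _ ha) (twist_mul_hom _ (phi_gr ha)) rmorphM.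
  congr (_ * _); elim: m {ha} => //= m IH; rewrite psiK -IH.
  by case: m IH => [|m] IH /=; rewrite ?phiK // psiK.
pose m1 := GRing.isLinear.Build K twist_graded twist_graded *:%R f f_lin.
pose m2 := GRing.isMonoidMorphism.Build twist_graded twist_graded f f_mul.
pose h : {lrmorphism twist_graded -> twist_graded} := HB.pack f m1 m2.
exists h; split.
  by split; [exists psi; [exact: phiK|exact: psiK]|exact: phi_gr].
pose e : twist_graded -> A := id.
have e_lin : linear e by [].
pose m3 := GRing.isLinear.Build K twist_graded A *:%R e e_lin.
pose e' : {linear twist_graded -> A} := HB.pack e m3.
exists e'; split=> //; first by exists id.
move=> m a b ha; change (twist_mul a (iter m phi b) = (a : A) * b).
rewrite (twist_mul_hom _ ha); congr (_ * _).
have phiI n : iter n psi (iter n phi b) = b.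
  by elim: n => // n IH; rewrite iterSr /= phiK.
exact: phiI.
Qed.
End TwistedAlgebra.

Lemma lrmorphism_factor (K : fieldType) (F A B : algType K)
    (ev : {lrmorphism F -> A}) (ev2 : {lrmorphism F -> B}) :
  (forall a, exists p, ev p = a) -> (forall p, ev p = 0 -> ev2 p = 0) ->
  exists f : {lrmorphism A -> B}, forall p, f (ev p) = ev2 p.
Proof.
move=> surj ker.
pose f a := ev2 (sval (cid (surj a))).
have fE p : f (ev p) = ev2 p.
  rewrite /f; case: (cid _) => q /= qp; apply/subr0_eq; rewrite -rmorphB.
  by apply: ker; rewrite rmorphB /= qp subrr.
have f_lin : linear f.
  move=> k a b; have [p <-] := surj a; have [q <-] := surj b.
  by rewrite -linearP !fE linearP.
have f_mul : GRing.monoid_morphism f.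
  split; first by rewrite -(rmorph1 ev) fE rmorph1.
  move=> a b; have [p <-] := surj a; have [q <-] := surj b.
  by rewrite -rmorphM !fE rmorphM.
pose m1 := GRing.isLinear.Build K A B *:%R f f_lin.
pose m2 := GRing.isMonoidMorphism.Build A B f f_mul.
by exists (HB.pack f m1 m2 : {lrmorphism A -> B}).
Qed.

(** * Diagonal automorphisms and the relations of the twist *)

Section Diagonal.
Variables (K : fieldType) (i : K) (A : graded_alg K) (g : 'I_3 -> A).
Hypothesis ii : i * i = -1.
Hypothesis g1 : forall s, gr A 1 (g s).
Hypothesis presA : presents g (H_rel i).
Notation x := (g i0).
Notation y := (g i1).
Notation z := (g i2).
Let cE (a : A) : i *: a = (i%:A : A) * a. Proof. by rewrite mulr_algl. Qed.
Let yy := H_yy presA.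
Let zy := H_zy presA cE.
Let yx := H_yx presA cE.

Definition diagonal (e : K) (s : 'I_3) : K :=
  if s == i0 then 1 else if s == i1 then -1 else e.

(** The three relators are scaled by 1, - e and -1. The last needs e^2 = -1, so that z^2 is scaled
    like y x - x y; both e = i and e = - i qualify and give mutually inverse maps. *)
Lemma diagonal_endomorphism (e : K) : e * e = -1 ->
  exists f : {lrmorphism A -> A}, (forall s, f (g s) = diagonal e s *: g s) /\
    forall m a, gr A m a -> gr A m (f a).
Proof.
move=> ee; have [F [ev [evX surj ker]]] := presentation_eval presA.
have [ev2 ev2X] := free_eval F (fun s => diagonal e s *: g s).
have rel0 p : H_relator i p -> ev2 p = 0.
  have d0 : diagonal e i0 = 1 by rewrite /diagonal eqxx.
  have d1 : diagonal e i1 = -1 by rewrite /diagonal !inord3_eq.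
  have d2 : diagonal e i2 = e by rewrite /diagonal !inord3_eq.
  case=> ->; rewrite !rmorphB /= ?[ev2 (_ *: _)]linearZ /= !rmorphM /= !ev2X ?d0 ?d1 ?d2 ?scale1r.
  - by rewrite -scalerAl -scalerAr !scalerA mulrNN mulr1 scale1r yy subrr.
  - rewrite -!scalerAl -!scalerAr !scalerA zy mulNr -cE -scaleNr scalerA -scalerBl.
    by rewrite !mulrN1 mulrNN opprK [e * i]mulrC subrr scale0r.
  - rewrite -!scalerAl -!scalerAr !scalerA.
    by rewrite -scalerBr yx -cE scalerA -scalerBl -mulrA ee mulrC subrr scale0r.
have [|f fE] := @lrmorphism_factor K F A A ev ev2 surj.
  move=> p /ker; elim=> [|u h w rh|u v _ hu _ hv]; first exact: rmorph0.
    by rewrite !rmorphM /= (rel0 _ rh) mulr0 mul0r.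
  by rewrite rmorphD /= hu hv addr0.
have fg s : f (g s) = diagonal e s *: g s by rewrite -{1}evX fE ev2X.
exists f; split; first exact: fg.
elim=> [|m IH] a ha.
  have [k ->] := (H_connected ii g1 presA cE a).1 ha.
  by rewrite linearZ /= rmorph1; apply: gr_alg.
have [k [a1 [a2 [a3 e1]]]] := left_decomposition ii presA cE a.
have -> : a = x * hcomp m a1 + y * hcomp m a2 + z * hcomp m a3.
  have := comp_hom m.+1 ha; rewrite eqxx => <-.
  rewrite e1 !raddfD /= (comp_hom _ (gr_alg A k)) add0r.
  by rewrite -[m.+1]add1n !(compMl _ _ (g1 _)).
have T s b : gr A m.+1 (f (g s * hcomp m b)).
  rewrite rmorphM /= fg -scalerAl; apply: gr_scale; rewrite -add1n.
  by apply: gr_mul => //; apply: IH; apply: comp_in.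
by rewrite !rmorphD; apply: grD; [apply: grD|]; apply: T.
Qed.

Lemma generators_ext (f h : {lrmorphism A -> A}) :
  (forall s, f (g s) = h (g s)) -> f =1 h.
Proof.
move=> e a; have [F [ev [evX surj ker]]] := presentation_eval presA.
have [p <-] := surj a; elim/free_ind_gen: p => [u v eu ev_|k u eu||s u eu].
- by rewrite !rmorphD /= eu ev_.
- by rewrite !linearZ /= eu.
- by rewrite !rmorph1.
- by rewrite !rmorphM /= evX eu e.
Qed.

Variables (psi : {lrmorphism A -> A}).
Hypothesis psiE : forall s, psi (g s) = diagonal (- i) s *: g s.
Variables (D : algType K) (t : {linear D -> A}) (gD : 'I_3 -> D).
Hypothesis t_inj : injective t.
Hypothesis t_gen : forall s, t (gD s) = g s.
Hypothesis t_mul : forall s a, t (gD s * a) = g s * psi (t a).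
Hypothesis t1 : t 1 = 1.

Notation xD := (gD i0).
Notation yD := (gD i1).
Notation zD := (gD i2).

Let d0 : diagonal (- i) i0 = 1. Proof. by rewrite /diagonal eqxx. Qed.
Let d1 : diagonal (- i) i1 = -1. Proof. by rewrite /diagonal !inord3_eq. Qed.
Let d2 : diagonal (- i) i2 = - i. Proof. by rewrite /diagonal !inord3_eq. Qed.

Lemma untwist_gen s u : t (gD s * gD u) = diagonal (- i) u *: (g s * g u).
Proof. by rewrite t_mul t_gen psiE scalerAr. Qed.

Lemma twist_yy : yD * yD = - (xD * xD).
Proof. by apply: t_inj; rewrite linearN /= !untwist_gen d1 d0 scale1r scaleN1r yy. Qed.

Lemma twist_zy : zD * yD = - (yD * zD).
Proof.
apply: t_inj; rewrite linearN /= !untwist_gen d1 d2 scaleN1r scaleNr opprK zy.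
by rewrite mulNr opprK -cE.
Qed.

Lemma twist_yx : yD * xD + xD * yD = - (zD * zD).
Proof.
apply: t_inj; rewrite linearN linearD /= !untwist_gen d0 d1 d2 scale1r scaleN1r.
by rewrite yx scaleNr opprK -cE.
Qed.
End Diagonal.

(** * The relation ideal of the twist, by rescaling words *)

Section TwistPresentation.
Variables (K : fieldType) (F : free_model K 'I_3) (i : K).
Hypothesis ii : i * i = -1.
Notation d := (diagonal (- i)).
Notation X s := (word (F := F) [:: s]).

Definition word_weight (w : seq 'I_3) : K := \prod_(s <- w) d s.

(** The factor between a word multiplied in D and the same word multiplied in H: putting s before w'
    applies psi to w', which has eigenvalue [word_weight w']. *)
Fixpoint word_scale (w : seq 'I_3) : K :=
  if w is s :: w' then word_scale w' * word_weight w' else 1.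

Lemma diagonal_neq0 s : d s != 0.
Proof.
have i0 := i_neq0 ii; rewrite /diagonal.
by case: ifP => _; [|case: ifP => _]; rewrite ?oppr_eq0 ?oner_neq0.
Qed.

Lemma word_weight_neq0 w : word_weight w != 0.
Proof.
rewrite /word_weight; elim: w => [|s w IH]; first by rewrite big_nil oner_neq0.
by rewrite big_cons mulf_neq0 ?diagonal_neq0.
Qed.

Lemma word_scale_neq0 w : word_scale w != 0.
Proof.
elim: w => [|s w IH] /=; first exact: oner_neq0.
by rewrite mulf_neq0 ?word_weight_neq0.
Qed.

Lemma word_weight_cat u v : word_weight (u ++ v) = word_weight u * word_weight v.
Proof. exact: big_cat. Qed.

Lemma word_scale_cat u v :
  word_scale (u ++ v) = word_scale u * word_scale v * word_weight v ^+ size u.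
Proof.
elim: u => [|s u IH] /=; first by rewrite expr0 mulr1 mul1r.
rewrite IH word_weight_cat exprS; ring.
Qed.

(** This isolates the factor that depends on the two middle letters, where a relator is inserted
    between u and v. *)
Lemma word_scale_split u a b v :
  word_scale (u ++ [:: a; b] ++ v) = word_scale u * (word_scale v *
    word_weight v ^+ (size u).+2) * (d b * (d a * d b) ^+ size u).
Proof.
rewrite word_scale_cat /= /word_weight !big_cons -/(word_weight v) !exprMn !exprS.
ring.
Qed.

(** As r is only linear, each u f v with u, v words is treated directly. The product d a * d b is
    the same for all terms of one relator, so the factor depending on the length of u is common to
    them; the remaining factor d b changes the coefficients into those of D. *)
Lemma rescaling_ideal (r : {linear F -> F}) :
  (forall w, r (word w) = (word_scale w)^-1 *: word w) ->
  forall p, ideal_gen (H_relator i (F := F)) p ->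
    ideal_gen (relator (-1) (-1) (-1) (-1) (F := F)) (r p).
Proof.
move=> rE.
have r2 u a b v : r (word u * (X a * X b) * word v) =
    (word_scale u * (word_scale v * word_weight v ^+ (size u).+2))^-1 *:
      ((d b * (d a * d b) ^+ size u)^-1 *: (word u * (X a * X b) * word v)).
  have -> : word u * (X a * X b) * word v = word (F := F) (u ++ [:: a; b] ++ v).
    by rewrite (word_cat u) (word_cat [:: a; b]) (@word_cons _ _ F a [:: b]) !mulrA.
  by rewrite rE word_scale_split invfM scalerA mulrC.
have d0 : d i0 = 1 by rewrite /diagonal eqxx.
have d1 : d i1 = -1 by rewrite /diagonal !inord3_eq.
have d2 : d i2 = - i by rewrite /diagonal !inord3_eq.
have rel u f v : H_relator i f ->
    ideal_gen (relator (-1) (-1) (-1) (-1) (F := F)) (r (word u * f * word v)).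
  have invNi : (- i)^-1 = i by apply: (mulfI (i_neq0 ii)); rewrite invrN mulrN mulfV ?i_neq0 // ii.
  have W (k : K) P q : relator (-1) (-1) (-1) (-1) q ->
      P = k *: (word u * q * word v) -> ideal_gen (relator (-1) (-1) (-1) (-1) (F := F)) P.
    by move=> rq ->; apply: ideal_genZ; constructor.
  (* The ratios of these factors within one relator do not depend on the length of u; the next four
     identities record them. *)
  pose q a b := (d b * (d a * d b) ^+ size u)^-1.
  have q11 : q i1 i1 = - q i0 i0.
    by rewrite /q d0 d1 mulrNN !mulN1r !mul1r invrN.
  have q21 : i * q i1 i2 = q i2 i1.
    by rewrite /q d1 d2 [- i * -1]mulrC !invfM invNi mulrA ii invrN1.
  have q01 : q i0 i1 = - q i1 i0.
    by rewrite /q d0 d1 !mulr1 !mul1r mulN1r invrN.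
  have q22 : i * q i2 i2 = - q i1 i0.
    by rewrite /q d0 d1 d2 mulrNN ii !mulr1 invfM invNi mulrA ii mul1r mulN1r.
  case=> ->.
  - rewrite mulrBr mulrBl linearB !r2 -!/(q _ _) -scalerBr q11 scaleNr -opprD -scalerDr.
    rewrite scalerN -scaleNr scalerA.
    apply: W (Or31 _ _ (erefl _)) _.
    by rewrite scaleN1r opprK mulrDr mulrDl.
  - rewrite mulrBr mulrBl linearB -scalerAr -scalerAl linearZ /= !r2 -!/(q _ _) -q21.
    set m := _^-1; rewrite !scalerA.
    have -> : - i * (m * q i1 i2) = - (m * (i * q i1 i2)) by ring.
    rewrite scaleNr opprK -scalerDr; apply: W (Or32 _ _ (erefl _)) _.
    by rewrite scaleN1r opprK mulrDr mulrDl.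
  - rewrite !(mulrBr, mulrBl) !linearB -!scalerAr -!scalerAl !linearZ /= !r2 -!/(q _ _).
    set m := _^-1; rewrite !scalerN !scalerA.
    have -> : i * (m * q i2 i2) = - (m * q i1 i0) by rewrite -mulrN -q22; ring.
    rewrite q01 mulrN !scaleNr !opprK -!scalerDr; apply: W (Or33 _ _ (erefl _)) _.
    by rewrite !scaleN1r !opprK !(mulrDr, mulrDl).
move=> p; elim=> [|u f v rf|u v _ hu _ hv]; first by rewrite linear0; constructor.
  elim/free_ind: u => [|u u' hu hu'|k u].
  - by rewrite !mul0r linear0; constructor.
  - by rewrite !mulrDl linearD; constructor.
  elim/free_ind: v => [|v v' hv hv'|l v].
  - by rewrite mulr0 linear0; constructor.
  - by rewrite mulrDr linearD; constructor.
  rewrite -scalerAr -!scalerAl !linearZ /=; do 2!apply: ideal_genZ; exact: rel.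
by rewrite linearD; constructor.
Qed.
End TwistPresentation.

(** * Central quadrics in the twist *)

Section Centrality.
Variables (K : fieldType) (A : algType K) (F : free_model K 'I_3).
Variables (ev : {lrmorphism F -> A}) (g : 'I_3 -> A).
Hypothesis evX : forall s, ev (word [:: s]) = g s.
Hypothesis surj : forall a, exists p, ev p = a.
Notation x := (g i0).
Notation y := (g i1).
Notation z := (g i2).
Variables (c : A).
Hypothesis cC : forall a, c * a = a * c.
Hypothesis cc : c * c = -1.
Hypothesis yy : y * y = - (x * x).
Hypothesis zy : z * y = - (y * z).
Hypothesis yx : y * x + x * y = - (z * z).

Lemma central_of_generators (a : A) :
  (forall s, a * g s = g s * a) -> central a.
Proof.
move=> h b; have [p <-] := surj b; elim/free_ind_gen: p => [u v eu ev_|k u eu||s u eu].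
- by rewrite !rmorphD /= mulrDr mulrDl eu ev_.
- by rewrite !linearZ /= -scalerAr -scalerAl eu.
- by rewrite rmorph1 mulr1 mul1r.
- by rewrite rmorphM /= evX mulrA h -!mulrA eu.
Qed.

Lemma quadrics_central k : central (quadrics 1 g k).
Proof.
(* Here z^2 = - (y x + x y), which commutes with x because x^2 = - y^2 commutes with y. *)
have zzx : z * z * x = x * (z * z).
  have zz : z * z = - (y * x + x * y) by rewrite yx opprK.
  transitivity (- (y * (x * x)) - x * y * x); first by rewrite zz; nc_ring cC cc.
  transitivity (- (x * x * y) - x * y * x); last by rewrite zz; nc_ring cC cc.
  by rewrite -[x * x]opprK -yy; nc_ring cC cc.
have xzx : (x * z + z * x) * x = x * (x * z + z * x).
  transitivity (x * z * x + z * (x * x)); first by nc_ring cC cc.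
  transitivity (x * z * x + x * x * z); last by nc_ring cC cc.
  rewrite -[x * x]opprK -yy; transitivity (x * z * x - z * y * y); first by nc_ring cC cc.
  rewrite zy; transitivity (x * z * x + y * (z * y)); first by nc_ring cC cc.
  by rewrite zy; nc_ring cC cc.
have xzy : (x * z + z * x) * y = y * (x * z + z * x).
  transitivity (x * (z * y) + z * (y * x + x * y) - z * y * x); first by nc_ring cC cc.
  rewrite yx zy; transitivity (- (x * y) * z + - (z * z) * z + y * z * x); first by nc_ring cC cc.
  by rewrite -yx; nc_ring cC cc.
apply: central_of_generators => s; rewrite /quadrics scale1r.
case: (ord3P k); rewrite ?eqxx ?inord3_eq //=; case: (ord3P s) => //.
- by rewrite mulrA.
- by rewrite -[x * x]opprK -yy; nc_ring cC cc.
- rewrite -[x * x]opprK -yy; transitivity (- (y * (y * z))); first by nc_ring cC cc.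
  rewrite -[y * z]opprK -zy; transitivity (- (- (y * z) * y)); first by nc_ring cC cc.
  by rewrite -zy; nc_ring cC cc.
- transitivity (z * (z * y)); first by nc_ring cC cc.
  rewrite zy; transitivity (- (z * y) * z); first by nc_ring cC cc.
  by rewrite zy; nc_ring cC cc.
- by rewrite mulrA.
- transitivity (x * (z * z) + z * x * z); first by nc_ring cC cc.
  by rewrite -zzx; nc_ring cC cc.
Qed.
End Centrality.

Lemma cmu_ones (K : fieldType) : cmu (-1) (-1) 1 = const_mx 1 :> 'M[K]_3.
Proof.
apply/matrixP=> a b; rewrite !mxE invrN1 invr1 opprK.
by do 6!case: ifP => _ //.
Qed.

Section TwistClifford.
Variables (K : fieldType) (i : K) (A : graded_alg K) (g : 'I_3 -> A).
Hypothesis char2 : 2%:R != 0 :> K.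
Hypothesis ii : i * i = -1.
Hypothesis presA : presents g (H_rel i).
Variables (psi : {lrmorphism A -> A}).
Hypothesis psiE : forall s, psi (g s) = diagonal (- i) s *: g s.
Variables (D : graded_alg K) (t : {linear D -> A}) (gD : 'I_3 -> D).
Hypothesis gD1 : forall s, gr D 1 (gD s).
Hypothesis t_inj : injective t.
Hypothesis t_gen : forall s, t (gD s) = g s.
Hypothesis t_mul : forall s a, t (gD s * a) = g s * psi (t a).
Hypothesis t1 : t 1 = 1.

Lemma psi_word (F : free_model K 'I_3) (ev : {lrmorphism F -> A}) w :
  (forall s, ev (word [:: s]) = g s) ->
  psi (ev (word w)) = word_weight i w *: ev (word w).
Proof.
move=> evX; elim: w => [|s w IH].
  by rewrite word_nil !rmorph1 /word_weight big_nil scale1r.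
rewrite word_cons !rmorphM /= IH evX psiE -scalerAl -scalerAr scalerA.
by rewrite /word_weight big_cons.
Qed.

(** Through t, evaluation in D is evaluation in H preceded by the rescaling [up], with inverse [dn].
    Its kernel is therefore the image under [dn] of the relation ideal of H. *)
Lemma twist_graded_clifford : graded_clifford D.
Proof.
have [F [ev [evX surj ker]]] := presentation_eval presA.
have [evD evDX] := free_eval F gD.
have [up upE] := free_lift F (fun w => word_scale i w *: word (F := F) w).
have [dn dnE] := free_lift F (fun w => (word_scale i w)^-1 *: word (F := F) w).
have upK p : dn (up p) = p.
  elim/free_ind: p => [|u v eu ev_|k w]; first by rewrite !linear0.
    by rewrite !linearD /= eu ev_.
  rewrite !linearZ /= upE linearZ /= dnE !scalerA mulrAC -mulrA.
  by rewrite mulVf ?mulr1 // word_scale_neq0.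
have dnK p : up (dn p) = p.
  elim/free_ind: p => [|u v eu ev_|k w]; first by rewrite !linear0.
    by rewrite !linearD /= eu ev_.
  rewrite !linearZ /= dnE linearZ /= upE !scalerA -mulrA.
  by rewrite mulVf ?mulr1 // word_scale_neq0.
have tev p : t (evD p) = ev (up p).
  elim/free_ind: p => [|u v eu ev_|k w]; first by rewrite !linear0.
    by rewrite !linearD /= eu ev_.
  rewrite !linearZ /= upE; congr (k *: _); elim: w => [|s w IH].
    by rewrite word_nil linearZ /= !rmorph1 t1 scale1r.
  rewrite word_cons rmorphM /= evDX t_mul IH !linearZ /= (psi_word _ evX).
  by rewrite rmorphM /= evX scalerA -scalerAr.
have yy := twist_yy presA psiE t_inj t_gen t_mul.
have zy := twist_zy presA psiE t_inj t_gen t_mul.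
have yx := twist_yx presA psiE t_inj t_gen t_mul.
have surjD a : exists p, evD p = a.
  have [p pE] := surj (t a); exists (dn p).
  by apply: t_inj; rewrite tev dnK.
have kerD p : evD p = 0 <-> ideal_gen (relator (-1) (-1) (-1) (-1) (F := F)) p.
  split=> [p0|].
    rewrite -(upK p); apply: (rescaling_ideal ii dnE); apply/ker.
    by rewrite -tev p0 linear0.
  elim=> [|u f v rf|u v _ hu _ hv]; first exact: rmorph0.
    rewrite !rmorphM /= [T in _ * T * _](_ : _ = 0) ?mulr0 ?mul0r //.
    case: rf => ->; rewrite !scaleN1r !opprK ?rmorphD ?rmorphM /= !evDX.
    - by rewrite yy addNr.
    - by rewrite zy addNr.
    - by rewrite yx addNr.
  by rewrite rmorphD /= hu hv addr0.
exists 3%N, (cM (-1) (-1) (-1) 1), gD, (quadrics 1 gD).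
have N0 : -1 != 0 :> K by rewrite oppr_eq0 oner_neq0.
have cDC (a : D) : i%:A * a = a * i%:A by rewrite mulr_algl mulr_algr.
have cDc : i%:A * i%:A = -1 :> D by rewrite mulr_algl scalerA ii scaleN1r.
have cen k : central (quadrics 1 gD k) by apply: (quadrics_central evDX surjD cDC cDc).
split=> //; rewrite -cmu_ones.
apply: (gsca_of_relators N0 N0 (oner_neq0 K) char2 evDX) => // k a.
by split; exists a; rewrite cen.
Qed.
End TwistClifford.

Theorem lemma4p1 (K : closedFieldType) (char_neq2 : 2%:R != 0 :> K)
    (i : K) (i_prim : 4.-primitive_root i)
    (H : graded_alg K) (g : 'I_3 -> H)
    (g_degree1 : forall j, gr H 1 (g j))
    (H_presented : presents g (H_rel i)) :
  regular_gsca H /\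
  exists D : graded_alg K,
    graded_clifford D /\
    exists phi : {lrmorphism D -> D},
      graded_automorphism phi /\ is_twist H phi.
Proof.
have ii : i * i = -1.
  have i4 := prim_expr_order i_prim.
  have i2 : i ^+ 2 != 1 by rewrite -(prim_order_dvd i_prim).
  have : (i ^+ 2 - 1) * (i ^+ 2 + 1) = 0.
    by rewrite mulrDr mulr1 mulrBl mul1r -exprD i4 addrC addrA subrK subrr.
  move/eqP; rewrite mulf_eq0 subr_eq0 (negPf i2) /= => /eqP i2N.
  by apply/eqP; rewrite -addr_eq0 -i2N.
have cE (a : H) : i *: a = (i%:A : H) * a by rewrite mulr_algl.
split.
  split.
  - exact: (H_graded_skew_clifford char_neq2 ii g_degree1 H_presented cE).
  - exact: (H_quadratic g_degree1 H_presented).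
  - by exists 3%N; apply: (H_regular ii g_degree1 H_presented cE).
have NN : - i * - i = -1 by rewrite mulrNN.
have [psi [psiE psi_gr]] := diagonal_endomorphism ii g_degree1 H_presented NN.
have [phi [phiE phi_gr]] := diagonal_endomorphism ii g_degree1 H_presented ii.
have dd s : diagonal i s * diagonal (- i) s = 1.
  rewrite /diagonal; case: ifP => _; first exact: mulr1.
  by case: ifP => _; [rewrite mulrNN mulr1|rewrite mulrN ii opprK].
have psiK : cancel psi phi.
  apply: (generators_ext H_presented (f := phi \o psi) (h := idfun)) => s /=.
  by rewrite psiE linearZ /= phiE scalerA mulrC dd scale1r.
have phiK : cancel phi psi.
  apply: (generators_ext H_presented (f := psi \o phi) (h := idfun)) => s /=.
  by rewrite phiE linearZ /= psiE scalerA dd scale1r.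
exists (twist_graded psi_gr); split; last exact: (twist_automorphism _ phi_gr psiK phiK).
have [t [[t' tK t'K] t_gr t_mul]] := twist_graded_untwist psi_gr.
have t1 : t 1 = 1.
  have := t_mul 0%N 1 (t' 1) ((t_gr _ _).1 (gr_one _)).
  by rewrite mul1r t'K mulr1.
have tg s : t (t' (g s)) = g s by apply: t'K.
apply: (twist_graded_clifford char_neq2 ii H_presented psiE _ (can_inj tK) tg _ t1).
  by move=> s; apply/t_gr; rewrite tg; apply: g_degree1.
by move=> s a; rewrite (t_mul 1%N) tg.
Qed.
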